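(* Let $\Gamma\subset\mathbb{R}^{n}$ be a closed convex acute cone with vertex at the origin, let $\mathbf{h}\in\mathcal{S}'_{\Gamma}(E)$, let $\alpha\in\mathbb{R}$, and let $L$ be slowly varying at infinity. Then $\mathbf{h}$ is quasiasymptotically bounded of degree $\alpha$ at infinity with respect to $L$ in $\mathcal{S}'(\mathbb{R}^n,E)$ if and only if there exist numbers $k\in\mathbb{N}$ and $0\leq\kappa<1$ and a vector $\omega\in C_{\Gamma}$ such that $$\limsup_{\lambda\to0^{+}}\ \sup_{(x,\sigma)\in\partial\Omega^{\kappa},\ \sigma\neq0}\frac{\sigma^{k}\lambda^{n+\alpha}}{L(1/\lambda)}\left\|\mathcal{L}\{\mathbf{h};\lambda(x+i\sigma\omega)\}\right\|<\infty.$$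
   Context: $E$ is a Banach space with norm $\|\cdot\|$; $\mathbb{N}=\{0,1,2,\dots\}$; $\mathbb{H}^{n+1}=\mathbb{R}^{n}\times(0,\infty)$. $\mathcal{S}'(\mathbb{R}^{n},E)$ is the space of continuous linear mappings $\mathcal{S}(\mathbb{R}^{n})\to E$; $\mathcal{S}'_{\Gamma}(E)$ is the subspace of those supported by $\Gamma$. The conjugate cone is $\Gamma^{*}=\{\xi\in\mathbb{R}^{n}:\xi\cdot u\geq0\ \forall u\in\Gamma\}$; $\Gamma$ acute means that $\Gamma^{*}$ has non-empty interior; $C_{\Gamma}=\operatorname{int}\Gamma^{*}$ and $T^{C_{\Gamma}}=\mathbb{R}^{n}+iC_{\Gamma}$. The Laplace transform of $\mathbf{h}\in\mathcal{S}'_{\Gamma}(E)$ is the holomorphic $E$-valued function $\mathcal{L}\{\mathbf{h};z\}=\langle\mathbf{h}(u),e^{iz\cdot u}\rangle$, $z\in T^{C_{\Gamma}}$ (the pairing makes sense since, for such $z$, $e^{iz\cdot u}$ coincides for $u\in\Gamma$ with an element of $\mathcal{S}(\mathbb{R}^{n})$). For $\kappa\geq0$, $\Omega^{\kappa}=\{(x,\sigma)\in\mathbb{H}^{n+1}:|x|\leq\sigma^{\kappa}\text{ and }0<\sigma\leq1\}$, and $\partial\Omega^{\kappa}$ is its boundary. $L$ is slowly varying at infinity if it is a positive measurable function on some $(A,\infty)$ with $\lim_{\lambda\to\infty}L(a\lambda)/L(\lambda)=1$ for each $a>0$. $\mathbf{h}$ is quasiasymptotically bounded of degree $\alpha$ at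 infinity with respect to $L$ in $\mathcal{S}'(\mathbb{R}^n,E)$ if $\limsup_{\lambda\to\infty}\frac{1}{\lambda^{\alpha}L(\lambda)}\|\langle\mathbf{h}(\lambda u),\phi(u)\rangle\|<\infty$ for each $\phi\in\mathcal{S}(\mathbb{R}^{n})$, where $\langle\mathbf{h}(\lambda u),\phi(u)\rangle=\lambda^{-n}\langle\mathbf{h}(u),\phi(u/\lambda)\rangle$. *)

(* Defs.v *)
From HB Require Import structures.
From mathcomp Require Import all_boot all_order all_algebra.
From mathcomp Require Import all_classical all_reals all_analysis.
From mathcomp Require Import measurable_realfun.
From mathcomp Require Export complex.

Set Implicit Arguments.
Unset Strict Implicit.
Unset Printing Implicit Defensive.

Import Order.TTheory GRing.Theory Num.Theory.
Import numFieldNormedType.Exports.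

Local Open Scope classical_set_scope.
Local Open Scope ring_scope.
Local Open Scope complex_scope.

(* Norms over R[i] take values in R[i]; [rnorm] is the same number in R. *)
Definition rnorm (R : realType) (V : normedModType R[i]) (v : V) : R :=
  complex.Re `|v|.

(* The library norm on row vectors is the sup norm. *)
Definition enorm (R : realType) (n : nat) (x : 'rV[R]_n) : R :=
  Num.sqrt (\sum_(j < n) x 0 j ^+ 2).

Definition dotr (R : pzRingType) (n : nat) (x y : 'rV[R]_n) : R :=
  \sum_(j < n) x 0 j * y 0 j.

Definition cvec (R : pzRingType) (n : nat) (x : 'rV[R]_n) : 'rV[R[i]]_n :=
  map_mx (fun t => t%:C) x.

Definition cexp (R : realType) (w : R[i]) : R[i] :=
  (expR (complex.Re w) * cos (complex.Im w))
    +i* (expR (complex.Re w) * sin (complex.Im w)).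

Section Schwartz.
Context (R : realType) (n : nat).
Implicit Types (f : 'rV[R]_n -> R) (F G : 'rV[R]_n -> R[i]^o) (s : seq 'I_n).

(* s lists the coordinates along which f is successively differentiated;
   a multi-index is such a list up to order. *)
Definition partials s f : 'rV[R]_n -> R :=
  foldr (fun j g x => 'D_(delta_mx 0 j) g x) f s.

Definition smooth f : Prop := forall s,
  continuous (partials s f) /\
  forall j x, derivable (partials s f) x (delta_mx 0 j).

Definition cpartials s F : 'rV[R]_n -> R[i]^o := fun x =>
  partials s (@complex.Re R \o F) x +i* partials s (@complex.Im R \o F) x.

Definition weighted (k : nat) s F (x : 'rV[R]_n) : R :=
  (1 + enorm x) ^+ k * rnorm (cpartials s F x).

Definition is_schwartz F : Prop :=
  [/\ smooth (@complex.Re R \o F), smooth (@complex.Im R \o F) &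
      forall k s, has_ubound (range (weighted k s F))].

Definition schwartz_pred : {pred ('rV[R]_n -> R[i]^o)} :=
  mem [set F | is_schwartz F].

Record schwartz := Schwartz {
  schwartz_val :> 'rV[R]_n -> R[i]^o ;
  schwartz_valP : schwartz_val \in schwartz_pred }.

HB.instance Definition _ := [isSub for schwartz_val].
HB.instance Definition _ := [Choice of schwartz by <:].

Lemma derivable_lin (a b : R) f g x v : derivable f x v -> derivable g x v ->
  derivable (fun x => a * f x + b * g x) x v.
Proof.
move=> df dg.
exact: (derivableD (derivableM (derivable_cst a x v) df)
                   (derivableM (derivable_cst b x v) dg)).
Qed.

Lemma derive_lin (a b : R) f g x v : derivable f x v -> derivable g x v ->
  'D_v (fun x => a * f x + b * g x) x = a * 'D_v f x + b * 'D_v g x.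
Proof.
move=> df dg.
have da := derivableM (derivable_cst a x v) df.
have db := derivableM (derivable_cst b x v) dg.
have Da := deriveM (derivable_cst a x v) df.
have Db := deriveM (derivable_cst b x v) dg.
rewrite derive_cst scaler0 addr0 in Da; rewrite derive_cst scaler0 addr0 in Db.
exact: (etrans (deriveD da db) (congr2 +%R Da Db)).
Qed.

Lemma partials_lin s (a b : R) f g : smooth f -> smooth g ->
  partials s (fun x => a * f x + b * g x) =
  (fun x => a * partials s f x + b * partials s g x).
Proof.
move=> sf sg; elim: s => [//|j s IHs] /=; apply/funext => x.
have [_ /(_ j x) df] := sf s; have [_ /(_ j x) dg] := sg s.
by rewrite IHs derive_lin.
Qed.

Lemma smooth_lin (a b : R) f g : smooth f -> smooth g ->
  smooth (fun x => a * f x + b * g x).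
Proof.
move=> sf sg s; rewrite partials_lin//.
have [cf df] := sf s; have [cg dg] := sg s; split=> [x|j x].
  exact: (cvgD (cvgM (cvg_cst a) (cf x)) (cvgM (cvg_cst b) (cg x))).
exact: derivable_lin.
Qed.

Lemma ReZD (c : R[i]) F G : @complex.Re R \o (c *: F + G) =
  fun x => 1 * (complex.Re c * complex.Re (F x) +
                - complex.Im c * complex.Im (F x)) + 1 * complex.Re (G x).
Proof.
apply/funext => x; rewrite /= /GRing.add/= /GRing.scale/=.
by case: c (F x) (G x) => [a b] [p q] [r t] /=; rewrite !mul1r mulNr.
Qed.

Lemma ImZD (c : R[i]) F G : @complex.Im R \o (c *: F + G) =
  fun x => 1 * (complex.Re c * complex.Im (F x) +
                complex.Im c * complex.Re (F x)) + 1 * complex.Im (G x).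
Proof.
apply/funext => x; rewrite /= /GRing.add/= /GRing.scale/=.
by case: c (F x) (G x) => [a b] [p q] [r t] /=; rewrite !mul1r.
Qed.

Lemma cpartialsZD s (c : R[i]) F G : is_schwartz F -> is_schwartz G ->
  cpartials s (c *: F + G) = c *: cpartials s F + cpartials s G.
Proof.
move=> [sF tF _] [sG tG _]; rewrite /cpartials ReZD ImZD; apply/funext => x.
have l1 := smooth_lin (complex.Re c) (- complex.Im c) sF tF.
have l2 := smooth_lin (complex.Re c) (complex.Im c) tF sF.
rewrite (partials_lin s 1 1 l1 sG) (partials_lin s 1 1 l2 tG).
rewrite (partials_lin s _ _ sF tF) (partials_lin s _ _ tF sF).
by rewrite !mul1r mulNr; case: c {l1 l2}.
Qed.

Lemma enorm_ge0 (x : 'rV[R]_n) : 0 <= enorm x. Proof. exact: sqrtr_ge0. Qed.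

Lemma RnormE (V : normedModType R[i]) (v : V) : (rnorm v)%:C = `|v|.
Proof.
rewrite /rnorm; have := normr_ge0 v; case: `|v| => a b.
by rewrite lecE/= => /andP[/eqP ->].
Qed.

Lemma rnorm_ge0 (V : normedModType R[i]) (v : V) : 0 <= rnorm v.
Proof. by rewrite -lecR RnormE normr_ge0. Qed.

Lemma ler_rnormD (V : normedModType R[i]) (v w : V) :
  rnorm (v + w) <= rnorm v + rnorm w.
Proof. by rewrite -lecR rmorphD/= !RnormE ler_normD. Qed.

Lemma rnormZ (V : normedModType R[i]) (c : R[i]) (v : V) :
  rnorm (c *: v) = rnorm (c : R[i]^o) * rnorm v.
Proof.
by apply: (@complexI R); rewrite rmorphM/= !RnormE normrZ.
Qed.

Lemma weightedZD k s (c : R[i]) F G x : is_schwartz F -> is_schwartz G ->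
  weighted k s (c *: F + G) x <=
  rnorm (c : R[i]^o) * weighted k s F x + weighted k s G x.
Proof.
move=> sF sG; rewrite /weighted cpartialsZD// mulrCA -mulrDr.
apply: ler_wpM2l; first by rewrite exprn_ge0// addr_ge0// enorm_ge0.
by rewrite (le_trans (ler_rnormD _ _))// rnormZ.
Qed.

Lemma partials0 s : partials s (fun=> 0) = fun=> 0.
Proof. by elim: s => //= j s ->; apply/funext => x; exact: derive_cst. Qed.

Lemma smooth0 : smooth (fun=> 0).
Proof.
move=> s; rewrite partials0; split; first exact: cst_continuous.
by move=> j x; exact: derivable_cst.
Qed.

Lemma cpartials0 s : cpartials s 0 = 0.
Proof.
by apply/funext => x; exact: (congr2 (@Complex R) (congr1 (@^~ x) (partials0 s))
                                    (congr1 (@^~ x) (partials0 s))).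
Qed.

Lemma rnorm0 (V : normedModType R[i]) : rnorm (0 : V) = 0.
Proof. by rewrite /rnorm normr0. Qed.

Lemma weighted0 k s x : weighted k s 0 x = 0.
Proof. by rewrite /weighted cpartials0 rnorm0 mulr0. Qed.

Lemma is_schwartz0 : is_schwartz 0.
Proof.
split; [exact: smooth0|exact: smooth0|move=> k s].
by exists 0 => _ [x _ <-]; rewrite weighted0.
Qed.

Lemma schwartz_submod_closed : submod_closed schwartz_pred.
Proof.
split=> [|c F G]; first by rewrite inE; exact: is_schwartz0.
rewrite !inE => sF sG; have [F1 F2 F3] := sF; have [G1 G2 G3] := sG.
split; [by rewrite ReZD; exact: (smooth_lin _ _ (smooth_lin _ _ F1 F2) G1)|
        by rewrite ImZD; exact: (smooth_lin _ _ (smooth_lin _ _ F2 F1) G2)|].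
move=> k s; have [M ubM] := F3 k s; have [N ubN] := G3 k s.
exists (rnorm (c : R[i]^o) * M + N) => _ [x _ <-].
apply: (le_trans (weightedZD _ _ _ _ sF sG)); apply: lerD.
  by apply: ler_wpM2l; [exact: rnorm_ge0|apply: ubM; exists x].
by apply: ubN; exists x.
Qed.

HB.instance Definition _ :=
  GRing.isSubmodClosed.Build _ _ schwartz_pred schwartz_submod_closed.
HB.instance Definition _ := [SubChoice_isSubLmodule of schwartz by <:].

Definition seminorm (k : nat) s (phi : schwartz) : R :=
  sup (range (weighted k s phi)).

Lemma schwartzP (phi : schwartz) : is_schwartz phi.
Proof. by have := schwartz_valP phi; rewrite inE. Qed.

Lemma weighted_seminorm k s (phi : schwartz) x :
  weighted k s phi x <= seminorm k s phi.
Proof.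
have [_ _ /(_ k s) ub] := schwartzP phi.
by apply: ub_le_sup => //; exists x.
Qed.

Lemma seminorm0 k s : seminorm k s 0 = 0.
Proof.
rewrite /seminorm -[RHS]sup1; congr sup; apply/seteqP; split=> [_ [x _ <-]|_ ->].
  exact: weighted0.
by exists 0 => //; exact: weighted0.
Qed.

Lemma seminormD k s (phi psi : schwartz) :
  seminorm k s (phi + psi) <= seminorm k s phi + seminorm k s psi.
Proof.
apply: ge_sup; first by exists (weighted k s (phi + psi : schwartz) 0), 0.
move=> _ [x _ <-].
have := @weightedZD k s 1 _ _ x (schwartzP phi) (schwartzP psi).
rewrite scale1r [rnorm _](_ : _ = 1) ?mul1r; last by rewrite /rnorm normr1.
move=> /le_trans; apply.
by apply: lerD; exact: weighted_seminorm.
Qed.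

(* The locally convex topology generated by the seminorms. *)
Definition schwartz_nbhs (phi : schwartz) : set_system schwartz :=
  [set A | exists (N : nat) (e : R), 0 < e /\
     forall psi : schwartz,
       (forall k s, (k <= N)%N -> (size s <= N)%N ->
          seminorm k s (psi - phi) < e) -> A psi].

HB.instance Definition _ := hasNbhs.Build schwartz schwartz_nbhs.

Lemma schwartz_nbhs_singleton (phi : schwartz) (A : set schwartz) :
  nbhs phi A -> A phi.
Proof.
by move=> [N [e [e0]]]; apply=> k s _ _; rewrite subrr seminorm0.
Qed.

Lemma schwartz_nbhs_filter (phi : schwartz) : ProperFilter (nbhs phi).
Proof.
split; first by move/schwartz_nbhs_singleton.
split; first by exists 0, 1.
- move=> A B [N [e [e0 NA]]] [M [d [d0 MB]]].
  exists (maxn N M), (Num.min e d); split; first by rewrite lt_min e0.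
  move=> psi H; split; [apply: NA|apply: MB] => k s kN sN.
    have := H k s (leq_trans kN (leq_maxl _ _)) (leq_trans sN (leq_maxl _ _)).
    by rewrite lt_min => /andP[].
  have := H k s (leq_trans kN (leq_maxr _ _)) (leq_trans sN (leq_maxr _ _)).
  by rewrite lt_min => /andP[].
- move=> A B AB [N [e [e0 NA]]]; exists N, e; split=> // psi H.
  exact/AB/NA.
Qed.

Lemma schwartz_nbhs_nbhs (phi : schwartz) (A : set schwartz) :
  nbhs phi A -> nbhs phi (nbhs^~ A).
Proof.
move=> [N [e [e0 NA]]]; exists N, (e / 2); split; first by rewrite divr_gt0.
move=> psi H; exists N, (e / 2); split; first by rewrite divr_gt0.
move=> chi H'; apply: NA => k s kN sN.
have -> : chi - phi = (chi - psi) + (psi - phi) by rewrite addrA subrK.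
apply: le_lt_trans (seminormD _ _ _ _) _.
by rewrite [ltRHS](splitr e); apply: ltrD; [exact: H'|exact: H].
Qed.

HB.instance Definition _ := Nbhs_isNbhsTopological.Build schwartz
  schwartz_nbhs_filter schwartz_nbhs_singleton schwartz_nbhs_nbhs.

Lemma cvg_derive_scale (c : R) f x v : c != 0 -> derivable f (c *: x) v ->
  h^-1 *: (((fun u => f (c *: u)) \o shift x) (h *: v) - f (c *: x))
    @[h --> 0^'] --> c * 'D_v f (c *: x).
Proof.
move=> c0 df.
have ch : (c * h) @[h --> 0^'] --> (0 : R)^'.
  move=> A [e /= e0 eA]; exists (e / `|c|) => /=.
    by rewrite divr_gt0// normr_gt0.
  move=> h /=; rewrite sub0r normrN => he h0; apply: eA => /=.
    by rewrite sub0r normrN normrM mulrC -ltr_pdivlMr ?normr_gt0.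
  by rewrite mulf_neq0.
have -> : (fun h : R => h^-1 *: (((fun u => f (c *: u)) \o shift x) (h *: v)
      - f (c *: x) : R^o)) = ((fun=> c) \* ((fun h : R => h^-1 *:
      ((f \o shift (c *: x)) (h *: v) - f (c *: x))) \o *%R c)).
  apply/funext => h /=; rewrite (scalerDr c (h *: v) x) (scalerA c h v).
  by rewrite -[in RHS]mulr_algl [RHS]mulrA scaler1 invfM mulrA divff// mul1r.
exact: (cvgM (cvg_cst c) (cvg_comp _ _ ch df)).
Qed.

Lemma partials_scale s (c : R) f : c != 0 -> smooth f ->
  partials s (fun u => f (c *: u)) =
  (fun x => c ^+ size s * partials s f (c *: x)).
Proof.
move=> c0 sf; elim: s => [|j s IHs]; first by apply/funext => x /=; rewrite mul1r.
apply/funext => x /=; rewrite IHs.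
have [_ /(_ j (c *: x)) df] := sf s.
have dg := cvg_derive_scale c0 df.
have Dg : derivable (fun u => partials s f (c *: u)) x (delta_mx 0 j).
  by apply/cvg_ex; exists (c * 'D_(delta_mx 0 j) (partials s f) (c *: x)).
have Eg := cvg_lim (@Rhausdorff R) dg.
have E := deriveM (derivable_cst (c ^+ size s) x (delta_mx 0 j)) Dg.
rewrite derive_cst scaler0 addr0 in E.
by rewrite exprSr -mulrA -Eg; exact: E.
Qed.

Lemma smooth_scale (c : R) f : c != 0 -> smooth f ->
  smooth (fun u => f (c *: u)).
Proof.
move=> c0 sf s; rewrite partials_scale//.
have [cf df] := sf s; split=> [x|j x].
  have cs : {for x, continuous (fun u : 'rV[R]_n => c *: u)}.
    exact: scaler_continuous.
  have cfs : {for x, continuous (fun u : 'rV[R]_n => partials s f (c *: u))}.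
    exact: (continuous_comp cs (cf (c *: x))).
  exact: (cvgM (cvg_cst (c ^+ size s)) cfs).
have Dg : derivable (fun u => partials s f (c *: u)) x (delta_mx 0 j).
  apply/cvg_ex; exists (c * 'D_(delta_mx 0 j) (partials s f) (c *: x)).
  exact: cvg_derive_scale.
exact: (derivableM (derivable_cst (c ^+ size s) x (delta_mx 0 j)) Dg).
Qed.

Lemma enormZ (c : R) (x : 'rV[R]_n) : enorm (c *: x) = `|c| * enorm x.
Proof.
rewrite /enorm -sqrtr_sqr -sqrtrM ?sqr_ge0// mulr_sumr.
by congr Num.sqrt; apply: eq_bigr => j _; rewrite mxE exprMn.
Qed.

Lemma is_schwartz_scale (c : R) F : c != 0 -> is_schwartz F ->
  is_schwartz (fun u => F (c *: u)).
Proof.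
move=> c0 [F1 F2 F3]; split.
- exact: (smooth_scale c0 F1).
- exact: (smooth_scale c0 F2).
move=> k s; have [M ubM] := F3 k s.
pose K := Num.max 1 `|c|^-1.
exists (K ^+ k * (`|c| ^+ size s * M)) => _ [x _ <-].
have K0 : 0 <= K by rewrite le_max ler01.
have wM : weighted k s F (c *: x) <= M by apply: ubM; exists (c *: x).
have -> : weighted k s (fun u => F (c *: u)) x =
    (1 + enorm x) ^+ k *
    (`|c| ^+ size s * rnorm (cpartials s F (c *: x))).
  rewrite /weighted; congr (_ * _).
  have -> : cpartials s (fun u => F (c *: u)) x =
      (c ^+ size s)%:C *: cpartials s F (c *: x).
    have E1 := congr1 (@^~ x) (partials_scale s c0 F1).
    have E2 := congr1 (@^~ x) (partials_scale s c0 F2).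
    apply: (etrans (congr2 (@Complex R) E1 E2)).
    by rewrite /GRing.scale/= /GRing.mul/= !mul0r subr0 addr0.
  rewrite rnormZ; congr (_ * _).
  by rewrite /rnorm normc_def/= expr0n addr0 sqrtr_sqr normrX.
apply: (@le_trans _ _ (K ^+ k * (`|c| ^+ size s * weighted k s F (c *: x))));
  last first.
  by rewrite ler_wpM2l ?exprn_ge0// ler_wpM2l ?exprn_ge0.
rewrite /weighted [_ ^+ size s * (_ * _)]mulrCA [leRHS]mulrA -exprMn.
rewrite ler_wpM2r ?mulr_ge0 ?exprn_ge0 ?rnorm_ge0//.
rewrite lerXn2r ?nnegrE ?mulr_ge0 ?addr_ge0 ?enorm_ge0//.
rewrite mulrDr mulr1 lerD// ?le_max ?lexx//.
rewrite enormZ mulrA ler_peMl ?enorm_ge0//.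
by rewrite -ler_pdivrMr ?normr_gt0// div1r le_max lexx orbT.
Qed.

(* [insubd 0 F] is the test function F when F is Schwartz and 0 otherwise. *)
Definition dilate (lambda : R) (phi : schwartz) : schwartz :=
  insubd 0 (fun u => phi (lambda^-1 *: u)).

Lemma dilateE (lambda : R) (phi : schwartz) : lambda != 0 ->
  dilate lambda phi = (fun u => phi (lambda^-1 *: u)) :> ('rV[R]_n -> R[i]^o).
Proof.
move=> l0; rewrite /dilate insubdK// inE.
by apply: is_schwartz_scale; [rewrite invr_eq0|exact: schwartzP].
Qed.

End Schwartz.

Section Distributions.
Context (R : realType) (n : nat) (E : completeNormedModType R[i]).
Implicit Types (Gamma : set 'rV[R]_n) (h : {linear schwartz R n -> E}).

Definition tsupport (phi : schwartz R n) : set 'rV[R]_n :=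
  closure [set u | phi u != 0].

Definition supported_by Gamma h : Prop := forall phi : schwartz R n,
  compact (tsupport phi) -> tsupport phi `&` Gamma = set0 -> h phi = 0.

Definition is_cone Gamma : Prop :=
  Gamma 0 /\ forall (t : R) u, 0 < t -> Gamma u -> Gamma (t *: u).

Definition conj_cone Gamma : set 'rV[R]_n :=
  [set xi | forall u, Gamma u -> 0 <= dotr xi u].

Definition open_conj_cone Gamma : set 'rV[R]_n := (conj_cone Gamma)°.

Definition acute Gamma : Prop := open_conj_cone Gamma !=set0.

(* For h supported by Gamma, <h, phi> depends only on phi near Gamma, and not
   in general on the restriction of phi to Gamma (take Gamma = {0} and h a
   derivative of the Dirac mass).  So e^{i z.u} is replaced by any Schwartz
   function equal to it on an open neighbourhood of Gamma; there is one for
   every z with imaginary part in [open_conj_cone Gamma]. *)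
Definition laplace Gamma h (z : 'rV[R[i]]_n) : E :=
  h (xget 0 [set phi : schwartz R n | exists U : set 'rV[R]_n,
       [/\ open U, Gamma `<=` U &
           forall u, U u -> phi u = cexp ('i%C * dotr z (cvec u))]]).

Definition pairing_dilate h (lambda : R) (phi : schwartz R n) : E :=
  (lambda ^- n)%:C *: h (dilate lambda phi).

Definition quasiasymptotically_bounded h (alpha : R) (L : R -> R) : Prop :=
  forall phi : schwartz R n,
    (limf_esup (fun lambda : R =>
       ((lambda `^ alpha * L lambda)^-1 *
          rnorm (pairing_dilate h lambda phi))%:E)
     (pinfty_nbhs R) < +oo)%E.

Definition Omega (kappa : R) : set ('rV[R]_n * R) :=
  [set p | [/\ enorm p.1 <= p.2 `^ kappa, 0 < p.2 & p.2 <= 1]].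

End Distributions.

Arguments Omega {R} n kappa.

Definition boundary (T : topologicalType) (A : set T) : set T :=
  closure A `\` A°.

(* Measurability is with respect to the Lebesgue sigma-algebra, i.e. the
   completion of the Borel one, on the domain. *)
Definition slowly_varying (R : realType) (L : R -> R) : Prop :=
  exists A : R,
    [/\ forall x, A < x -> 0 < L x,
        @measurable_fun _ _
          (g_sigma_algebraType (completed_algebra_gen (@lebesgue_measure R)))
          (measurableTypeR R) `]A, +oo[ L &
        forall a : R, 0 < a ->
          L (a * lambda) / L lambda @[lambda --> +oo] --> (1 : R)].

(* Main.v *)
(* Write t = omega.u, l(e) = e^-(n+alpha) L(1/e), and let chi be a smooth cutoff
   of a neighbourhood of Gamma, so that L{h; x + i s omega} = <h, chi e^{ix.u} e^{-st}>.

   Necessity (kappa = 0). The functions s^k chi e^{ix.u} e^{-st}, |x| <= 1, 0 < s <= 1,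
   are bounded in any finite number of Schwartz norms for k large. If the supremum
   were unbounded for every k, a uniform boundedness argument would sum near-maximal
   such functions into one test function violating quasiasymptotic boundedness.

   Sufficiency. L satisfies a Potter type bound, by a Steinhaus argument on measurable
   sets, and since kappa < 1 the dilations of the boundary of Omega^kappa sweep the half
   space with polynomial control; hence |L{h; e(x + i s omega)}| <= C ((1+|x|)/s)^M l(e)
   for all x, all s in (0,1] and small e. A compactly supported psi is the limit of its
   discrete Fourier interpolants on finer and larger grids, whose coefficients decay
   rapidly, uniformly in the grid; this bounds |<h, (chi e^{-st} psi)(e u)>| by C s^-M l(e) |psi|.
   Finally phi is a sum of dyadic pieces, the i-th supported where |u| ~ 2^i; taking
   s = 2^-i there costs 2^{iM}, which the decay of phi absorbs. *)

Require Import Defs.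
From mathcomp Require Import all_boot all_order all_algebra.
From mathcomp Require Import all_classical all_reals all_analysis.
From mathcomp Require Import measurable_realfun complex ring lra.

Set Implicit Arguments.
Unset Strict Implicit.
Unset Printing Implicit Defensive.

Import Order.TTheory GRing.Theory Num.Theory.
Import numFieldNormedType.Exports.

Local Open Scope classical_set_scope.
Local Open Scope ring_scope.
Local Open Scope complex_scope.

(** * Smooth functions *)

(** No E-valued integral is ever formed: Fourier inversion is replaced by finite sums of
    exponentials, on which linearity of h suffices, and limits are taken in the Schwartz norms only.
    Continuity of h enters through one inequality, |<h, f>| <= C |f|_N ([hr_bound]), whose constants
    are unrelated to alpha and L. Applied to exponentials it gives an a priori bound of the Laplace
    transform on a strip, which keeps suprema finite and covers the points that the boundary
    hypothesis, valid for small lambda only, does not reach. The analysis is done on real functions: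
    e^{ix.u} is split into cos(x.u + c) with c = 0 or c = -pi/2, and the values of the transform at
    x and -x together control both pairings. The damping e^{-st} cannot be sent to 1, since the tube
    bound blows up like s^-M. It is cancelled on each compact piece by a factor e^{st}, which is
    harmless only where st stays bounded; this ties s to the size of the piece and dictates a dyadic
    decomposition. *)

Lemma eq_lerW (R : numDomainType) (a b : R) : a = b -> a <= b.
Proof. by move=> ->. Qed.

(** A quadratic remainder identifies the derivative without a limit computation. It serves at the
    origin for [flat] and for limits of functions in [rschw_complete], where such remainders pass to
    the limit. *)
Lemma is_derive_quadratic (R : realType) (V : normedModType R) (f : V -> R)
    (x v : V) (d C : R) :
  (forall h : R, `|f (h *: v + x) - f x - h * d| <= C * h ^+ 2) ->
  is_derive x v f d.
Proof.
move=> H.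
have C0 : 0 <= C by have := le_trans (normr_ge0 _) (H 1); rewrite expr1n mulr1.
have cv : h^-1 *: ((f \o shift x) (h *: v) - f x) @[h --> 0^'] --> d.
  apply/cvgrPdistC_le => e e0; near=> h.
  have h0 : h != 0 by near: h; exact: nbhs_dnbhs_neq.
  have -> : h^-1 *: ((f \o shift x) (h *: v) - f x) - d =
      h^-1 * (f (h *: v + x) - f x - h * d).
    by rewrite mulrBr mulrA mulVf// mul1r.
  rewrite normrM normfV mulrC ler_pdivrMr ?normr_gt0//.
  rewrite (le_trans (H h))// -(real_normK (num_real h)) expr2 mulrA.
  rewrite ler_wpM2r// (@le_trans _ _ ((C + 1) * `|h|)) ?ler_wpM2r ?lerDl//.
  rewrite mulrC -ler_pdivlMr ?ltr_wpDl//; near: h.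
  have p0 : 0 < e / (C + 1) by rewrite divr_gt0// ltr_wpDl.
  apply: (@cvg_within _ (nbhs (0 : R))); apply/nbhs_ballP.
  exists (e / (C + 1)) => //= h; rewrite /ball/= sub0r normrN => /ltW.
  by [].
by split; [apply/cvg_ex; exists d|exact: cvg_lim cv].
Unshelve. all: by end_near. Qed.

Section Calculus.
Context (R : realType) (n : nat).
Implicit Types (f g : 'rV[R]_n -> R) (x u v : 'rV[R]_n) (s : seq 'I_n).

Local Notation e_ j := (delta_mx 0 j : 'rV[R]_n).

Lemma is_derive_lineP f x v d :
  is_derive x v f d <-> is_derive (0 : R) 1 (fun h => f (h *: v + x)) d.
Proof.
have E : (fun h : R => h^-1 *: (((fun h : R => f (h *: v + x)) \o shift 0) (h *: 1)
    - f (0 *: v + x))) = (fun h => h^-1 *: ((f \o shift x) (h *: v) - f x)).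
  by apply/funext => h /=; rewrite addr0 scale0r add0r [_%:A]mulr1.
by split=> -[c ed]; split; rewrite /derivable /derive ?E// -E.
Qed.

Lemma is_derive_line f x v (t : R) :
  (forall y, derivable f y v) ->
  is_derive t 1 (fun h => f (h *: v + x)) ('D_v f (t *: v + x)).
Proof.
move=> df; have /is_derive_lineP H := derivableP (df (t *: v + x)).
have -> : (fun h => f (h *: v + x)) =
    (fun h : R => f (h *: v + (t *: v + x))) \o (fun h : R => h - t).
  by apply/funext => h /=; rewrite addrA -scalerDl subrK.
have H' : is_derive ((fun h : R => h - t) t) 1 (fun h : R => f (h *: v + (t *: v + x)))
   ('D_v f (t *: v + x)) by rewrite /= subrr.
have H2 : is_derive t 1 (fun h : R => h - t) 1 := is_derive_shift t 1 (- t).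
have := @is_derive1_comp R (fun h : R => f (h *: v + (t *: v + x)))
  (fun h => h - t) t _ _ H' H2.
by rewrite mulr1.
Qed.

Lemma line_MVT f x v (t B : R) : (forall y, derivable f y v) -> 0 <= B ->
  (forall r : R, `|r| <= `|t| -> `|'D_v f (r *: v + x)| <= B) ->
  `|f (t *: v + x) - f x| <= B * `|t|.
Proof.
move=> df B0 H.
pose F (h : R) := f (h *: v + x).
have dF (r : R) : is_derive r 1 F ('D_v f (r *: v + x)) by exact: is_derive_line.
have cF (a b : R) : {within `[a, b], continuous F}.
  apply: continuous_subspaceT => r.
  by apply/differentiable_continuous/derivable1_diffP; have [] := dF r.
have -> : f x = F 0 by rewrite /F scale0r add0r.
have [t0|t0] := leP 0 t.
  have [c cin ->] := MVT_segment t0 (fun r _ => dF r) (cF _ _).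
  rewrite subr0 normrM ler_wpM2r//; apply: H.
  move: cin; rewrite in_itv/= => /andP[c0 ct].
  by rewrite !ger0_norm.
have [c cin E] := MVT_segment (ltW t0) (fun r _ => dF r) (cF _ _).
rewrite -normrN opprB E sub0r normrM normrN ler_wpM2r//; apply: H.
move: cin; rewrite in_itv/= => /andP[c0 ct].
by rewrite !ler0_norm ?lerN2// ltW.
Qed.

(** Mean value theorem for f(x + hv) - h D_v f(x), whose derivative is estimated by a second use of
    it; hence the constant B and not B / 2. *)
Lemma line_taylor f x v (t B : R) : (forall y, derivable f y v) ->
  (forall y, derivable (fun y => 'D_v f y) y v) -> 0 <= B ->
  (forall y, `|'D_v (fun y => 'D_v f y) y| <= B) ->
  `|f (t *: v + x) - f x - t * 'D_v f x| <= B * t ^+ 2.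
Proof.
move=> df ddf B0 H.
pose F (h : R) := f (h *: v + x) - h * 'D_v f x.
have dF (r : R) : is_derive r 1 F ('D_v f (r *: v + x) - 'D_v f x).
  have H1 := is_derive_line x r df.
  have H2 : is_derive r 1 (fun h : R => h * 'D_v f x) ('D_v f x).
    have E : (fun h : R => h * 'D_v f x) = 'D_v f x \*: (id : R -> R).
      by apply/funext => h; rewrite /= mulrC.
    by rewrite E; apply: is_derive_eq; rewrite [_ *: _]mulr1.
  exact: (is_deriveB H1 H2).
have cF (a b : R) : {within `[a, b], continuous F}.
  apply: continuous_subspaceT => r.
  by apply/differentiable_continuous/derivable1_diffP; have [] := dF r.
have -> : f (t *: v + x) - f x - t * 'D_v f x = F t - F 0.
  by rewrite /F scale0r add0r mul0r subr0 addrAC.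
have Hd (r : R) : `|'D_v f (r *: v + x) - 'D_v f x| <= B * `|r|.
  exact: (line_MVT ddf B0 (fun _ _ => H _)).
have [t0|t0] := leP 0 t.
  have [c cin ->] := MVT_segment t0 (fun r _ => dF r) (cF _ _).
  move: cin; rewrite in_itv/= => /andP[c0 ct].
  rewrite subr0 normrM expr2 mulrA (ger0_norm t0) ler_wpM2r//.
  by rewrite (le_trans (Hd _))// ler_wpM2l// (ger0_norm c0).
have [c cin E] := MVT_segment (ltW t0) (fun r _ => dF r) (cF _ _).
move: cin; rewrite in_itv/= => /andP[c0 ct].
rewrite -normrN opprB E sub0r normrM normrN.
rewrite -(real_normK (num_real t)) expr2 mulrA ler_wpM2r//.
by rewrite (le_trans (Hd _))// ler_wpM2l// (ler0_norm ct) ltr0_norm// lerN2.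
Qed.

Lemma partials_rcons s j f :
  partials (rcons s j) f = partials s (fun x => 'D_(e_ j) f x).
Proof. by rewrite /partials foldr_rcons. Qed.

Lemma smooth_continuous f : smooth f -> continuous f.
Proof. by move=> /(_ [::])[]. Qed.

Lemma smooth_derivable f j x : smooth f -> derivable f x (e_ j).
Proof. by move=> /(_ [::])[_ /(_ j x)]. Qed.

Lemma smooth_derive f j : smooth f -> smooth (fun x => 'D_(e_ j) f x).
Proof. by move=> sf s; rewrite -partials_rcons; exact: sf. Qed.

Lemma smooth_partials f s : smooth f -> smooth (partials s f).
Proof.
move=> sf s'; have -> : partials s' (partials s f) = partials (s' ++ s) f.
  by rewrite /partials foldr_cat.
exact: sf.
Qed.

(** Peels off the innermost derivative, whereas [partials] adds outer ones; in this form closure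
    under products follows from the product rule by induction. *)
Fixpoint csm (k : nat) f : Prop :=
  if k is k.+1 then [/\ continuous f, forall j x, derivable f x (e_ j) &
    forall j, csm k (fun x => 'D_(e_ j) f x)] else continuous f.

Lemma smooth_csm f : smooth f <-> forall k, csm k f.
Proof.
split=> [sf k|cf s].
  elim: k f sf => [|k IH] f sf /=; first exact: smooth_continuous.
  split=> [|j x|j]; [exact: smooth_continuous|exact: smooth_derivable|].
  exact/IH/smooth_derive.
elim/last_ind: s f cf => [|s j IH] f cf.
  by split; [exact: (cf 0)|move=> j x; have [_ /(_ j x)] := cf 1].
rewrite partials_rcons; apply: IH => k.
by have [_ _ /(_ j)] := cf k.+1.
Qed.

Lemma csmW k f : csm k.+1 f -> csm k f.
Proof.
elim: k f => [|k IH] f; first by case.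
by move=> [cf df H]; split=> // j; exact/IH/H.
Qed.

Lemma csmD k f g : csm k f -> csm k g -> csm k (fun x => f x + g x).
Proof.
elim: k f g => [|k IH] f g /=; first by move=> cf cg x; exact: (cvgD (cf x) (cg x)).
move=> [cf df Hf] [cg dg Hg]; split=> [x|j x|j].
- exact: (cvgD (cf x) (cg x)).
- exact: (derivableD (df j x) (dg j x)).
rewrite [X in csm _ X](_ : _ = (fun x => 'D_(e_ j) f x + 'D_(e_ j) g x)).
  exact: IH.
by apply/funext => x; exact: (deriveD (df j x) (dg j x)).
Qed.

Lemma deriveMx f g x j : derivable f x (e_ j) -> derivable g x (e_ j) ->
  'D_(e_ j) (fun x => f x * g x) x =
  'D_(e_ j) f x * g x + f x * 'D_(e_ j) g x.
Proof.
move=> df dg; apply: (etrans (deriveM df dg)).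
by rewrite addrC [X in X + _]mulrC.
Qed.

Lemma csmM k f g : csm k f -> csm k g -> csm k (fun x => f x * g x).
Proof.
elim: k f g => [|k IH] f g; first by move=> cf cg x; exact: (cvgM (cf x) (cg x)).
move=> F G; move: (F) (G) => [cf df Hf] [cg dg Hg]; split=> [x|j x|j].
- exact: (cvgM (cf x) (cg x)).
- exact: (derivableM (df j x) (dg j x)).
rewrite [X in csm _ X](_ : _ = (fun x =>
    'D_(e_ j) f x * g x + f x * 'D_(e_ j) g x)).
  by apply: csmD; [exact: (IH _ _ (Hf j) (csmW G))|exact: (IH _ _ (csmW F) (Hg j))].
by apply/funext => x; exact: deriveMx.
Qed.

Lemma smoothD f g : smooth f -> smooth g -> smooth (fun x => f x + g x).
Proof.
by move=> /smooth_csm sf /smooth_csm sg; apply/smooth_csm => k; exact: csmD.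
Qed.

Lemma smoothM f g : smooth f -> smooth g -> smooth (fun x => f x * g x).
Proof.
by move=> /smooth_csm sf /smooth_csm sg; apply/smooth_csm => k; exact: csmM.
Qed.

Lemma smooth_cst (c : R) : smooth (fun _ : 'rV[R]_n => c).
Proof.
have H s : partials s (fun _ : 'rV[R]_n => c) = fun=> (s == [::])%:R * c.
  elim: s => [|j s IH] /=; first by apply/funext => x; rewrite mul1r.
  by apply/funext => x; rewrite IH mul0r; exact: derive_cst.
by move=> s; rewrite H; split=> [|j x]; [exact: cst_continuous|exact: derivable_cst].
Qed.

Lemma smoothZ (c : R) f : smooth f -> smooth (fun x => c * f x).
Proof. by move=> sf; exact: (smoothM (smooth_cst c) sf). Qed.

Lemma partialsD s f g : smooth f -> smooth g ->
  partials s (fun x => f x + g x) = fun x => partials s f x + partials s g x.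
Proof.
move=> sf sg; have := partials_lin s 1 1 sf sg.
under eq_fun do rewrite !mul1r.
by move=> ->; under eq_fun do rewrite !mul1r.
Qed.

Lemma partialsZ s c f : smooth f ->
  partials s (fun x => c * f x) = fun x => c * partials s f x.
Proof.
move=> sf; have := partials_lin s c 0 sf sf.
under eq_fun do rewrite mul0r addr0.
by move=> ->; under eq_fun do rewrite mul0r addr0.
Qed.

Lemma smooth_sum (I : Type) (r : seq I) (P : pred I) (F : I -> 'rV[R]_n -> R) :
  (forall i, smooth (F i)) -> smooth (fun x => \sum_(i <- r | P i) F i x).
Proof.
move=> sF; elim: r => [|i r IH].
  by under eq_fun do rewrite big_nil; exact: smooth_cst.
case: (boolP (P i)) => Pi; last by under eq_fun do rewrite big_cons (negbTE Pi).
under eq_fun do rewrite big_cons Pi.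
exact: (smoothD (sF i) IH).
Qed.

Lemma partials_sum s (I : Type) (r : seq I) (P : pred I) (F : I -> 'rV[R]_n -> R) :
  (forall i, smooth (F i)) ->
  partials s (fun x => \sum_(i <- r | P i) F i x) =
  fun x => \sum_(i <- r | P i) partials s (F i) x.
Proof.
move=> sF; elim: r => [|i r IH].
  under eq_fun do rewrite big_nil; rewrite partials0.
  by apply/funext => x; rewrite big_nil.
case: (boolP (P i)) => Pi; last first.
  under eq_fun do rewrite big_cons (negbTE Pi).
  by rewrite IH; apply/funext => x; rewrite big_cons (negbTE Pi).
under eq_fun do rewrite big_cons Pi.
rewrite partialsD//; last exact: smooth_sum.
by rewrite IH; apply/funext => x; rewrite big_cons Pi.
Qed.

Lemma smooth_prod (I : Type) (r : seq I) (P : pred I) (F : I -> 'rV[R]_n -> R) :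
  (forall i, smooth (F i)) -> smooth (fun x => \prod_(i <- r | P i) F i x).
Proof.
move=> sF; elim: r => [|i r IH].
  by under eq_fun do rewrite big_nil; exact: smooth_cst.
case: (boolP (P i)) => Pi; last by under eq_fun do rewrite big_cons (negbTE Pi).
under eq_fun do rewrite big_cons Pi.
exact: (smoothM (sF i) IH).
Qed.

(** The induction must run over products of derivatives of f and g, because one differentiation
    already leaves the form f g. Each derivative doubles the number of terms, hence 2 ^ |s|. *)
Lemma partialsM_aux (N : nat) f g x (A B : R) : smooth f -> smooth g ->
  (forall s, (size s <= N)%N -> `|partials s f x| <= A) ->
  (forall s, (size s <= N)%N -> `|partials s g x| <= B) ->
  forall s a b, (size s + size a <= N)%N -> (size s + size b <= N)%N ->
  `|partials s (fun y => partials a f y * partials b g y) x| <=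
     2 ^+ size s * (A * B).
Proof.
move=> sf sg HA HB; elim/last_ind => [|s j IH] a b.
  rewrite !add0n mul1r => Na Nb /=; rewrite normrM.
  by apply: ler_pM => //; [exact: HA|exact: HB].
rewrite size_rcons !addSnnS => Na Nb; rewrite partials_rcons.
have fa := smooth_partials a sf; have gb := smooth_partials b sg.
rewrite [X in partials _ X](_ : _ = fun y => partials (j :: a) f y *
  partials b g y + partials a f y * partials (j :: b) g y); last first.
  apply/funext => y.
  by rewrite deriveMx//; exact: smooth_derivable.
rewrite (partialsD s (smoothM (smooth_derive j fa) gb)
  (smoothM fa (smooth_derive j gb))).
rewrite (le_trans (ler_normD _ _))// exprS -mulrA [2 * _]mulr_natl mulr2n.
have W m k : (m + k.+1 <= N)%N -> (m + k <= N)%N.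
  by move=> H; rewrite (leq_trans _ H)// addnS.
apply: lerD.
  by apply: (IH (j :: a) b) => //; exact: W.
by apply: (IH a (j :: b)) => //; exact: W.
Qed.

Lemma partialsM_le (N : nat) f g x (A B : R) : smooth f -> smooth g ->
  (forall s, (size s <= N)%N -> `|partials s f x| <= A) ->
  (forall s, (size s <= N)%N -> `|partials s g x| <= B) ->
  forall s, (size s <= N)%N ->
  `|partials s (fun y => f y * g y) x| <= 2 ^+ N * (A * B).
Proof.
move=> sf sg HA HB s sN.
have := @partialsM_aux N f g x A B sf sg HA HB s [::] [::].
rewrite !addn0 => /(_ sN sN) /le_trans; apply.
have A0 : 0 <= A by rewrite (le_trans _ (HA [::] _)).
have B0 : 0 <= B by rewrite (le_trans _ (HB [::] _)).
by rewrite ler_wpM2r ?mulr_ge0// ler_weXn2l// ler1n.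
Qed.

Lemma dotrDl u v z' : dotr (u + v) z' = dotr u z' + dotr v z' :> R.
Proof. by rewrite /dotr -big_split; apply: eq_bigr => j _; rewrite mxE mulrDl. Qed.

Lemma dotrC u v : dotr u v = dotr v u :> R.
Proof. by rewrite /dotr; apply: eq_bigr => j _; rewrite mulrC. Qed.

Lemma dotrDr z' u v : dotr z' (u + v) = dotr z' u + dotr z' v :> R.
Proof. by rewrite !(dotrC z') dotrDl. Qed.

Lemma dotrZr (c : R) u v : dotr u (c *: v) = c * dotr u v.
Proof.
by rewrite /dotr mulr_sumr; apply: eq_bigr => j _; rewrite mxE mulrCA.
Qed.

Lemma dotrZl (c : R) u v : dotr (c *: u) v = c * dotr u v.
Proof. by rewrite dotrC dotrZr dotrC. Qed.

Lemma dotrNl u v : dotr (- u) v = - dotr u v :> R.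
Proof. by rewrite -scaleN1r dotrZl mulN1r. Qed.

Lemma dotr_delta u j : dotr u (e_ j) = u 0 j.
Proof.
rewrite /dotr (bigD1 j)//= mxE !eqxx mulr1 big1 ?addr0// => i /negbTE ij.
by rewrite mxE ij andbF mulr0.
Qed.

Lemma continuous_dotr u : continuous (dotr u : 'rV[R]_n -> R).
Proof.
rewrite /dotr; elim: (index_enum _) => [|j r IH].
  by under eq_fun do rewrite big_nil; exact: cst_continuous.
under eq_fun do rewrite big_cons.
move=> x; exact: (cvgD (cvgM (cvg_cst _) (@coord_continuous _ _ _ 0 j x)) (IH x)).
Qed.

(** A function [d 0] with all its successive derivatives. Given this sequence, the partial
    derivatives of the ridge function [d 0 (dotr u x)] are explicit, and bounds on them reduce to
    bounds on each [d k]. *)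
Definition tower (d : nat -> R -> R) :=
  forall k (t : R), is_derive t 1 (d k) (d k.+1 t).

Lemma partials_dotr (d : nat -> R -> R) u s : tower d ->
  partials s (fun x => d 0%N (dotr u x)) =
  fun x => (\prod_(j <- s) u 0 j) * d (size s) (dotr u x).
Proof.
move=> td; elim: s => [|j s IH] /=.
  by apply/funext => x; rewrite big_nil mul1r.
apply/funext => x; rewrite IH big_cons.
apply: derive_val; apply/is_derive_lineP.
have -> : (fun h : R => \prod_(i <- s) u 0 i * d (size s) (dotr u (h *: e_ j + x)))
    = (\prod_(i <- s) u 0 i) \*: (d (size s) \o (fun h : R => u 0 j * h + dotr u x)).
  apply/funext => h /=.
  by rewrite dotrDr dotrZr dotr_delta [h * _]mulrC.
have H1 : is_derive (0 : R) 1 (fun h : R => u 0 j * h + dotr u x) (u 0 j).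
  have -> : (fun h : R => u 0 j * h + dotr u x) =
      (u 0 j \*: (id : R -> R)) + cst (dotr u x) by apply/funext.
  by apply: is_derive_eq; rewrite addr0 [_ *: _]mulr1.
have H2 : is_derive ((fun h : R => u 0 j * h + dotr u x) 0) 1 (d (size s))
   (d (size s).+1 (dotr u x)).
  by rewrite mulr0 add0r; exact: td.
have H3 := @is_derive1_comp R (d (size s)) (fun h : R => u 0 j * h + dotr u x)
  0 _ _ H2 H1.
apply: (is_derive_eq (is_deriveZ (\prod_(i <- s) u 0 i) H3)).
by rewrite /GRing.scale /= [d _ _ * _]mulrC mulrCA mulrA.
Qed.

Lemma smooth_dotr (d : nat -> R -> R) u : tower d ->
  smooth (fun x => d 0%N (dotr u x)).
Proof.
move=> td s; rewrite partials_dotr//; split=> [x|j x].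
  have H : {for x, continuous (d (size s) \o dotr u)}; last first.
    exact: (cvgM (cvg_cst _) H).
  apply: continuous_comp; first exact: continuous_dotr.
  apply/differentiable_continuous/derivable1_diffP.
  by have [] := td (size s) (dotr u x).
have := derivable_cst (\prod_(j <- s) u 0 j) x (e_ j) => H1.
apply: (derivableM H1); apply/derivable1P.
have -> : (fun h : R => d (size s) (dotr u (h *: e_ j + x)))
    = d (size s) \o (fun h : R => u 0 j * h + dotr u x).
  by apply/funext => h /=; rewrite dotrDr dotrZr dotr_delta [h * _]mulrC.
apply/derivable1_diffP/differentiable_comp.
  apply/derivable1_diffP.
  by apply: ex_derive; apply: (is_deriveD (is_deriveZ (u 0 j) (is_derive_id 0 1))
    (is_derive_cst (dotr u x) 0 1)).
by apply/derivable1_diffP; have [] := td (size s) (u 0 j * 0 + dotr u x).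
Qed.

Lemma partials_local0 f (U : set 'rV[R]_n) s : open U ->
  (forall x, U x -> f x = 0) -> forall x, U x -> partials s f x = 0.
Proof.
move=> oU; elim: s f => [//|j s IH] f H x Ux /=.
rewrite (@near_eq_derive _ _ _ _ (cst 0)) ?derive_cst//.
near=> y; apply: IH => //; near: y; exact: open_nbhs_nbhs.
Unshelve. all: by end_near. Qed.

End Calculus.

(** * One-dimensional cutoffs *)

Section OneVariable.
Context (R : realType).
Implicit Types (f g : R -> R) (x y : R).

Fixpoint ck (k : nat) f : Prop :=
  if k is k.+1 then (forall x, derivable f x 1) /\ ck k (derive1 f) else True.

Lemma ckW k f : ck k.+1 f -> ck k f.
Proof. by elim: k f => [//|k IH] f [df H]; split=> //; exact: IH. Qed.

Lemma ckD k f g : ck k f -> ck k g -> ck k (fun x => f x + g x).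
Proof.
elim: k f g => [//|k IH] f g [df Hf] [dg Hg]; split=> [x|].
  exact: (derivableD (df x) (dg x)).
rewrite [X in ck _ X](_ : _ = (fun x => derive1 f x + derive1 g x)); first exact: IH.
by apply/funext => x; rewrite !derive1E; exact: (deriveD (df x) (dg x)).
Qed.

Lemma ckM k f g : ck k f -> ck k g -> ck k (fun x => f x * g x).
Proof.
elim: k f g => [//|k IH] f g F G; move: (F) (G) => [df Hf] [dg Hg].
split=> [x|]; first exact: (derivableM (df x) (dg x)).
rewrite [X in ck _ X](_ : _ = (fun x => f x * derive1 g x + g x * derive1 f x)).
  by apply: ckD; apply: IH => //; exact: ckW.
by apply/funext => x; rewrite !derive1E; exact: (deriveM (df x) (dg x)).
Qed.

Lemma ck_cst k (c : R) : ck k (fun _ : R => c).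
Proof.
elim: k c => [//|k IH] c; split=> [x|]; first exact: derivable_cst.
rewrite [X in ck _ X](_ : _ = (fun=> 0)); first exact: IH.
by apply/funext => x; rewrite derive1E; exact: derive_cst.
Qed.

Lemma ckV k f : (forall x, f x != 0) -> ck k f -> ck k (fun x => (f x)^-1).
Proof.
move=> f0; elim: k => [//|k IH] F; move: (F) => [df Hf].
split=> [x|]; first exact: (derivableV (f0 x) (df x)).
rewrite [X in ck _ X](_ : _ = (fun x => (-1) * ((f x)^-1 * (f x)^-1) * derive1 f x)).
  have H := IH (ckW F).
  by apply: ckM => //; apply: ckM; [exact: ck_cst|exact: ckM].
apply/funext => x; rewrite !derive1E (deriveV (f0 x) (df x)).
by rewrite mulN1r -invfM -expr2.
Qed.

Lemma ck_affine k f (a b : R) : ck k f -> ck k (fun x => f (a * x + b)).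
Proof.
elim: k f => [//|k IH] f [df Hf].
have dl x : is_derive x 1 (fun x : R => a * x + b) a.
  have -> : (fun x : R => a * x + b) = (a \*: (id : R -> R)) + cst b.
    by apply/funext.
  by apply: is_derive_eq; rewrite addr0 [_ *: _]mulr1.
have H x : is_derive x 1 (fun x => f (a * x + b)) (derive1 f (a * x + b) * a).
  have h := derivableP (df (a * x + b)); rewrite -derive1E in h.
  exact: (@is_derive1_comp R f (fun x => a * x + b) _ _ _ h (dl x)).
split=> [x|]; first by have [] := H x.
rewrite [X in ck _ X](_ : _ = (fun x => derive1 f (a * x + b) * a)).
  by apply: ckM; [exact: IH|exact: ck_cst].
by apply/funext => x; rewrite derive1E; have [] := H x.
Qed.

Lemma ck_tower f : (forall k, ck k f) -> tower (fun k => derive1n k f).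
Proof.
move=> cf k t; split; last by rewrite derive1nS derive1E.
elim: k f cf => [|k IH] f cf; first by have [] := cf 1%N.
by rewrite derive1Sn; apply: IH => m; have [] := cf m.+1.
Qed.

(** From y <= e^y at y = x / m, raised to the power m. *)
Lemma expr_le_expR (m : nat) x : 0 <= x -> x ^+ m <= m%:R ^+ m * expR x.
Proof.
move=> x0; case: m => [|m]; first by rewrite !expr0 mul1r (le_trans _ (expR_ge1Dx _))// lerDl.
have m0 : 0 < m.+1%:R :> R by [].
have : (x / m.+1%:R) ^+ m.+1 <= expR (x / m.+1%:R) ^+ m.+1.
  rewrite lerXn2r ?nnegrE ?divr_ge0 ?expR_ge0//.
  by rewrite (le_trans _ (expR_ge1Dx _))// lerDr.
rewrite expr_div_n -expRM_natl mulrCA divff ?gt_eqF// mulr1.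
by rewrite ler_pdivrMr ?exprn_gt0// mulrC.
Qed.

(** The functions x^-m e^{-1/x}, extended by zero. The derivative of one is a combination of two
    others, so smoothness of the whole family reduces to differentiability at the origin. *)
Definition flat (m : nat) x : R :=
  if 0 < x then x^-1 ^+ m * expR (- x^-1) else 0.

(** The exponential absorbs m + 2 powers of 1/x, two more than present; the surplus is the factor
    x^2, which makes the derivative at 0 vanish. *)
Lemma flat_bound m x : `|flat m x| <= m.+2%:R ^+ m.+2 * x ^+ 2.
Proof.
rewrite /flat; case: ifPn => x0; last first.
  by rewrite normr0 mulr_ge0 ?sqr_ge0// exprn_ge0.
have y0 : 0 < x^-1 by rewrite invr_gt0.
rewrite ger0_norm ?mulr_ge0 ?expR_ge0 ?exprn_ge0 ?(ltW y0)//.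
have := expr_le_expR m.+2 (ltW y0).
rewrite -addn2 exprD -ler_pdivlMr ?exprn_gt0// => /(ler_wpM2r (expR_ge0 (- x^-1))).
move=> /le_trans; apply.
rewrite -!mulrA ler_wpM2l ?exprn_ge0// exprVn invrK mulrCA mulrC -!mulrA.
by rewrite mulrA expRxMexpNx_1 mul1r.
Qed.

Lemma is_derive_flat m x :
  is_derive x 1 (flat m) (flat m.+2 x - m%:R * flat m.+1 x).
Proof.
have [x0|x0|->] := ltgtP x 0.
- rewrite {2 3}/flat ltNge (ltW x0)/= mulr0 subr0.
  apply: (@near_eq_is_derive _ _ _ (cst 0)).
  near=> y; have y0 : y < 0 by near: y; exact: lt_nbhsl.
  by rewrite /flat ltNge (ltW y0).
- have H : is_derive x 1 (fun x => x^-1 ^+ m * expR (- x^-1))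
      (x^-1 ^+ m.+2 * expR (- x^-1) - m%:R * (x^-1 ^+ m.+1 * expR (- x^-1))).
    have xn0 : x != 0 by rewrite gt_eqF.
    have H1 : is_derive x 1 (fun x : R => x^-1) (- x ^- 2).
      by apply: (is_derive_eq (is_deriveV xn0 (is_derive_id _ _))); rewrite [_ *: _]mulr1.
    have H2 : is_derive x 1 (fun x : R => x^-1 ^+ m) (m%:R * x^-1 ^+ m.-1 * (- x ^- 2)).
      have -> : (fun x : R => x^-1 ^+ m) = (fun x : R => x^-1) ^+ m.
        by apply/funext => y; rewrite fctE.
      have -> : m%:R * x^-1 ^+ m.-1 * - x ^- 2 = m%:R * x^-1 ^+ m.-1 *: - x ^- 2 by [].
      by apply: (is_derive_eq (is_deriveX m H1)); rewrite mulr_natl.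
    have H3 : is_derive x 1 (fun x : R => expR (- x^-1)) (expR (- x^-1) * x^-2).
      apply: (@is_derive1_comp R expR (fun x => - x^-1)).
      by apply: (is_derive_eq (is_deriveN H1)); rewrite opprK.
    apply: (is_derive_eq (is_deriveM H2 H3)).
    rewrite /GRing.scale/= !exprVn !exprS.
    case: m {H2} => [|m] /=; rewrite ?exprS; field; by rewrite ?expf_neq0 ?xn0.
  move: H; rewrite {2 3}/flat x0; apply: near_eq_is_derive.
  near=> y; have y0 : 0 < y by near: y; exact: lt_nbhsr.
  by rewrite /flat y0.
rewrite {2 3}/flat ltxx mulr0 subr0.
apply: (@is_derive_quadratic _ _ _ _ _ _ (m.+2%:R ^+ m.+2)) => h.
rewrite [flat m 0]/flat ltxx subr0 mulr0 subr0 addr0 [_ *: _]mulr1.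
exact: flat_bound.
Unshelve. all: by end_near. Qed.

Lemma ck_flat k m : ck k (flat m).
Proof.
elim: k m => [//|k IH] m; split=> [x|]; first by have [] := is_derive_flat m x.
rewrite [X in ck _ X](_ : _ = (fun x => flat m.+2 x + (- m%:R) * flat m.+1 x)).
  by apply: ckD => //; apply: ckM => //; exact: ck_cst.
by apply/funext => x; rewrite derive1E mulNr; have [] := is_derive_flat m x.
Qed.

(** Every derivative is constant on each side of [a, b], and continuous on the compact interval
    itself. *)
Lemma tower_bounded f (a b c c' : R) : (forall k, ck k f) -> a <= b ->
  (forall x, x < a -> f x = c) -> (forall x, b < x -> f x = c') ->
  exists d, [/\ d 0%N = f, tower d & forall k, exists B, forall x, `|d k x| <= B].
Proof.
move=> cf ab fa fb; exists (fun k => derive1n k f); have td := ck_tower cf.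
split=> // k.
have cd : continuous (derive1n k f).
  move=> x; apply/differentiable_continuous/derivable1_diffP.
  by have [] := td k x.
have [ca Ha] : exists ca, forall x, x < a -> derive1n k f x = ca.
  elim: k {cd} => [|k [ca IH]]; first by exists c.
  exists 0 => x xa; have [_ <-] := td k x.
  rewrite (@near_eq_derive _ _ _ _ (cst ca)) ?derive_cst//.
  by near=> y; apply: IH; near: y; exact: lt_nbhsl.
have [cb Hb] : exists cb, forall x, b < x -> derive1n k f x = cb.
  elim: k {cd Ha} => [|k [cb IH]]; first by exists c'.
  exists 0 => x xa; have [_ <-] := td k x.
  rewrite (@near_eq_derive _ _ _ _ (cst cb)) ?derive_cst//.
  by near=> y; apply: IH; near: y; exact: lt_nbhsr.
have [M _ HM] := EVT_max ab (continuous_subspaceT cd).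
have [m _ Hm] := EVT_min ab (continuous_subspaceT cd).
exists (`|ca| + `|cb| + `|derive1n k f M| + `|derive1n k f m|) => x.
have [xa|xa] := ltP x a.
  by rewrite Ha// -!addrA lerDl !addr_ge0.
have [xb|xb] := ltP b x.
  by rewrite Hb// [`|ca| + _]addrC -!addrA lerDl !addr_ge0.
have xab : x \in `[a, b] by rewrite in_itv/= xa.
have := HM _ xab; have := Hm _ xab => h1 h2.
rewrite ler_norml; apply/andP; split.
  rewrite lerNl (le_trans (_ : _ <= `|derive1n k f m|))//.
    by rewrite -normrN (le_trans _ (ler_norm _))// lerN2.
  by rewrite lerDr !addr_ge0.
rewrite (le_trans h2)// (le_trans (ler_norm _))// -addrA addrCA lerDl.
by rewrite !addr_ge0.
Unshelve. all: by end_near. Qed.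

Definition step (x : R) : R := flat 0 x / (flat 0 x + flat 0 (1 - x)).

Lemma flat_ge0 m x : 0 <= flat m x.
Proof.
rewrite /flat; case: ifPn => // x0.
by rewrite mulr_ge0 ?expR_ge0// exprn_ge0// invr_ge0 ltW.
Qed.

Lemma step_den_gt0 x : 0 < flat 0 x + flat 0 (1 - x).
Proof.
have [x0|x0] := ltP 0 x.
  rewrite ltr_wpDr ?flat_ge0// /flat x0 mul1r expR_gt0//.
rewrite ltr_wpDl ?flat_ge0// /flat ifT ?mul1r ?expR_gt0//.
by rewrite subr_gt0 (le_lt_trans x0).
Qed.

Lemma step0 x : x <= 0 -> step x = 0.
Proof. by move=> x0; rewrite /step {1}/flat ltNge x0/= mul0r. Qed.

Lemma step1 x : 1 <= x -> step x = 1.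
Proof.
move=> x1; have := step_den_gt0 x; rewrite /step.
have -> : flat 0 (1 - x) = 0 by rewrite /flat subr_gt0 ltNge x1.
by rewrite addr0 => /gt_eqF/negbT/divff.
Qed.

Lemma ck_step k : ck k step.
Proof.
apply: ckM; first exact: ck_flat.
apply: ckV => [x|]; first by rewrite gt_eqF// step_den_gt0.
apply: ckD; first exact: ck_flat.
rewrite [X in ck _ X](_ : _ = fun x => flat 0 ((-1) * x + 1)).
  by apply: ck_affine; exact: ck_flat.
by apply/funext => x; rewrite mulN1r addrC.
Qed.

Definition bump (x : R) : R := step (x + 2) * step (2 - x).

Lemma bump1 x : `|x| <= 1 -> bump x = 1.
Proof.
by rewrite ler_norml => /andP[h1 h2]; rewrite /bump !step1 ?mulr1//; lra.
Qed.

Lemma bump0 x : 2 <= `|x| -> bump x = 0.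
Proof.
rewrite ler_normr; case/orP => h; rewrite /bump.
  by rewrite [step (2 - x)]step0 ?mulr0//; lra.
by rewrite [step (x + 2)]step0 ?mul0r//; lra.
Qed.

Lemma ck_bump k : ck k bump.
Proof.
apply: ckM.
  rewrite [X in ck _ X](_ : _ = fun x => step (1 * x + 2)).
    by apply: ck_affine; exact: ck_step.
  by apply/funext => x; rewrite mul1r.
rewrite [X in ck _ X](_ : _ = fun x => step ((-1) * x + 2)).
  by apply: ck_affine; exact: ck_step.
by apply/funext => x; rewrite mulN1r addrC.
Qed.

Lemma tower_expR : tower (fun _ : nat => @expR R).
Proof. by move=> k t; exact: is_derive_expR. Qed.

(** Differentiating the cosine adds pi/2 to its argument; the free phase c lets the same tower treat
    the sine. *)
Lemma tower_cos (c : R) : tower (fun (k : nat) x => cos (x + (c + k%:R * (pi / 2)))).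
Proof.
move=> k t.
have H2 := is_derive_shift t 1 (c + k%:R * (pi / 2)).
have := @is_derive1_comp R cos (fun x => x + (c + k%:R * (pi / 2))) t _ _
  (is_derive_cos _) H2.
rewrite mulr1 => /is_derive_eq; apply.
by rewrite -[in RHS]addn1 natrD [(_ + 1) * _]mulrDl mul1r !addrA cosDpihalf.
Qed.

End OneVariable.

(** * Weighted norms *)

Section Weighted.
Context (R : realType) (n : nat).
Implicit Types (f g w : 'rV[R]_n -> R) (x u v : 'rV[R]_n) (s : seq 'I_n).

Local Notation e_ j := (delta_mx 0 j : 'rV[R]_n).

Lemma abs_le_enorm x j : `|x 0 j| <= enorm x.
Proof.
rewrite -sqrtr_sqr ler_wsqrtr// (bigD1 j)//= lerDl sumr_ge0// => i _.
exact: sqr_ge0.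
Qed.

Lemma enorm_le_sum x : enorm x <= \sum_j `|x 0 j|.
Proof.
have H : forall r : seq 'I_n, \sum_(j <- r) x 0 j ^+ 2 <= (\sum_(j <- r) `|x 0 j|) ^+ 2.
  elim=> [|j r IH]; first by rewrite !big_nil expr0n.
  rewrite !big_cons sqrrD real_normK ?num_real// -addrA lerD2l.
  by rewrite ler_wpDl// mulrn_wge0// mulr_ge0// sumr_ge0.
rewrite -[leRHS]ger0_norm ?sumr_ge0// -sqrtr_sqr.
by rewrite ler_wsqrtr.
Qed.

Lemma ge1_enorm x : 1 <= 1 + enorm x. Proof. by rewrite lerDl enorm_ge0. Qed.

Lemma gt0_enorm x : 0 < 1 + enorm x.
Proof. exact: lt_le_trans (ge1_enorm x). Qed.

Hint Resolve ge1_enorm gt0_enorm : core.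

(** A single index governs both the power of the weight and the number of derivatives, so the
    Schwartz topology is described by one increasing scale of norms. *)
Definition wsup (N : nat) f (B : R) := forall s x, (size s <= N)%N ->
  (1 + enorm x) ^+ N * `|partials s f x| <= B.

Definition rschw f := smooth f /\ forall N, exists B, wsup N f B.

(** The functions by which real Schwartz functions will be multiplied: all derivatives bounded, no
    decay. *)
Definition bsm f := smooth f /\
  forall N, exists B : R, forall s x, (size s <= N)%N -> `|partials s f x| <= B.

Lemma wsup_ge0 N f B : wsup N f B -> 0 <= B.
Proof.
move=> /(_ [::] 0 (leq0n _)); apply: le_trans.
by rewrite mulr_ge0// exprn_ge0// ltW.
Qed.

Lemma wsup_le N f B B' : B <= B' -> wsup N f B -> wsup N f B'.
Proof. by move=> BB H s x sN; exact: le_trans (H s x sN) BB. Qed.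

Lemma wsupW N M f B : (N <= M)%N -> wsup M f B -> wsup N f B.
Proof.
move=> NM H s x sN; apply: le_trans (H s x (leq_trans sN NM)).
by rewrite ler_wpM2r// ler_weXn2l.
Qed.

Lemma wsup_pt N f B s x : wsup N f B -> (size s <= N)%N ->
  `|partials s f x| <= B / (1 + enorm x) ^+ N.
Proof. by move=> H sN; rewrite ler_pdivlMr ?exprn_gt0// mulrC; exact: H. Qed.

Lemma wsupD N f g (A B : R) : smooth f -> smooth g -> wsup N f A -> wsup N g B ->
  wsup N (fun x => f x + g x) (A + B).
Proof.
move=> sf sg HA HB s x sN; rewrite partialsD//.
apply: (@le_trans _ _ ((1 + enorm x) ^+ N * (`|partials s f x| + `|partials s g x|))).
  by rewrite ler_wpM2l ?ler_normD// exprn_ge0// ltW.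
by rewrite mulrDr lerD ?HA ?HB.
Qed.

Lemma wsupZ N c f A : smooth f -> wsup N f A -> wsup N (fun x => c * f x) (`|c| * A).
Proof.
move=> sf HA s x sN; rewrite partialsZ// normrM mulrCA.
by rewrite ler_wpM2l// HA.
Qed.

Lemma rschwD f g : rschw f -> rschw g -> rschw (fun x => f x + g x).
Proof.
move=> [sf Hf] [sg Hg]; split=> [|N]; first exact: smoothD.
have [A HA] := Hf N; have [B HB] := Hg N.
by exists (A + B); exact: wsupD.
Qed.

Lemma rschwZ c f : rschw f -> rschw (fun x => c * f x).
Proof.
move=> [sf Hf]; split=> [|N]; first exact: smoothZ.
by have [A HA] := Hf N; exists (`|c| * A); exact: wsupZ.
Qed.

Lemma rschw0 : rschw (fun=> 0).
Proof.
split=> [|N]; first exact: smooth_cst.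
by exists 0 => s x _; rewrite partials0 normr0 mulr0.
Qed.

Lemma rschw_sum (I : Type) (r : seq I) (F : I -> 'rV[R]_n -> R) :
  (forall i, rschw (F i)) -> rschw (fun x => \sum_(i <- r) F i x).
Proof.
move=> sF; elim: r => [|i r IH].
  by under eq_fun do rewrite big_nil; exact: rschw0.
by under eq_fun do rewrite big_cons; exact: (rschwD (sF i) IH).
Qed.

Lemma wsupM N w g (A B : R) : smooth w -> smooth g -> wsup N w A ->
  (forall s x, (size s <= N)%N -> `|partials s g x| <= B) ->
  wsup N (fun x => w x * g x) (2 ^+ N * (A * B)).
Proof.
move=> sw sg HA HB s x sN.
have h := partialsM_le sw sg (fun s => @wsup_pt N w A s x HA) (fun s => HB s x) sN.
rewrite mulrC -ler_pdivlMr ?exprn_gt0// (le_trans h)//.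
by rewrite -!mulrA [_^-1 * B]mulrC.
Qed.

Lemma rschwM w g : rschw w -> bsm g -> rschw (fun x => w x * g x).
Proof.
move=> [sw Hw] [sg Hg]; split=> [|N]; first exact: smoothM.
have [A HA] := Hw N; have [B HB] := Hg N.
by eexists; exact: (wsupM sw sg HA HB).
Qed.

Lemma bsmM f g : bsm f -> bsm g -> bsm (fun x => f x * g x).
Proof.
move=> [sf Hf] [sg Hg]; split=> [|N]; first exact: smoothM.
have [A HA] := Hf N; have [B HB] := Hg N.
exists (2 ^+ N * (A * B)) => s x sN.
exact: (partialsM_le sf sg (fun s => HA s x) (fun s => HB s x) sN).
Qed.

Lemma bsm_cst c : bsm (fun=> c).
Proof.
split=> [|N]; first exact: smooth_cst.
exists `|c| => s x _; case: s => [//|j s] /=.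
have -> : partials s (fun _ : 'rV[R]_n => c) = fun=> (s == [::])%:R * c.
  elim: s => [|i s IH] /=; first by apply/funext => y; rewrite mul1r.
  by apply/funext => y; rewrite IH mul0r; exact: derive_cst.
by rewrite derive_cst normr0.
Qed.

Lemma bsm_prod (I : Type) (r : seq I) (F : I -> 'rV[R]_n -> R) :
  (forall i, bsm (F i)) -> bsm (fun x => \prod_(i <- r) F i x).
Proof.
move=> sF; elim: r => [|i r IH].
  by under eq_fun do rewrite big_nil; exact: bsm_cst.
by under eq_fun do rewrite big_cons; exact: (bsmM (sF i) IH).
Qed.

Lemma prod_enorm_le u s : `|\prod_(j <- s) u 0 j| <= (1 + enorm u) ^+ size s.
Proof.
elim: s => [|j s IH]; first by rewrite big_nil normr1.
rewrite big_cons normrM exprS ler_pM//.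
by rewrite (le_trans (abs_le_enorm u j))// lerDr.
Qed.

Lemma partials_dotr_le (d : nat -> R -> R) u s (B : R) x : tower d ->
  `|d (size s) (dotr u x)| <= B ->
  `|partials s (fun x => d 0%N (dotr u x)) x| <= (1 + enorm u) ^+ size s * B.
Proof.
by move=> td H; rewrite partials_dotr// normrM ler_pM// prod_enorm_le.
Qed.

Lemma tower_uniform (d : nat -> R -> R) (N : nat) :
  (forall k, exists B : R, forall t, `|d k t| <= B) ->
  exists B : R, 0 <= B /\ forall k t, (k <= N)%N -> `|d k t| <= B.
Proof.
move=> H; elim: N => [|N [B [B0 IH]]].
  have [B HB] := H 0%N; exists B; split; first exact: le_trans (HB 0).
  by move=> k t; rewrite leqn0 => /eqP ->.
have [B' HB'] := H N.+1; exists (B + B'); split.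
  by rewrite addr_ge0// (le_trans _ (HB' 0)).
move=> k t; rewrite leq_eqVlt => /orP[/eqP ->|kN].
  by rewrite (le_trans (HB' _))// lerDr.
by rewrite (le_trans (IH k t kN))// lerDl (le_trans _ (HB' 0)).
Qed.

Lemma bsm_dotr (d : nat -> R -> R) u : tower d ->
  (forall k, exists B : R, forall t, `|d k t| <= B) ->
  bsm (fun x => d 0%N (dotr u x)).
Proof.
move=> td bd; split=> [|N]; first exact: smooth_dotr.
have [B [B0 HB]] := tower_uniform N bd.
exists ((1 + enorm u) ^+ N * B) => s x sN.
apply: (le_trans (partials_dotr_le td (HB _ _ sN))).
by rewrite ler_wpM2r// ler_weXn2l.
Qed.

Definition inbox (r : R) x := forall j, `|x 0 j| <= r.

Lemma enorm_le_box (r : R) x : inbox r x -> enorm x <= n%:R * r.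
Proof.
move=> xr; rewrite (le_trans (enorm_le_sum x))// (le_trans (ler_sum _ (fun j _ => xr j)))//.
by rewrite sumr_const card_ord mulr_natl.
Qed.

Lemma notin_box r x : ~ inbox r x -> r < enorm x.
Proof.
move=> /existsNP[j /negP]; rewrite -ltNge => /lt_le_trans; apply.
exact: abs_le_enorm.
Qed.

(** [ubsm] is boundedness of every derivative uniformly along the sequence, [loc0] is locally
    uniform convergence to 0. Together they imply convergence after multiplication by a Schwartz
    function ([convergence]). *)
Definition ubsm (g : nat -> 'rV[R]_n -> R) := (forall i, smooth (g i)) /\
  forall N, exists B : R, forall i s x, (size s <= N)%N -> `|partials s (g i) x| <= B.

Definition loc0 (g : nat -> 'rV[R]_n -> R) := forall r e : R, 0 < e ->
  exists I : nat, forall i, (I <= i)%N -> forall x, inbox r x -> `|g i x| <= e.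

Lemma rschw_bound f N : rschw f -> exists B : R, 0 <= B /\ forall s x, (size s <= N)%N ->
  `|partials s f x| <= B.
Proof.
move=> [_ /(_ N)[B W]]; exists B; split; first exact: wsup_ge0 W.
move=> s x sN; rewrite (le_trans (wsup_pt x W sN))// ler_pdivrMr ?exprn_gt0 ?gt0_enorm//.
by rewrite ler_peMr ?(wsup_ge0 W)// exprn_ege1// ge1_enorm.
Qed.

Lemma rschw_bsm f : rschw f -> bsm f.
Proof.
move=> sf; split; first by case: sf.
by move=> N; have [B [_ HB]] := rschw_bound N sf; exists B => s x; exact: HB.
Qed.

Lemma ubsm_bsm (g : nat -> 'rV[R]_n -> R) i : ubsm g -> bsm (g i).
Proof.
by move=> [sg bg]; split=> // N; have [B HB] := bg N; exists B => s x; exact: HB.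
Qed.

(** Interpolation between orders: with second derivatives uniformly bounded, small values on a box
    enlarged by 1 force a small first derivative on the box, through a difference quotient. *)
Lemma loc0_partials (g : nat -> 'rV[R]_n -> R) N : ubsm g -> loc0 g -> forall r e : R, 0 < e ->
  exists I : nat, forall i, (I <= i)%N ->
    forall s x, (size s <= N)%N -> inbox r x -> `|partials s (g i) x| <= e.
Proof.
move=> [sg bg] lg; elim: N => [|N IH] r e e0.
  have [I HI] := lg r e e0; exists I => i iI s x; rewrite leqn0 => /nilP -> /=.
  exact: HI.
have [B HB] := bg N.+2.
have B0 : 0 <= B by exact: le_trans (HB 0%N [::] 0 (leq0n _)).
(* The difference quotient of step t errs by at most B t <= e / 2; values below t e / 4 at its two
   end points contribute the other e / 2. *)
pose t := Num.min 1 (e / (2 * (B + 1))).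
have t0 : 0 < t by rewrite lt_min ltr01 divr_gt0// mulr_gt0// ltr_wpDl.
have t1 : t <= 1 by rewrite ge_min lexx.
have tB : B * t <= e / 2.
  apply: (@le_trans _ _ (B * (e / (2 * (B + 1))))).
    by rewrite ler_wpM2l// ge_min lexx orbT.
  have B1 : 0 < B + 1 by rewrite ltr_wpDl.
  have -> : B * (e / (2 * (B + 1))) = e / 2 * (B / (B + 1)).
    by field; rewrite gt_eqF.
  by rewrite ler_piMr ?divr_ge0 ?(ltW e0)// ler_pdivrMr// mul1r lerDl.
have e'0 : 0 < t * e / 4 by rewrite divr_gt0// mulr_gt0.
have [I HI] := IH (r + 1) _ e'0; exists I => i iI [|j s] x sN xr.
  apply: (le_trans (HI i iI [::] x _ _)) => //.
    by move=> j; rewrite (le_trans (xr j))// lerDl.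
  rewrite mulrAC ler_piMl ?(ltW e0)//; lra.
have sps := smooth_partials s (sg i).
have xe : inbox (r + 1) (t *: e_ j + x).
  move=> k; rewrite !mxE eqxx/= (le_trans (ler_normD _ _))// addrC lerD//.
  rewrite normrM (ger0_norm (ltW t0)) ger0_norm ?ler0n//.
  by case: (k == j); rewrite ?mulr1// mulr0.
have xb : inbox (r + 1) x by move=> k; rewrite (le_trans (xr k))// lerDl.
have H1 := HI i iI s _ sN xe; have H2 := HI i iI s _ sN xb.
have H3 := line_taylor x t (fun y => smooth_derivable sps)
  (fun y => smooth_derivable (smooth_derive j sps)) B0
  (fun y => HB i [:: j, j & s] y sN).
rewrite /= -(ler_pM2l t0) -{1}(ger0_norm (ltW t0)) -normrM.
set D := t * _ in H3 *; set a := partials s _ _ in H3 H1; set b := partials s _ x in H3 H2.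
have -> : D = (a - b) - (a - b - D) by rewrite opprB addrCA subrr addr0.
apply: (le_trans (ler_normB _ _)).
apply: (@le_trans _ _ ((t * e / 4 + t * e / 4) + B * t ^+ 2)).
  by rewrite lerD// (le_trans (ler_normB _ _))// lerD.
have -> : B * t ^+ 2 = t * (B * t) by rewrite expr2 mulrCA.
have : t * (B * t) <= t * (e / 2) by rewrite ler_pM2l.
rewrite [t * (e / 2)]mulrA; move: (t * (B * t)) => q; move: (t * e) => p; lra.
Qed.

(** The decay of w is used with one spare power of the weight. Outside a large box this power makes
    the product small, the derivatives of g being merely bounded; inside the box [loc0_partials]
    applies. *)
Lemma convergence w (g : nat -> 'rV[R]_n -> R) : rschw w -> ubsm g -> loc0 g ->
  forall N (e : R), 0 < e -> exists I : nat, forall i, (I <= i)%N ->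
    wsup N (fun x => w x * g i x) e.
Proof.
move=> [sw Hw] ug lg N e e0; have [sg bg] := ug.
have [A HA] := Hw N.+1; have A0 := wsup_ge0 HA.
have [B HB] := bg N; have B0 : 0 <= B by exact: le_trans (HB 0%N [::] 0 (leq0n _)).
pose K : R := 2 ^+ N * (A + 1) * (B + 1).
have K0 : 0 < K by rewrite !mulr_gt0 ?exprn_gt0 ?ltr_wpDl.
(* Radius K / e and tolerance e / K: the spare power of the weight is worth e / K outside the box,
   and K dominates all constants. *)
have [I HI] := loc0_partials N ug lg (K / e) (divr_gt0 e0 K0).
exists I => i iI s x sN.
have Aw s' : (size s' <= N)%N -> `|partials s' w x| <= A / (1 + enorm x) ^+ N.+1.
  by move=> s'N; exact: (wsup_pt x HA (leqW s'N)).
have [xb|/notin_box xb] := pselect (inbox (K / e) x).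
  have := partialsM_le sw (sg i) Aw (fun s sN => HI i iI s x sN xb) sN.
  move=> /(ler_wpM2l (exprn_ge0 N (ltW (gt0_enorm x)))) /le_trans; apply.
  rewrite exprS invfM.
  set q := (1 + enorm x) ^+ N; have q0 : 0 < q by rewrite exprn_gt0.
  rewrite [leLHS](_ : _ = e * ((2 ^+ N * A) / K) * (1 + enorm x)^-1); last first.
    by field; rewrite !gt_eqF.
  have h1 : 2 ^+ N * A / K <= 1.
    rewrite ler_pdivrMr// mul1r /K -mulrA ler_wpM2l ?exprn_ge0//; nra.
  have h3 : 0 <= 2 ^+ N * A / K by rewrite !mulr_ge0 ?exprn_ge0 ?invr_ge0 ?(ltW K0).
  rewrite -mulrA ler_piMr ?(ltW e0)// mulr_ile1//.
    by rewrite invr_ge0 ltW.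
  by rewrite invf_le1.
have := partialsM_le sw (sg i) Aw (fun s sN => HB i s x sN) sN.
move=> /(ler_wpM2l (exprn_ge0 N (ltW (gt0_enorm x)))) /le_trans; apply.
rewrite exprS invfM.
set q := (1 + enorm x) ^+ N; have q0 : 0 < q by rewrite exprn_gt0.
rewrite [leLHS](_ : _ = (2 ^+ N * A * B) / (1 + enorm x)); last first.
  by field; rewrite !gt_eqF.
rewrite ler_pdivrMr// mulrDr mulr1; move: xb; rewrite ltr_pdivrMr// mulrC => xb.
rewrite (le_trans _ (ltW (ltr_wpDl (ltW e0) xb)))//.
rewrite /K -!mulrA ler_wpM2l ?exprn_ge0//; nra.
Qed.

(** For c <= 1 the derivatives only gain; the loss c^-N comes from the weight, as the function is
    stretched. *)
Lemma wsup_dil N (c : R) f B : 0 < c <= 1 -> smooth f -> wsup N f B ->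
  wsup N (fun u => f (c *: u)) (c ^- N * B).
Proof.
move=> /andP[c0 c1] sf H s x sN; rewrite partials_scale ?gt_eqF//.
rewrite [leRHS]mulrC ler_pdivlMr ?exprn_gt0// normrM.
have Hx := H s (c *: x) sN.
apply: le_trans Hx; rewrite [leLHS]mulrC mulrA -exprMn normrX ger0_norm ?(ltW c0)//.
apply: ler_pM.
- by rewrite exprn_ge0// mulr_ge0// ltW.
- by rewrite mulr_ge0// exprn_ge0// ltW.
- rewrite lerXn2r ?nnegrE ?mulr_ge0 ?(ltW c0) ?(ltW (gt0_enorm _))//.
  by rewrite enormZ mulrDr mulr1 (ger0_norm (ltW c0)) lerD2r.
by rewrite ler_piMl// exprn_ile1// ltW.
Qed.

Lemma rschw_dil (c : R) f : 0 < c <= 1 -> rschw f -> rschw (fun u => f (c *: u)).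
Proof.
move=> c01 [sf Hf]; split=> [|N].
  by apply: smooth_scale => //; rewrite gt_eqF//; case/andP: c01.
have [B HB] := Hf N.
by eexists; exact: (wsup_dil c01 sf HB).
Qed.

End Weighted.
#[global] Hint Resolve ge1_enorm gt0_enorm : core.

(** * Restriction to real test functions *)

Section Functional.
Context (R : realType) (n : nat) (E : completeNormedModType R[i]).
Variables (h : {linear schwartz R n -> E}).
Implicit Types (f g : 'rV[R]_n -> R) (x u v : 'rV[R]_n) (s : seq 'I_n).

Lemma rnorm_complex (a b : R) : rnorm (a +i* b : R[i]^o) = Num.sqrt (a ^+ 2 + b ^+ 2).
Proof. by rewrite /rnorm normc_def. Qed.

Lemma abs_Re_le (c : R[i]) : `|complex.Re c| <= rnorm (c : R[i]^o).
Proof.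
by case: c => a b; rewrite rnorm_complex /= -sqrtr_sqr ler_wsqrtr// lerDl sqr_ge0.
Qed.

Lemma abs_Im_le (c : R[i]) : `|complex.Im c| <= rnorm (c : R[i]^o).
Proof.
by case: c => a b; rewrite rnorm_complex /= -sqrtr_sqr ler_wsqrtr// lerDr sqr_ge0.
Qed.

Lemma rnorm_real (a : R) : rnorm (a%:C : R[i]^o) = `|a|.
Proof. by rewrite rnorm_complex expr0n addr0 sqrtr_sqr. Qed.

Lemma rnormZr (a : R) (v : E) : rnorm (a%:C *: v) = `|a| * rnorm v.
Proof. by rewrite rnormZ rnorm_real. Qed.

Lemma rnorm_i (v : E) : rnorm ('i%C *: v) = rnorm v.
Proof. by rewrite rnormZ rnorm_complex expr0n expr1n add0r sqrtr1 mul1r. Qed.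

Lemma rnormN (v : E) : rnorm (- v) = rnorm v.
Proof. by rewrite /rnorm normrN. Qed.

Lemma rnorm_eq0 (v : E) : rnorm v = 0 -> v = 0.
Proof. by move=> v0; apply/eqP; rewrite -normr_eq0 -RnormE v0. Qed.

Lemma ler_rnormB (v w : E) : rnorm (v - w) <= rnorm v + rnorm w.
Proof. by rewrite (le_trans (ler_rnormD _ _))// rnormN. Qed.

Lemma rnorm_sum (I : Type) (r : seq I) (F : I -> E) :
  rnorm (\sum_(i <- r) F i) <= \sum_(i <- r) rnorm (F i).
Proof.
elim: r => [|i r IH]; first by rewrite !big_nil rnorm0.
by rewrite !big_cons (le_trans (ler_rnormD _ _))// lerD2l.
Qed.

Definition toC f : 'rV[R]_n -> R[i]^o := fun u => (f u)%:C.

Lemma cpartials_toC s f x : cpartials s (toC f) x = (partials s f x)%:C.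
Proof. by rewrite /cpartials; congr (_ +i* _); rewrite partials0. Qed.

Lemma is_schwartz_toC f : rschw f -> is_schwartz (toC f).
Proof.
move=> [sf Hf]; split=> [||k s]; [exact: sf|exact: smooth_cst|].
have [B HB] := Hf (maxn k (size s)); exists B => _ [x _ <-].
rewrite /weighted cpartials_toC rnorm_real.
apply: le_trans (HB s x (leq_maxr _ _)).
by rewrite ler_wpM2r// ler_weXn2l// leq_maxl.
Qed.

Lemma rschw_part (F : 'rV[R]_n -> R[i]^o) f : smooth f ->
  (forall k s, has_ubound (range (weighted k s F))) ->
  (forall s x, `|partials s f x| <= rnorm (cpartials s F x)) -> rschw f.
Proof.
move=> sf Hb fF; split=> // N.
have [B HB] := choice (fun s => Hb N s).
(* There are finitely many lists of length at most N, so the sum of their individual bounds serves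
   for all of them. *)
exists (\sum_(m < N.+1) \sum_(t : m.-tuple 'I_n) `|B t|) => s x sN.
apply: (@le_trans _ _ (weighted N s F x)).
  exact: (ler_wpM2l (exprn_ge0 N (ltW (gt0_enorm x))) (fF s x)).
apply: (@le_trans _ _ `|B s|).
  by rewrite (le_trans _ (ler_norm _))//; apply: HB; exists x.
rewrite (bigD1 (Ordinal (sN : (size s < N.+1)%N)))//= -[leLHS]addr0 lerD//.
  rewrite (bigD1 (in_tuple s))//= lerDl sumr_ge0//.
by rewrite sumr_ge0// => i _; rewrite sumr_ge0.
Qed.

Lemma rschw_Re (phi : schwartz R n) : rschw (@complex.Re R \o phi).
Proof.
have [s1 s2 H] := schwartzP phi; apply: (rschw_part s1 H) => s x.
exact: (abs_Re_le (cpartials s phi x)).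
Qed.

Lemma rschw_Im (phi : schwartz R n) : rschw (@complex.Im R \o phi).
Proof.
have [s1 s2 H] := schwartzP phi; apply: (rschw_part s2 H) => s x.
exact: (abs_Im_le (cpartials s phi x)).
Qed.

(** [insubd] returns 0 when f is not Schwartz, which is why the algebraic rules for [hr] below
    assume [rschw]. *)
Definition rtest f : schwartz R n := insubd 0 (toC f).

Lemma rtestE f : rschw f -> rtest f = toC f :> ('rV[R]_n -> R[i]^o).
Proof. by move=> sf; rewrite /rtest insubdK// inE; exact: is_schwartz_toC. Qed.

Definition hr f : E := h (rtest f).

Lemma hrD f g : rschw f -> rschw g -> hr (fun u => f u + g u) = hr f + hr g.
Proof.
move=> sf sg; rewrite /hr -linearD; congr (h _); apply/val_inj => /=.
rewrite (rtestE (rschwD sf sg)) rtestE// rtestE//; apply/funext => x.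
by rewrite /toC rmorphD.
Qed.

Lemma hrZ (c : R) f : rschw f -> hr (fun u => c * f u) = c%:C *: hr f.
Proof.
move=> sf; rewrite /hr -linearZ; congr (h _); apply/val_inj => /=.
rewrite (rtestE (rschwZ c sf)) rtestE//; apply/funext => x.
by rewrite /toC rmorphM.
Qed.

Lemma hrB f g : rschw f -> rschw g -> hr (fun u => f u - g u) = hr f - hr g.
Proof.
move=> sf sg.
have -> : (fun u => f u - g u) = (fun u => f u + (-1) * g u).
  by apply/funext => u; rewrite mulN1r.
by rewrite hrD ?hrZ//; [rewrite rmorphN1 scaleN1r|exact: rschwZ].
Qed.

Lemma hr0 : hr (fun=> 0) = 0.
Proof.
have -> : (fun _ : 'rV[R]_n => 0 : R) = (fun u : 'rV[R]_n => 0 * (fun=> 0 : R) u).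
  by apply/funext => u; rewrite mul0r.
by rewrite hrZ ?scale0r//; exact: rschw0.
Qed.

Lemma hr_sum (I : Type) (r : seq I) (F : I -> 'rV[R]_n -> R) :
  (forall i, rschw (F i)) ->
  hr (fun u => \sum_(i <- r) F i u) = \sum_(i <- r) hr (F i).
Proof.
move=> sF; elim: r => [|i r IH].
  by under eq_fun do rewrite big_nil; rewrite hr0 big_nil.
under eq_fun do rewrite big_cons.
by rewrite hrD ?IH ?big_cons//; exact: rschw_sum.
Qed.

Lemma h_split (phi : schwartz R n) :
  h phi = hr (@complex.Re R \o phi) + 'i%C *: hr (@complex.Im R \o phi).
Proof.
rewrite /hr -linearZ -linearD; congr (h _); apply/val_inj => /=.
rewrite (rtestE (rschw_Re phi)) (rtestE (rschw_Im phi)); apply/funext => x.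
rewrite [RHS]/GRing.add/= [X in _ + X]/GRing.scale/= /toC /=.
by case: (phi x) => a b; apply/eqP; rewrite eq_complex/=; apply/andP; split; apply/eqP; ring.
Qed.

Hypothesis h_continuous : continuous h.

(** Only continuity at 0 is used: a neighbourhood of 0 contains a ball for finitely many seminorms,
    and homogeneity turns it into an inequality for one norm. *)
Lemma hr_bound : exists N (C : R), 0 <= C /\ forall f (B : R), rschw f ->
  wsup N f B -> rnorm (hr f) <= C * B.
Proof.
have /cvgrPdist_lt /(_ 1 ltr01) := @h_continuous 0.
rewrite linear0 => -[N [e [e0 H]]].
exists N, (2 / e); split; first by rewrite divr_ge0// ltW.
(* The rescaling divides by B; the case B = 0 is reached by enlarging B arbitrarily little. *)
suff S f (B : R) : 0 < B -> rschw f -> wsup N f B -> rnorm (hr f) <= 2 / e * B.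
  move=> f B sf wB; apply/ler_addgt0Pr => d d0.
  have B0 := wsup_ge0 wB.
  have dC : 0 < d / (2 / e) by rewrite divr_gt0// divr_gt0.
  have BB : B <= B + d / (2 / e) by rewrite lerDl ltW.
  apply: (le_trans (S f _ _ sf (wsup_le BB wB))); first by rewrite ltr_wpDl.
  by rewrite mulrDr [_ * (d / _)]mulrC divfK// gt_eqF// divr_gt0.
move=> B0 sf wB.
(* With this factor the seminorms are at most e / 2, hence strictly below e as the neighbourhood
   requires. *)
have c0 : 0 < e / (2 * B) by rewrite divr_gt0// mulr_gt0.
have sg := rschwZ (e / (2 * B)) sf.
have := H (rtest (fun u => e / (2 * B) * f u)).
rewrite /mkset => /(_ _) /=.
rewrite sub0r normrN -RnormE (_ : (1 : R[i]) = 1%:C)// ltcR.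
have -> : h (rtest (fun u => e / (2 * B) * f u)) = (e / (2 * B))%:C *: hr f.
  by rewrite -hrZ.
rewrite rnormZr (gtr0_norm c0) => S.
have: e / (2 * B) * rnorm (hr f) < 1.
  apply: S => k s kN sN; rewrite subr0.
  apply: (@le_lt_trans _ _ (e / 2)); last by rewrite ltr_pdivrMr// ltr_pMr// ltr1n.
  apply: ge_sup; first by eexists; exists 0.
  move=> _ [x _ <-]; rewrite /weighted rtestE// cpartials_toC rnorm_real.
  rewrite partialsZ; last by case: sf.
  rewrite normrM (gtr0_norm c0) mulrCA.
  apply: (@le_trans _ _ (e / (2 * B) * B)); last first.
    by rewrite invfM mulrA divfK// gt_eqF.
  rewrite ler_wpM2l ?(ltW c0)// (le_trans _ (wB s x sN))//.
  by rewrite ler_wpM2r// ler_weXn2l.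
rewrite mulrC -ltr_pdivlMr// mul1r invf_div => /ltW/le_trans; apply.
by rewrite mulrAC.
Qed.

Lemma hr_dil_bound : exists N (C : R), 0 <= C /\ forall (c : R) f (B : R),
  0 < c <= 1 -> rschw f -> wsup N f B ->
  rnorm (hr (fun u => f (c *: u))) <= C * (c ^- N * B).
Proof.
have [N [C [C0 H]]] := hr_bound; exists N, C; split=> // c f B c01 sf wB.
by apply: H; [exact: rschw_dil|apply: wsup_dil => //; case: sf].
Qed.

Definition cutoff (r : R) u : R := \prod_(j < n) bump (dotr (r^-1 *: delta_mx 0 j) u).

Lemma dotr_scaled (r : R) j u : dotr (r *: delta_mx 0 j) u = r * u 0 j.
Proof. by rewrite dotrZl dotrC dotr_delta. Qed.

Lemma bump_tower : exists d : nat -> R -> R, [/\ d 0%N = @bump R, tower d &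
  forall k, exists B : R, forall t, `|d k t| <= B].
Proof.
apply: (@tower_bounded R (@bump R) (- 2) 2 0 0) => [|||x x2].
- exact: ck_bump.
- lra.
- by move=> x x2; rewrite bump0// ler_normr; apply/orP; right; lra.
- by rewrite bump0// ler_normr (ltW x2).
Qed.

Lemma bsm_bump_uniform N : exists B : R, forall (r : R) j s x, 1 <= r ->
  (size s <= N)%N -> `|partials s (fun u => bump (dotr (r^-1 *: delta_mx 0 j) u)) x| <= B.
Proof.
have [d [d0 td bd]] := bump_tower.
have [B [B0 HB]] := tower_uniform N bd.
exists (2 ^+ N * B) => r j s x r1 sN; rewrite -d0.
apply: (le_trans (partials_dotr_le td (HB _ _ sN))).
rewrite ler_wpM2r//.
apply: (@le_trans _ _ (2 ^+ size s)); last by rewrite ler_weXn2l// ler1n.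
have r0 : 0 < r by rewrite (lt_le_trans _ r1).
suff H : enorm (r^-1 *: delta_mx 0 j : 'rV[R]_n) <= 1.
  by rewrite lerXn2r ?nnegrE ?(ltW (gt0_enorm _))//; lra.
rewrite (le_trans (enorm_le_sum _))// (bigD1 j)//= big1 ?addr0.
  by rewrite !mxE !eqxx mulr1 ger0_norm ?invr_ge0 ?(ltW r0)// invf_le1.
by move=> i ij; rewrite !mxE (negbTE ij) andbF mulr0 normr0.
Qed.

Lemma smooth_bump (r : R) j : smooth (fun u => bump (dotr (r^-1 *: delta_mx 0 j) u)).
Proof. by have [d [<- td bd]] := bump_tower; exact: smooth_dotr. Qed.

Lemma smooth_cutoff r : smooth (cutoff r).
Proof. by apply: smooth_prod => j; exact: smooth_bump. Qed.

(** Uniform in r >= 1, since each derivative brings out a factor 1/r; this makes truncations at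
    growing r converge in every norm. *)
Lemma cutoff_bound N : exists B : R, forall (r : R) s x, 1 <= r ->
  (size s <= N)%N -> `|partials s (cutoff r) x| <= B.
Proof.
have [B HB] := bsm_bump_uniform N.
have H (l : seq 'I_n) : exists A : R, forall (r : R) s x, 1 <= r -> (size s <= N)%N ->
    `|partials s (fun u => \prod_(j <- l) bump (dotr (r^-1 *: delta_mx 0 j) u)) x| <= A.
  elim: l => [|j l [A HA]].
    have [_ /(_ N)[A HA]] := @bsm_cst R n 1; exists A => r s x _ sN.
    by under eq_fun do rewrite big_nil; exact: HA.
  exists (2 ^+ N * (B * A)) => r s x r1 sN.
  under eq_fun do rewrite big_cons.
  apply: (partialsM_le (N := N)) => //; [exact: smooth_bump| |move=> s' s'N; exact: HB|].
    by apply: smooth_prod => i; exact: smooth_bump.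
  by move=> s' s'N; exact: HA.
exact: (H (index_enum _)).
Qed.

Lemma bsm_cutoff r : 1 <= r -> bsm (cutoff r).
Proof.
move=> r1; split=> [|N]; first exact: smooth_cutoff.
by have [B HB] := cutoff_bound N; exists B => s x; exact: HB.
Qed.

Lemma cutoff1 r x : 0 < r -> inbox r x -> cutoff r x = 1.
Proof.
move=> r0 xr; apply: big1 => j _; rewrite dotr_scaled bump1// normrM normfV.
by rewrite (gtr0_norm r0) mulrC ler_pdivrMr// mul1r; exact: xr.
Qed.

Lemma cutoff0 r x : 0 < r -> (exists j, 2 * r <= `|x 0 j|) -> cutoff r x = 0.
Proof.
move=> r0 [j xj]; rewrite /cutoff (bigD1 j)//= dotr_scaled bump0 ?mul0r//.
by rewrite normrM normfV (gtr0_norm r0) mulrC ler_pdivlMr.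
Qed.

Lemma ubsm_cutoff (r : nat -> R) : (forall i, 1 <= r i) ->
  ubsm (fun i u => 1 + (-1) * cutoff (r i) u).
Proof.
move=> r1; split=> [i|N].
  exact: (smoothD (smooth_cst 1) (smoothZ (-1) (smooth_cutoff (r i)))).
have [B HB] := cutoff_bound N.
have [_ /(_ N)[A HA]] := @bsm_cst R n 1.
exists (A + B) => i s x sN.
rewrite (partialsD s (smooth_cst 1) (smoothZ (-1) (smooth_cutoff (r i)))).
rewrite (le_trans (ler_normD _ _))// lerD ?HA//.
by rewrite (partialsZ s (-1) (smooth_cutoff _)) mulN1r normrN HB.
Qed.

Lemma loc0_cutoff (r : nat -> R) : (forall i, i%:R < r i) ->
  loc0 (fun i u => 1 + (-1) * cutoff (r i) u).
Proof.
move=> Hr b e e0.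
exists (Num.bound b) => i iI x xb; rewrite cutoff1 ?mulN1r ?subrr ?normr0 ?(ltW e0)//.
  by rewrite (le_lt_trans _ (Hr i)).
move=> j; rewrite (le_trans (xb j))// (le_trans _ (ltW (Hr i)))//.
have [b0|b0] := leP 0 b; last by rewrite (le_trans (ltW b0)).
by rewrite (le_trans (ltW (archi_boundP b0)))// ler_nat.
Qed.

Lemma hr_cutoff_approx f (e : R) : rschw f -> 0 < e ->
  exists I : nat, forall i, (I <= i)%N ->
    rnorm (hr f - hr (fun u => f u * cutoff i.+1%:R u)) <= e.
Proof.
move=> sf e0; have [N [C [C0 H]]] := hr_bound.
have r1 (i : nat) : 1 <= i.+1%:R :> R by rewrite ler1n.
have r2 (i : nat) : i%:R < i.+1%:R :> R by rewrite ltr_nat.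
have e1 : 0 < e / (C + 1) by rewrite divr_gt0// ltr_wpDl.
have [I HI] := convergence sf (ubsm_cutoff r1) (loc0_cutoff r2) N e1.
exists I => i iI.
have sc : rschw (fun u => f u * cutoff i.+1%:R u).
  by apply: rschwM => //; exact: bsm_cutoff.
rewrite -hrB//.
have -> : (fun u => f u - f u * cutoff i.+1%:R u) =
    (fun u => f u * (1 + (-1) * cutoff i.+1%:R u)).
  by apply/funext => u; ring.
apply: (le_trans (H _ _ _ (HI i iI))).
  by apply: rschwM => //; exact: (ubsm_bsm i (ubsm_cutoff r1)).
by rewrite mulrA ler_pdivrMr ?ltr_wpDl// mulrC ler_wpM2l ?(ltW e0)// lerDl.
Qed.

Variable Gamma : set 'rV[R]_n.
Hypothesis h_supported : supported_by Gamma h.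

Lemma compact_inbox (r : R) : compact (inbox r : set 'rV[R]_n).
Proof.
have -> : (inbox r : set 'rV[R]_n) = [set v | forall i, `[- r, r]%classic (v 0 i)].
  by apply/seteqP; split=> v H i; have := H i; rewrite /= in_itv/= ler_norml.
exact: (rV_compact (fun=> @segment_compact R (- r) r)).
Qed.

(** [supported_by] concerns compactly supported test functions only. The truncations of f have
    compact support off U and are annihilated; continuity carries this over to f. *)
Lemma hr_local0 f (U : set 'rV[R]_n) : rschw f -> open U -> Gamma `<=` U ->
  (forall u, U u -> f u = 0) -> hr f = 0.
Proof.
move=> sf oU GU fU; apply: rnorm_eq0; apply/le_anti/andP; split; last exact: rnorm_ge0.
apply/ler_addgt0Pl => e e0; rewrite addr0.
have [I /(_ I (leqnn _))] := hr_cutoff_approx sf e0.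
set g := (fun u => f u * _) => Hg.
have I0 : (0 : R) < I.+1%:R by [].
have sg : rschw g.
  by apply: rschwM => //; apply: bsm_cutoff; rewrite ler1n.
have sup1 : [set u | rtest g u != 0] `<=` ~` U `&` inbox (2 * I.+1%:R).
  move=> u /=; rewrite rtestE// /toC /g => gu; split.
    by move=> Uu; move: gu; rewrite fU// mul0r eqxx.
  apply: contrapT => /existsNP[j /negP]; rewrite -ltNge => /ltW uj.
  by move: gu; rewrite (@cutoff0 _ u) ?mulr0 ?eqxx//; exists j.
have cl : closed (inbox (2 * I.+1%:R) : set 'rV[R]_n).
  by apply: compact_closed; [exact: norm_hausdorff|exact: compact_inbox].
(* Vanishing on the open set U, and not just on Gamma, is what keeps the closed support away from
   Gamma. *)
have sup2 : tsupport (rtest g) `<=` ~` U `&` inbox (2 * I.+1%:R).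
  have cc : closed (~` U `&` (inbox (2 * I.+1%:R) : set 'rV[R]_n)).
    by apply: closedI => //; exact: open_closedC.
  by rewrite [X in _ `<=` X]((closure_id _).1 cc); exact: closureS.
have g0 : hr g = 0.
  apply: h_supported.
    apply: (@subclosed_compact _ _ (inbox (2 * I.+1%:R))) => //.
    - exact: closed_closure.
    - exact: compact_inbox.
    - by move=> u /sup2[].
  by apply/seteqP; split=> // u [/sup2[nU _] /GU].
by move: Hg; rewrite g0 subr0.
Qed.

Lemma h_local0 (phi : schwartz R n) (U : set 'rV[R]_n) : open U -> Gamma `<=` U ->
  (forall u, U u -> phi u = 0) -> h phi = 0.
Proof.
move=> oU GU pU; rewrite h_split.
rewrite (hr_local0 (rschw_Re phi) oU GU) ?(hr_local0 (rschw_Im phi) oU GU) ?scaler0 ?addr0//.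
  by move=> u /pU /= ->.
by move=> u /pU /= ->.
Qed.

End Functional.

(** * Exponentials near the cone *)

Section ConeExponentials.
Context (R : realType) (n : nat).
Variables (omega : 'rV[R]_n) (delta : R).
Hypothesis delta_gt0 : 0 < delta.
Implicit Types (x u : 'rV[R]_n) (s : seq 'I_n).

Local Notation e_ j := (delta_mx 0 j : 'rV[R]_n).

(** Rises from 0 at t = -1 to 1 at t = -1/2, so that it is 1 on a neighbourhood of the half-line t
    >= 0. *)
Definition step2 (t : R) : R := step (2 * t + 2).

Lemma step2_tower : exists d : nat -> R -> R, [/\ d 0%N = step2, tower d &
  forall k, exists B : R, forall t, `|d k t| <= B].
Proof.
apply: (@tower_bounded R step2 (- 1) (- 1 / 2) 0 1) => [k|||].
- by apply: ck_affine; exact: ck_step.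
- lra.
- by move=> x x2; rewrite /step2 step0//; lra.
- by move=> x x2; rewrite /step2 step1//; lra.
Qed.

(** The cutoff chi. For a suitable delta the 2n vectors omega +- delta e_j lie in the conjugate
    cone, so every factor is 1 near Gamma; conversely, where no factor vanishes, these 2n
    inequalities bound |u| by omega.u. *)
Definition cone_cut u : R := \prod_(j < n)
  (step2 (dotr (omega + delta *: e_ j) u) * step2 (dotr (omega - delta *: e_ j) u)).

Lemma bsm_step2 x : bsm (fun u => step2 (dotr x u)).
Proof. by have [d [<- td bd]] := step2_tower; exact: bsm_dotr. Qed.

Lemma bsm_cone_cut : bsm cone_cut.
Proof. by apply: bsm_prod => j; apply: bsmM; exact: bsm_step2. Qed.

(** Real part of e^{iz.u}, z = x + i t omega, for c = 0, and imaginary part for c = -pi/2. *)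
Definition ecos x (t c : R) u : R :=
  expR (dotr (- (t *: omega)) u) * cos (dotr x u + c).

Lemma smooth_expR_dotr x : smooth (fun u : 'rV[R]_n => expR (dotr x u)).
Proof. exact: (smooth_dotr x (@tower_expR R)). Qed.

Lemma cos_shiftE (c : R) x : (fun u => cos (dotr x u + c)) =
  (fun u => (fun (k : nat) t => cos (t + (c + k%:R * (pi / 2)))) 0%N (dotr x u)).
Proof. by apply/funext => u; rewrite mul0r addr0. Qed.

Lemma smooth_cos_dotr (c : R) x : smooth (fun u : 'rV[R]_n => cos (dotr x u + c)).
Proof. by rewrite cos_shiftE; apply: (smooth_dotr x (tower_cos c)). Qed.

Lemma smooth_ecos x t c : smooth (ecos x t c).
Proof. by apply: smoothM; [exact: smooth_expR_dotr|exact: smooth_cos_dotr]. Qed.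

Definition cone_ecos x t c u : R := cone_cut u * ecos x t c u.

Lemma smooth_cone_ecos x t c : smooth (cone_ecos x t c).
Proof. by apply: smoothM; [have [] := bsm_cone_cut|exact: smooth_ecos]. Qed.

Lemma cone_cut0 j u :
  dotr (omega + delta *: e_ j) u < - 1 \/ dotr (omega - delta *: e_ j) u < - 1 ->
  cone_cut u = 0.
Proof.
have H (t : R) : t < - 1 -> step2 t = 0 by move=> t1; rewrite /step2 step0//; lra.
rewrite /cone_cut (bigD1 j)//=.
case=> h.
  by rewrite (H _ h) mul0r mul0r.
by rewrite (H _ h) [X in X * _]mulr0 mul0r.
Qed.

Definition near_cone u := forall j,
  - 1 <= dotr (omega + delta *: e_ j) u /\ - 1 <= dotr (omega - delta *: e_ j) u.

Lemma open_dotr_lt x (a : R) : open [set u : 'rV[R]_n | dotr x u < a].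
Proof.
apply: (@open_comp _ _ (dotr x : 'rV[R]_n -> R) [set t | t < a]); last exact: open_lt.
by move=> u _; exact: continuous_dotr.
Qed.

Lemma open_dotr_gt x (a : R) : open [set u : 'rV[R]_n | a < dotr x u].
Proof.
apply: (@open_comp _ _ (dotr x : 'rV[R]_n -> R) [set t | a < t]); last exact: open_gt.
by move=> u _; exact: continuous_dotr.
Qed.

Lemma cone_ecos_far x t c s u : ~ near_cone u -> partials s (cone_ecos x t c) u = 0.
Proof.
move=> /existsNP[j /not_andP Hj].
have [w [Hw wu]] : exists w, (w = omega + delta *: e_ j \/ w = omega - delta *: e_ j)
    /\ dotr w u < - 1.
  by case: Hj => /negP; rewrite -ltNge => H; [exists (omega + delta *: e_ j)|
    exists (omega - delta *: e_ j)]; split=> //; [left|right].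
apply: (@partials_local0 _ _ _ [set v | dotr w v < - 1]) => //.
  exact: open_dotr_lt.
move=> v /= wv; rewrite /cone_ecos (@cone_cut0 j) ?mul0r//.
by case: Hw => <-; [left|right].
Qed.

Lemma near_cone_coord u j : near_cone u -> delta * `|u 0 j| <= 1 + dotr omega u.
Proof.
move=> /(_ j); rewrite dotrDl dotrDl dotrNl !dotrZl !(dotrC (e_ j)) !dotr_delta => -[h1 h2].
rewrite -(gtr0_norm delta_gt0) -normrM ler_norml; apply/andP; split; lra.
Qed.

Lemma near_cone_ge u : near_cone u -> - 1 <= dotr omega u.
Proof.
move=> H; case: (pselect (exists j : 'I_n, True)) => [[j _]|nj].
  have := near_cone_coord j H.
  have : 0 <= delta * `|u 0 j| by rewrite mulr_ge0// ltW.
  lra.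
(* Without an index j the dimension is 0 and the scalar product is an empty sum. *)
rewrite /dotr big1 ?lerN10// => j; exfalso; apply: nj; by exists j.
Qed.

Lemma near_cone_enorm u : near_cone u ->
  1 + enorm u <= (1 + n%:R / delta) * (2 + dotr omega u).
Proof.
move=> H; have h1 := near_cone_ge H.
have : enorm u <= n%:R / delta * (1 + dotr omega u).
  apply: (le_trans (enorm_le_sum u)).
  apply: (@le_trans _ _ (\sum_(j < n) (1 + dotr omega u) / delta)).
    apply: ler_sum => j _; rewrite ler_pdivlMr// mulrC.
    exact: near_cone_coord.
  rewrite sumr_const card_ord -mulr_natl; apply: eq_lerW.
  ring.
have : 0 <= n%:R / delta by rewrite divr_ge0// ltW.
move: (n%:R / delta) (dotr omega u) h1 => p t; nra.
Qed.

(** Each derivative of the cosine costs a factor 1 + |x|. The weight (1 + |u|)^N is absorbed by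
    e^{-t omega.u} at the price t^-N, because omega.u dominates |u| on the support of the cutoff. *)
Lemma wsup_cone_ecos N : exists C : R, 0 <= C /\ forall x t c, 0 < t <= 1 ->
  wsup N (cone_ecos x t c) (C * ((1 + enorm x) / t) ^+ N).
Proof.
have [scc /(_ N)[B HB]] := bsm_cone_cut.
have B0 : 0 <= B by exact: le_trans (HB [::] 0 (leq0n _)).
pose K : R := 1 + n%:R / delta.
have K0 : 0 <= K by rewrite addr_ge0// divr_ge0// ltW.
pose C : R := 2 ^+ N * (B * (2 ^+ N * ((1 + enorm omega) ^+ N)))
  * (K ^+ N * (N%:R ^+ N * expR 2)).
have O0 : 0 <= (1 + enorm omega) ^+ N := exprn_ge0 N (ltW (gt0_enorm omega)).
have C0 : 0 <= C by rewrite !mulr_ge0 ?O0 ?exprn_ge0 ?expR_ge0.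
exists C; split=> // x t c /andP[t0 t1] s u sN.
have [nu|fu] := pselect (near_cone u); last first.
  have P0 := exprn_ge0 N (divr_ge0 (ltW (gt0_enorm x)) (ltW t0)).
  by rewrite cone_ecos_far// normr0 mulr0 mulr_ge0.
pose T := dotr omega u.
have h1 : - 1 <= T := near_cone_ge nu.
have E1 : expR (dotr (- (t *: omega)) u) = expR (- (t * T)).
  by rewrite dotrNl dotrZl.
have P1 s' : (size s' <= N)%N ->
    `|partials s' (fun u => expR (dotr (- (t *: omega)) u)) u| <=
    (1 + enorm omega) ^+ N * expR (- (t * T)).
  move=> s'N; apply: (le_trans (@partials_dotr_le _ _ (fun=> @expR R) _ _
      (expR (- (t * T))) _ (@tower_expR R) _)).
    by rewrite /= E1 ger0_norm// expR_ge0.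
  rewrite ler_wpM2r ?expR_ge0//.
  apply: (@le_trans _ _ ((1 + enorm omega) ^+ size s')).
    rewrite lerXn2r ?nnegrE ?(ltW (gt0_enorm _))// lerD2l.
    by rewrite -scaleNr enormZ normrN gtr0_norm// ler_piMl// enorm_ge0.
  by rewrite ler_weXn2l.
have P2 s' : (size s' <= N)%N ->
    `|partials s' (fun u => cos (dotr x u + c)) u| <= (1 + enorm x) ^+ N.
  move=> s'N; rewrite cos_shiftE.
  apply: (le_trans (partials_dotr_le (B := 1) (tower_cos c) _)).
    by rewrite cos_max.
  by rewrite mulr1 ler_weXn2l.
have P3 s' : (size s' <= N)%N -> `|partials s' (ecos x t c) u| <=
    2 ^+ N * ((1 + enorm omega) ^+ N * expR (- (t * T)) * (1 + enorm x) ^+ N).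
  exact: (partialsM_le (smooth_expR_dotr _) (smooth_cos_dotr _ _) P1 P2).
have P4 := partialsM_le scc (smooth_ecos x t c) (fun s => HB s u) P3 sN.
(* From (t (2 + T))^N <= N^N e^{t (2 + T)}: the shift by 2 keeps the base positive, as T >= -1, and
   costs e^{2t} <= e^2. *)
have W : (1 + enorm u) ^+ N * expR (- (t * T)) <= K ^+ N * (N%:R ^+ N * expR 2) / t ^+ N.
  have tT : 0 <= t * (2 + T) by rewrite mulr_ge0 ?(ltW t0)//; lra.
  have := expr_le_expR N tT; rewrite exprMn => H.
  apply: (@le_trans _ _ ((K * (2 + T)) ^+ N * expR (- (t * T)))).
    rewrite ler_wpM2r ?expR_ge0// lerXn2r ?nnegrE ?(ltW (gt0_enorm _)) ?mulr_ge0//.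
      by lra.
    exact: near_cone_enorm.
  rewrite exprMn -!mulrA ler_wpM2l ?exprn_ge0// mulrA ler_pdivlMr ?exprn_gt0//.
  rewrite mulrC mulrA (le_trans (ler_wpM2r (expR_ge0 _) H))// -mulrA -expRD.
  rewrite ler_wpM2l ?exprn_ge0// ler_expR; lra.
apply: (le_trans (ler_wpM2l (exprn_ge0 N (ltW (gt0_enorm u))) P4)).
have X0 : 0 <= (1 + enorm x) ^+ N := exprn_ge0 N (ltW (gt0_enorm x)).
rewrite [leLHS](_ : _ = 2 ^+ N * (B * (2 ^+ N * ((1 + enorm omega) ^+ N))) *
  (1 + enorm x) ^+ N * ((1 + enorm u) ^+ N * expR (- (t * T)))); last by ring.
apply: (le_trans (ler_wpM2l _ W)).
  by rewrite !mulr_ge0 ?O0 ?X0 ?exprn_ge0.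
by rewrite expr_div_n /C; apply: eq_lerW; ring.
Qed.

Lemma rschw_cone_ecos x t c : 0 < t <= 1 -> rschw (cone_ecos x t c).
Proof.
move=> t01; split=> [|N]; first exact: smooth_cone_ecos.
have [C [C0 H]] := wsup_cone_ecos N.
by eexists; exact: (H x t c t01).
Qed.

Lemma cone_cut1 u : (forall j, - 1 / 2 < dotr (omega + delta *: e_ j) u /\
   - 1 / 2 < dotr (omega - delta *: e_ j) u) -> cone_cut u = 1.
Proof.
move=> H; apply: big1 => j _; have [h1 h2] := H j.
by rewrite /step2 !step1 ?mulr1//; lra.
Qed.

End ConeExponentials.

(** * The Laplace transform through real pairings *)

Section Laplace.
Context (R : realType) (n : nat) (E : completeNormedModType R[i]).
Variables (h : {linear schwartz R n -> E}) (Gamma : set 'rV[R]_n).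
Hypothesis h_continuous : continuous h.
Hypothesis h_supported : supported_by Gamma h.
Variables (omega : 'rV[R]_n) (delta : R).
Hypothesis delta_gt0 : 0 < delta.
Local Notation e_ j := (delta_mx 0 j : 'rV[R]_n).
Hypothesis delta_conj : forall j, conj_cone Gamma (omega + delta *: e_ j) /\
  conj_cone Gamma (omega - delta *: e_ j).

Definition cone_nbhd : set 'rV[R]_n := [set u | forall j,
   - 1 / 2 < dotr (omega + delta *: e_ j) u /\ - 1 / 2 < dotr (omega - delta *: e_ j) u].

Lemma open_cone_nbhd : open cone_nbhd.
Proof.
have H (l : seq 'I_n) : open [set u : 'rV[R]_n | forall j, j \in l ->
    - 1 / 2 < dotr (omega + delta *: e_ j) u /\ - 1 / 2 < dotr (omega - delta *: e_ j) u].
  elim: l => [|i l IH].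
    rewrite [X in open X](_ : _ = setT); first exact: openT.
    by apply/seteqP; split=> // u _ j; rewrite in_nil.
  rewrite [X in open X](_ : _ = ([set u | - 1 / 2 < dotr (omega + delta *: e_ i) u] `&`
      [set u | - 1 / 2 < dotr (omega - delta *: e_ i) u]) `&`
      [set u : 'rV[R]_n | forall j, j \in l -> - 1 / 2 < dotr (omega + delta *: e_ j) u /\
        - 1 / 2 < dotr (omega - delta *: e_ j) u]).
    by apply: openI => //; apply: openI; exact: open_dotr_gt.
  apply/seteqP; split=> [u Hu|u [Hu1 Hu2] j].
    by split; [apply: Hu; rewrite inE eqxx|move=> j jl; apply: Hu; rewrite inE jl orbT].
  by rewrite inE => /orP[/eqP ->|/Hu2].
rewrite [X in open X](_ : _ = [set u : 'rV[R]_n | forall j, j \in enum 'I_n ->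
    - 1 / 2 < dotr (omega + delta *: e_ j) u /\ - 1 / 2 < dotr (omega - delta *: e_ j) u]) //.
by apply/seteqP; split=> u Hu j => [_|]; apply: Hu; rewrite mem_enum.
Qed.

Lemma cone_nbhd_sub : Gamma `<=` cone_nbhd.
Proof.
move=> u Gu j; have [h1 h2] := delta_conj j; have := h1 u Gu; have := h2 u Gu.
by move=> h3 h4; split; lra.
Qed.

Definition ztube (x : 'rV[R]_n) (t : R) : 'rV[R[i]]_n :=
  cvec x + ('i%C * t%:C) *: cvec omega.

Lemma cexp_ztube x t u : cexp ('i%C * dotr (ztube x t) (cvec u)) =
  ecos omega x t 0 u +i* ecos omega x t (- (pi / 2)) u.
Proof.
have -> : 'i%C * dotr (ztube x t) (cvec u) = (- (t * dotr omega u)) +i* dotr x u.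
  rewrite /dotr /ztube mulr_sumr.
  have -> : (- (t * (\sum_(j < n) omega 0 j * u 0 j))) +i* (\sum_(j < n) x 0 j * u 0 j)
      = \sum_(j < n) ((- (t * (omega 0 j * u 0 j))) +i* (x 0 j * u 0 j)).
    rewrite mulr_sumr -sumrN.
    elim: (index_enum _) => [|j r IH]; first by rewrite !big_nil.
    by rewrite !big_cons -IH; apply/eqP; rewrite eq_complex/= !eqxx.
  apply: eq_bigr => j _; rewrite !mxE; apply/eqP; rewrite eq_complex/=.
  by apply/andP; split; apply/eqP; ring.
rewrite /cexp /ecos /= addr0 cosBpihalf.
by rewrite dotrNl dotrZl.
Qed.

Definition cexp_test x t : 'rV[R]_n -> R[i]^o := fun u =>
  cone_ecos omega delta x t 0 u +i* cone_ecos omega delta x t (- (pi / 2)) u.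

Lemma is_schwartz_pair (f g : 'rV[R]_n -> R) : rschw f -> rschw g ->
  is_schwartz (fun u => (f u +i* g u : R[i]^o)).
Proof.
move=> sf sg; have F := is_schwartz_toC sf; have G := is_schwartz_toC sg.
pose F' := Schwartz (mem_set F); pose G' := Schwartz (mem_set G).
have -> : (fun u => (f u +i* g u : R[i]^o)) = ('i%C *: G' + F' : schwartz R n) :> (_ -> _).
  apply/funext => u; rewrite /= /toC; apply/eqP; rewrite eq_complex.
  by rewrite /GRing.add/= /GRing.scale/=; apply/andP; split; apply/eqP; ring.
exact: schwartzP.
Qed.

(** [laplace] pairs h with an unspecified Schwartz extension of the exponential. The cut-off
    exponential is one such extension, and two extensions agree on an open neighbourhood of Gamma,
    so [h_local0] identifies their pairings. *)
Lemma laplaceE x t : 0 < t <= 1 -> laplace Gamma h (ztube x t) =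
  hr h (cone_ecos omega delta x t 0) +
  'i%C *: hr h (cone_ecos omega delta x t (- (pi / 2))).
Proof.
move=> t01.
have s1 := rschw_cone_ecos omega delta_gt0 x 0 t01.
have s2 := rschw_cone_ecos omega delta_gt0 x (- (pi / 2)) t01.
have S := is_schwartz_pair s1 s2.
pose phi0 := Schwartz (mem_set S).
have E0 : h phi0 = hr h (cone_ecos omega delta x t 0) +
    'i%C *: hr h (cone_ecos omega delta x t (- (pi / 2))) by rewrite h_split.
rewrite -E0 /laplace; set P := [set phi | _].
have Pphi0 : P phi0.
  exists cone_nbhd; split; [exact: open_cone_nbhd|exact: cone_nbhd_sub|].
  move=> u Uu; rewrite cexp_ztube /phi0 /= /cone_ecos.
  by rewrite cone_cut1// !mul1r.
have [U [oU GU HU]] := xgetPex 0 (ex_intro _ _ Pphi0).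
apply/eqP; rewrite -subr_eq0 -linearB; apply/eqP.
have [U' [oU' GU' HU']] := Pphi0.
apply: (h_local0 h_continuous h_supported (openI oU oU')).
  by move=> u Gu; split; [exact: GU|exact: GU'].
have HU2 : forall u, U u -> xget 0 P u = cexp ('i%C * dotr (ztube x t) (cvec u)) := HU.
move=> u [Uu U'u].
have -> : (xget 0 P - phi0) u = xget 0 P u - phi0 u by [].
by rewrite HU2// HU'// subrr.
Qed.

(** The a priori bound, from continuity of h alone. It makes the suprema in [quasi_to_laplace]
    finite and treats the large dilations in [tube_bound_of_boundary]. *)
Lemma laplace_bound : exists N (C : R), 0 <= C /\ forall x t, 0 < t <= 1 ->
  rnorm (laplace Gamma h (ztube x t)) <= C * ((1 + enorm x) / t) ^+ N.
Proof.
have [N [C [C0 H]]] := hr_bound h_continuous.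
have [D [D0 HD]] := wsup_cone_ecos omega delta_gt0 N.
exists N, (2 * (C * D)); split; first by rewrite !mulr_ge0.
move=> x t t01; rewrite laplaceE// (le_trans (ler_rnormD _ _))// rnorm_i.
have S c := H _ _ (rschw_cone_ecos omega delta_gt0 x c t01) (HD x t c t01).
by rewrite -mulrA mulr_natl mulr2n -mulrA lerD// S.
Qed.

Lemma cone_ecosN x t c u :
  cone_ecos omega delta (- x) t c u = cone_ecos omega delta x t (- c) u.
Proof.
by rewrite /cone_ecos /ecos dotrNl -[in LHS](opprK c) -opprD cosN.
Qed.

(** E carries no conjugation, so the two pairings a and b cannot be read off the single value a +
    ib. Replacing x by -x fixes the cosine and negates the sine, which gives a - ib as well. *)
Lemma hr_cone_ecos_le (x : 'rV[R]_n) (t : R) c : 0 < t <= 1 -> c = 0 \/ c = - (pi / 2) ->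
  rnorm (hr h (cone_ecos omega delta x t c)) <=
  rnorm (laplace Gamma h (ztube x t)) + rnorm (laplace Gamma h (ztube (- x) t)).
Proof.
move=> t01 Hc.
have E1 := laplaceE x t01; have E2 := laplaceE (- x) t01.
have Ec : hr h (cone_ecos omega delta (- x) t 0) = hr h (cone_ecos omega delta x t 0).
  by congr (hr h _); apply/funext => u; rewrite cone_ecosN oppr0.
have Es : hr h (cone_ecos omega delta (- x) t (- (pi / 2))) =
    - hr h (cone_ecos omega delta x t (- (pi / 2))).
  have := hrZ h (-1) (rschw_cone_ecos omega delta_gt0 x (- (pi / 2)) t01).
  rewrite rmorphN1 scaleN1r => <-.
  congr (hr h _); apply/funext => u; rewrite cone_ecosN opprK /cone_ecos /ecos.
  by rewrite cosDpihalf cosBpihalf; ring.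
rewrite Ec Es in E2.
set a := hr h _ in E1 E2; set b := hr h _ in E1 E2.
rewrite E1 E2 scalerN.
have two (v : E) : rnorm (v + v) = 2 * rnorm v.
  by rewrite -mulr2n -scaler_nat (_ : 2%:R = (2%:R : R)%:C) ?rnormZr ?ger0_norm// rmorph_nat.
case: Hc => ->.
  have -> : hr h (cone_ecos omega delta x t 0) = a by [].
  apply: (@le_trans _ _ (2 * rnorm a)); first by rewrite ler_peMl ?rnorm_ge0// ler1n.
  rewrite -two (_ : a + a = (a + 'i%C *: b) + (a - 'i%C *: b)) ?ler_rnormD//.
  by rewrite addrACA subrr addr0.
have -> : hr h (cone_ecos omega delta x t (- (pi / 2))) = b by [].
apply: (@le_trans _ _ (2 * rnorm b)); first by rewrite ler_peMl ?rnorm_ge0// ler1n.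
rewrite -(rnorm_i b) -two.
rewrite (_ : _ + _ = (a + 'i%C *: b) - (a - 'i%C *: b)) ?ler_rnormB//.
by rewrite opprB [RHS]addrC addrA subrK.
Qed.

End Laplace.

Lemma open_conj_cone_delta (R : realType) (n : nat) (Gamma : set 'rV[R]_n) omega :
  open_conj_cone Gamma omega -> exists delta : R, 0 < delta /\
    forall j, conj_cone Gamma (omega + delta *: delta_mx 0 j) /\
      conj_cone Gamma (omega - delta *: delta_mx 0 j).
Proof.
rewrite /open_conj_cone /interior => /nbhs_ballP[e /= e0 H].
exists (e / 2); split; first by rewrite divr_gt0.
have B (c : R) j : `|c| < e -> conj_cone Gamma (omega + c *: delta_mx 0 j).
  move=> ce; apply: H; split=> // i k; rewrite /ball/= !mxE opprD addNKr normrN normrM.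
  rewrite (le_lt_trans _ ce)// ler_piMr//.
  by case: (_ && _); rewrite ?normr1// normr0.
have e2 : `|e / 2| < e by rewrite gtr0_norm ?divr_gt0// ltr_pdivrMr// ltr_pMr// ltr1n.
by move=> j; split; [exact: B|rewrite -scaleNr; apply: B; rewrite normrN].
Qed.

(** * Completeness of the Schwartz space *)

Section Completeness.
Context (R : realType) (n : nat).
Implicit Types (f g : 'rV[R]_n -> R) (x u v : 'rV[R]_n) (s : seq 'I_n).

Local Notation e_ j := (delta_mx 0 j : 'rV[R]_n).

Lemma inbox_lipschitz f (B e : R) u v : smooth f -> 0 <= B ->
  (forall j x, `|'D_(e_ j) f x| <= B) -> inbox e (u - v) ->
  `|f u - f v| <= n%:R * (B * e).
Proof.
move=> sf B0 HB uv.
(* Passes from v to u by changing one coordinate at a time. *)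
pose w (k : nat) : 'rV[R]_n := \row_j (if (j < k)%N then u 0 j else v 0 j).
have H (k : nat) : (k <= n)%N -> `|f (w k) - f v| <= k%:R * (B * e).
  elim: k => [|k IH] kn.
    have -> : w 0%N = v by apply/rowP => j; rewrite mxE.
    by rewrite subrr normr0 mul0r.
  pose j := Ordinal kn.
  have -> : w k.+1 = (u - v) 0 j *: e_ j + w k.
    apply/rowP => i; rewrite !mxE eqxx/= ltnS leq_eqVlt.
    have [->|ij] := eqVneq i j; first by rewrite eqxx/= ltnn mulr1 subrK.
    have -> : (nat_of_ord i == k) = false by apply: contra_neqF ij => /eqP ik; exact: val_inj.
    by rewrite /= mulr0 add0r.
  have -> : f ((u - v) 0 j *: e_ j + w k) - f v =
     (f ((u - v) 0 j *: e_ j + w k) - f (w k)) + (f (w k) - f v).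
    by rewrite addrA subrK.
  apply: (le_trans (ler_normD _ _)).
  rewrite -[k.+1]addn1 natrD mulrDl mul1r addrC.
  apply: lerD; first exact/IH/ltnW.
  have d y : derivable f y (e_ j) := smooth_derivable sf.
  apply: (le_trans (line_MVT d B0 (fun r _ => HB j _))).
  by rewrite ler_wpM2l// uv.
have -> : u = w n by apply/rowP => j; rewrite mxE ltn_ord.
exact: H.
Qed.

Lemma lipschitz_continuous f (B : R) : 0 <= B ->
  (forall u v (e : R), inbox e (u - v) -> `|f u - f v| <= B * e) -> continuous f.
Proof.
move=> B0 H x A /nbhs_ballP[e /= e0 eA]; apply/nbhs_ballP.
have p : 0 < e / (B + 1) by rewrite divr_gt0// ltr_wpDl.
exists (e / (B + 1)) => //= y [_ Hy]; apply: eA; rewrite /ball/=.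
apply: (@le_lt_trans _ _ (B * (e / (B + 1)))).
  by apply: H => j; rewrite !mxE; apply/ltW; exact: Hy.
by rewrite mulrA ltr_pdivrMr ?ltr_wpDl// mulrC ltr_pM2l// ltrDl.
Qed.

Lemma exists_pow2_le (K e : R) : 0 <= K -> 0 < e -> exists i, K / 2 ^+ i <= e.
Proof.
move=> K0 e0; exists (Num.bound (K / e)).
have q0 : 0 <= K / e := divr_ge0 K0 (ltW e0).
rewrite ler_pdivrMr ?exprn_gt0// [leRHS]mulrC -ler_pdivrMr//.
rewrite (le_trans (ltW (archi_boundP q0)))//.
by rewrite -natrX ler_nat ltnW// ltn_expl.
Qed.

(** With d i = 2C / 2^i, the sum of the increments from i on, the intervals [a i - d i, a i + d i]
    are nested; the limit is the supremum of their left ends. *)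
Lemma geometric_limit (a : nat -> R) (C : R) :
  (forall i, `|a i.+1 - a i| <= C / 2 ^+ i) ->
  exists l, forall i, `|l - a i| <= 2 * C / 2 ^+ i.
Proof.
move=> H.
have C0 : 0 <= C by have := le_trans (normr_ge0 _) (H 0%N); rewrite expr0 divr1.
have p2 i : 0 < 2 ^+ i :> R by rewrite exprn_gt0.
pose d i := 2 * C / 2 ^+ i.
have dS i : d i - d i.+1 = C / 2 ^+ i.
  by rewrite /d exprS; field; rewrite gt_eqF.
have d0 i : 0 <= d i by rewrite /d divr_ge0 ?mulr_ge0 ?(ltW (p2 _)).
have incr i k : a i - d i <= a (k + i)%N - d (k + i)%N.
  elim: k => [//|k /le_trans]; apply; rewrite addSn.
  have := H (k + i)%N; rewrite -dS ler_norml => /andP[]; lra.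
have decr i k : a (k + i)%N + d (k + i)%N <= a i + d i.
  elim: k => [//|k]; apply: le_trans; rewrite addSn.
  have := H (k + i)%N; rewrite -dS ler_norml => /andP[]; lra.
have ub i k : a k - d k <= a i + d i.
  have := incr k i; have := decr i k; rewrite addnC; have := d0 (i + k)%N; lra.
pose A := range (fun i => a i - d i).
have A1 : has_sup A.
  split; first by exists (a 0%N - d 0%N), 0%N.
  by exists (a 0%N + d 0%N) => _ [k _ <-]; exact: ub.
exists (sup A) => i; rewrite -/(d i).
have h1 : a i - d i <= sup A by apply: ub_le_sup; [case: A1|exists i].
have h2 : sup A <= a i + d i by apply: ge_sup; [case: A1|move=> _ [k _ <-]; exact: ub].
rewrite ler_norml; apply/andP; split; lra.
Qed.

(** By uniqueness of limits, a limit obtained with one constant also converges at the rate given by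
    any other bound on the increments. This lets one pointwise limit serve for all weights at
    once. *)
Lemma geometric_rate (a : nat -> R) (l C D : R) :
  (forall i, `|a i.+1 - a i| <= D / 2 ^+ i) ->
  (forall i, `|l - a i| <= C / 2 ^+ i) -> forall i, `|l - a i| <= 2 * D / 2 ^+ i.
Proof.
move=> HD HC i; have [l' Hl'] := geometric_limit HD.
suff -> : l = l' by [].
apply/eqP; rewrite -subr_eq0 -normr_le0; apply/ler_addgt0Pl => e e0; rewrite addr0.
have K0 : 0 <= C + 2 * D.
  have := le_trans (normr_ge0 _) (HC 0%N); have := le_trans (normr_ge0 _) (Hl' 0%N).
  by rewrite expr0 !divr1; lra.
have [k Hk] := exists_pow2_le K0 e0.
have -> : l - l' = (l - a k) - (l' - a k) by rewrite opprB addrA subrK.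
apply: (le_trans (ler_normB _ _)); apply: (le_trans (lerD (HC k) (Hl' k))).
by rewrite -mulrDl.
Qed.

(** All partial derivatives are given pointwise limits [P s]. Second derivatives are bounded
    uniformly in m, so the Taylor estimate relating orders s and j :: s passes to the limit and
    shows that [P (j :: s)] is the derivative of [P s]; continuity follows from uniform Lipschitz
    bounds. *)
Lemma rschw_complete (S : nat -> 'rV[R]_n -> R) : (forall m, rschw (S m)) ->
  (forall N, exists C, forall m, wsup N (fun x => S m.+1 x - S m x) (C / 2 ^+ m)) ->
  exists F, rschw F /\
    forall N, exists C, forall m, wsup N (fun x => F x - S m x) (C / 2 ^+ m).
Proof.
move=> rS HS; have sS m : smooth (S m) by have [] := rS m.
have pB (f g : 'rV[R]_n -> R) s x : smooth f -> smooth g ->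
    partials s (fun x => f x - g x) x = partials s f x - partials s g x.
  move=> sf sg; under eq_fun do rewrite -mulN1r.
  rewrite (partialsD s sf (smoothZ (-1) sg)) (partialsZ s (-1) sg).
  by rewrite mulN1r.
have [C HC] := choice HS.
have rate N s x : (size s <= N)%N -> forall i,
    `|partials s (S i.+1) x - partials s (S i) x| <= C N / (1 + enorm x) ^+ N / 2 ^+ i.
  move=> sN i; rewrite -pB//.
  by rewrite mulrAC (wsup_pt x (HC N i) sN).
(* The limit must not depend on the norm N, so it is selected with the weight of order |s|;
   [geometric_rate] then upgrades it to every N. *)
pose Q s x := [set l | forall i,
   `|l - partials s (S i) x| <= 2 * (C (size s) / (1 + enorm x) ^+ size s) / 2 ^+ i].
pose P s x : R := xget 0 (Q s x).
have HP0 s x i : `|P s x - partials s (S i) x| <=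
    2 * (C (size s) / (1 + enorm x) ^+ size s) / 2 ^+ i.
  have [l Hl] := geometric_limit (rate _ s x (leqnn _)).
  have H : Q s x (P s x) by apply: xgetPex; exists l.
  exact: H.
have HP N s x : (size s <= N)%N -> forall i, `|P s x - partials s (S i) x| <=
    2 * (C N / (1 + enorm x) ^+ N) / 2 ^+ i.
  by move=> sN; exact: (geometric_rate (rate N s x sN) (HP0 s x)).
have C0 N : 0 <= C N by have := wsup_ge0 (HC N 0%N); rewrite expr0 divr1.
have HPu s x i : `|P s x - partials s (S i) x| <= 2 * C (size s) / 2 ^+ i.
  apply: (le_trans (HP0 s x i)); rewrite ler_wpM2r ?invr_ge0 ?exprn_ge0// ler_wpM2l//.
  by rewrite ler_pdivrMr ?exprn_gt0 ?gt0_enorm// ler_peMr// exprn_ege1// ge1_enorm.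
have bd s : exists B : R, 0 <= B /\ forall m x, `|partials s (S m) x| <= B.
  have [_ /(_ (size s)) [B0 HB0]] := rS 0%N.
  have B00 := wsup_ge0 HB0.
  exists (B0 + 4 * C (size s)); split; first by rewrite addr_ge0// mulr_ge0.
  move=> m x.
  have h0 : `|partials s (S 0%N) x| <= B0.
    rewrite (le_trans _ (HB0 s x (leqnn _)))// ler_peMl// exprn_ege1// ge1_enorm.
  have h1 := HPu s x 0%N; have h2 := HPu s x m; rewrite expr0 divr1 in h1.
  have h3 : 2 * C (size s) / 2 ^+ m <= 2 * C (size s).
    by rewrite ler_pdivrMr ?exprn_gt0// ler_peMr ?mulr_ge0// exprn_ege1// ler1n.
  have -> : partials s (S m) x = partials s (S 0%N) x +
    (P s x - partials s (S 0%N) x) - (P s x - partials s (S m) x) by ring.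
  apply: (le_trans (ler_normB _ _)); apply: (le_trans (lerD (ler_normD _ _) (lexx _))).
  move: h0 h1 h2 h3; set p1 := `|_|; set p2 := `|_|; set p3 := `|_|; set q := _ / _; lra.
have small (s : seq 'I_n) (e : R) : 0 < e -> exists i, forall x, `|P s x - partials s (S i) x| <= e.
  move=> e0; have K0 : 0 <= 2 * C (size s) by rewrite mulr_ge0.
  have [i Hi] := exists_pow2_le K0 e0.
  by exists i => x; exact: (le_trans (HPu s x i)).
have dP s j x : is_derive x (e_ j) (P s) (P (j :: s) x).
  have [B [B0 HB]] := bd [:: j, j & s].
  apply: (@is_derive_quadratic _ _ _ _ _ _ B) => t.
  apply/ler_addgt0Pr => e e0.
  have e1 : 0 < e / (2 + `|t|) by rewrite divr_gt0// ltr_wpDr.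
  have [i [h1 h2]] : exists i, (forall y, `|P s y - partials s (S i) y| <= e / (2 + `|t|)) /\
      (forall y, `|P (j :: s) y - partials (j :: s) (S i) y| <= e / (2 + `|t|)).
    pose K := 2 * C (size s) + 2 * C (size s).+1.
    have K0 : 0 <= K by rewrite addr_ge0 ?mulr_ge0.
    have [i Hi] := exists_pow2_le K0 e1; exists i.
    split=> y; (apply: le_trans Hi); apply: (le_trans (HPu _ _ _));
      rewrite ler_wpM2r ?invr_ge0 ?exprn_ge0// /K ?lerDl ?lerDr mulr_ge0//.
  have T := line_taylor x t (fun y => smooth_derivable (smooth_partials s (sS i)))
    (fun y => smooth_derivable (smooth_derive j (smooth_partials s (sS i)))) B0
    (fun y => HB i y).
  have -> : P s (t *: e_ j + x) - P s x - t * P (j :: s) x =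
    (partials s (S i) (t *: e_ j + x) - partials s (S i) x
       - t * 'D_(e_ j) (partials s (S i)) x)
    + ((P s (t *: e_ j + x) - partials s (S i) (t *: e_ j + x))
    - (P s x - partials s (S i) x)
    - t * (P (j :: s) x - partials (j :: s) (S i) x)) by rewrite /=; ring.
  apply: (le_trans (ler_normD _ _)); apply: lerD => //.
  apply: (le_trans (ler_normB _ _)); rewrite normrM.
  apply: (le_trans (lerD (ler_normB _ _) (lexx _))).
  apply: (@le_trans _ _ (e / (2 + `|t|) + e / (2 + `|t|) + `|t| * (e / (2 + `|t|)))).
    by rewrite !lerD ?ler_wpM2l.
  by rewrite -{1 2}[e / _]mul1r -!mulrDl mulrC divfK// gt_eqF// ltr_wpDr.
have PE s : partials s (P [::]) = P s.
  elim: s => [//|j s IH] /=; rewrite IH; apply/funext => x.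
  by have [_ ->] := dP s j x.
have cP s : continuous (P s).
  have HB j := bd (j :: s); have [B' HB'] := choice HB.
  pose B := \sum_j B' j.
  have B'0 j : 0 <= B' j by have [] := HB' j.
  have B0 : 0 <= B by rewrite sumr_ge0.
  apply: (@lipschitz_continuous _ (n%:R * B)); first by rewrite mulr_ge0.
  move=> u v e uv; apply/ler_addgt0Pr => d d0.
  have [i Hi] := small s (d / 2) (divr_gt0 d0 (ltr0Sn R 1)).
  have -> : P s u - P s v = (partials s (S i) u - partials s (S i) v) +
    ((P s u - partials s (S i) u) - (P s v - partials s (S i) v)) by ring.
  apply: (le_trans (ler_normD _ _)); apply: lerD.
    rewrite -mulrA; apply: inbox_lipschitz => //; first exact: smooth_partials.
    move=> j x; have [_ h] := HB' j; apply: (le_trans (h i x)).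
    by rewrite /B (bigD1 j)//= lerDl sumr_ge0.
  by rewrite (le_trans (ler_normB _ _))// [leRHS]splitr lerD.
have sP : smooth (P [::]).
  move=> s; rewrite PE; split; first exact: cP.
  by move=> j x; have [] := dP s j x.
have W N m : wsup N (fun x => P [::] x - S m x) (2 * C N / 2 ^+ m).
  move=> s x sN; rewrite pB// PE mulrC -ler_pdivlMr ?exprn_gt0 ?gt0_enorm//.
  apply: (le_trans (HP N s x sN m)); apply: eq_lerW.
  ring.
exists (P [::]); split; last by move=> N; exists (2 * C N).
split=> // N; have [_ /(_ N)[A HA]] := rS 0%N.
exists (A + 2 * C N / 2 ^+ 0); have -> : P [::] = fun x => S 0%N x + (P [::] x - S 0%N x).
  by apply/funext => x; rewrite addrCA subrr addr0.
have sd : smooth (fun x => P [::] x - S 0%N x).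
  have -> : (fun x => P [::] x - S 0%N x) = fun x => P [::] x + (-1) * S 0%N x.
    by apply/funext => x; rewrite mulN1r.
  exact: (smoothD sP (smoothZ (-1) (sS 0%N))).
exact: (wsupD (sS 0%N) sd HA (W N 0%N)).
Qed.

End Completeness.

(** * Limits superior and unbounded seminorms *)

Section LimsupBounds.
Context (R : realType).

Lemma limf_esup_lt_pinfty (F : set_system R) (f : R -> \bar R) :
  (limf_esup f F < +oo)%E <->
  exists A (M : R), F A /\ forall x, A x -> (f x <= M%:E)%E.
Proof.
rewrite /limf_esup; split.
  move=> /ereal_inf_lt[_ [A FA <-] H].
  have ub x : A x -> (f x <= ereal_sup (f @` A))%E.
    by move=> Ax; apply: ereal_sup_ubound; exists x.
  case E : (ereal_sup (f @` A)) => [r| |].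
  - by exists A, r; split=> // x Ax; rewrite -E ub.
  - by move: H; rewrite E.
  - by exists A, 0; split=> // x Ax; rewrite (le_trans (ub x Ax))// E leNye.
move=> [A [M [FA H]]]; apply: (@le_lt_trans _ _ M%:E); last by rewrite ltry.
apply: (@le_trans _ _ (ereal_sup (f @` A))).
  by apply: ereal_inf_lbound; exists A.
by apply: ge_ereal_sup => _ [x Ax <-]; exact: H.
Qed.

Lemma limsup_pinfty_bounded (f : R -> R) :
  (limf_esup (fun t => (f t)%:E) (pinfty_nbhs R) < +oo)%E <->
  exists A B : R, forall t, A < t -> f t <= B.
Proof.
rewrite limf_esup_lt_pinfty; split.
  move=> [S [B [[A [_ HA]] H]]]; exists A, B => t At.
  by rewrite -lee_fin; exact/H/HA.
move=> [A [B H]]; exists [set t | A < t], B; split.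
  by exists A; split=> //; exact: num_real.
by move=> t At; rewrite lee_fin; exact: H.
Qed.

Lemma limsup_right_bounded (I : Type) (D : set I) (g : R -> I -> R) :
  (limf_esup (fun t => ereal_sup [set (g t p)%:E | p in D]) 0^'+ < +oo)%E <->
  exists d B : R, 0 < d /\ forall t p, 0 < t < d -> D p -> g t p <= B.
Proof.
rewrite limf_esup_lt_pinfty; split.
  move=> [S [B [[d /= d0 Hd] H]]]; exists d, B; split=> // t p /andP[t0 td] Dp.
  have St : S t by apply: Hd => //=; rewrite sub0r normrN gtr0_norm.
  rewrite -lee_fin; apply: le_trans (H t St).
  by apply: ereal_sup_ubound; exists p.
move=> [d [B [d0 H]]]; exists [set t | 0 < t < d], B; split.
  exists d => //= t; rewrite /= sub0r normrN => td t0.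
  by rewrite t0/= -(gtr0_norm t0).
move=> t td; apply: ge_ereal_sup => _ [p Dp <-].
by rewrite lee_fin; exact: H.
Qed.

End LimsupBounds.

(** * A uniform boundedness principle on the Schwartz space *)

Section UniformBoundedness.
Context (R : realType) (n : nat).
Local Notation S := (schwartz R n).

Definition cwsup N (phi : 'rV[R]_n -> R[i]^o) (B : R) :=
  wsup N (@complex.Re R \o phi) B /\ wsup N (@complex.Im R \o phi) B.

Lemma cwsupZ N (c : R) (phi : S) B : cwsup N phi B ->
  cwsup N (c%:C *: phi : S) (`|c| * B).
Proof.
move=> [H1 H2]; split.
  have -> : @complex.Re R \o (c%:C *: phi : S) = fun x => c * (@complex.Re R \o phi) x.
    by apply/funext => x; rewrite /= /GRing.scale/=; case: (phi x) => a b /=; rewrite mul0r subr0.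
  by apply: wsupZ => //; have [] := rschw_Re phi.
have -> : @complex.Im R \o (c%:C *: phi : S) = fun x => c * (@complex.Im R \o phi) x.
  by apply/funext => x; rewrite /= /GRing.scale/=; case: (phi x) => a b /=; rewrite mul0r addr0.
by apply: wsupZ => //; have [] := rschw_Im phi.
Qed.

Lemma cwsup_le N (phi : 'rV[R]_n -> R[i]^o) B B' : B <= B' ->
  cwsup N phi B -> cwsup N phi B'.
Proof. by move=> BB [h1 h2]; split; exact: wsup_le BB _. Qed.

Lemma schwartz_cwsup N (phi : S) : exists B, cwsup N phi B.
Proof.
have [_ /(_ N)[A HA]] := rschw_Re phi; have [_ /(_ N)[B HB]] := rschw_Im phi.
exists (Num.max A B); split; [apply: wsup_le HA|apply: wsup_le HB];
  by rewrite le_max lexx ?orbT.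
Qed.

Lemma schwartz_complete (u : nat -> S) :
  (forall N, exists C : R, forall m, cwsup N (u m.+1 - u m : S) (C / 2 ^+ m)) ->
  exists f : S, forall N, exists C : R, forall m, cwsup N (f - u m : S) (C / 2 ^+ m).
Proof.
move=> H.
have ReB (f g : S) : @complex.Re R \o (f - g : S) =
    fun x => (@complex.Re R \o f) x - (@complex.Re R \o g) x.
  apply/funext => x; have E : (f - g : S) x = f x - g x by [].
  by rewrite /comp E; case: (f x) (g x) => [a b] [c d].
have ImB (f g : S) : @complex.Im R \o (f - g : S) =
    fun x => (@complex.Im R \o f) x - (@complex.Im R \o g) x.
  apply/funext => x; have E : (f - g : S) x = f x - g x by [].
  by rewrite /comp E; case: (f x) (g x) => [a b] [c d].
have [F [sF HF]] : exists F, rschw F /\ forall N, exists C : R, forall m,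
    wsup N (fun x => F x - (@complex.Re R \o u m) x) (C / 2 ^+ m).
  apply: (rschw_complete (S := fun m => @complex.Re R \o u m)).
    by move=> m; exact: rschw_Re.
  by move=> N; have [C HC] := H N; exists C => m; have [] := HC m; rewrite ReB.
have [G [sG HG]] : exists F, rschw F /\ forall N, exists C : R, forall m,
    wsup N (fun x => F x - (@complex.Im R \o u m) x) (C / 2 ^+ m).
  apply: (rschw_complete (S := fun m => @complex.Im R \o u m)).
    by move=> m; exact: rschw_Im.
  by move=> N; have [C HC] := H N; exists C => m; have [] := HC m; rewrite ImB.
pose f := Schwartz (mem_set (is_schwartz_pair sF sG)).
exists f => N; have [A HA] := HF N; have [B HB] := HG N.
exists (Num.max A B) => m; rewrite /cwsup ReB ImB; split.
  by apply: wsup_le (HA m); rewrite ler_wpM2r ?invr_ge0 ?exprn_ge0// le_max lexx.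
by apply: wsup_le (HB m); rewrite ler_wpM2r ?invr_ge0 ?exprn_ge0// le_max lexx orbT.
Qed.

(* The gliding hump is replaced by a choice of signs: each [phi k] is nearly
   maximal for [q k] among the later terms, which controls the tail of
   [\sum_k +- 3^-k phi k] without any constraint linking the choices. *)
Lemma unbounded_seminorms (q : nat -> S -> R) (phi : nat -> S) :
  (forall k f g, q k (f + g) <= q k f + q k g) ->
  (forall k (c : R) f, q k (c%:C *: f) = `|c| * q k f) ->
  (forall k, exists N (C : R), 0 <= C /\ forall (f : S) B, cwsup N f B -> q k f <= C * B) ->
  (forall N, exists C : R, forall k, (N <= k)%N -> cwsup N (phi k) C) ->
  (forall k i, (k <= i)%N -> q k (phi i) <= 4 / 3 * q k (phi k)) ->
  (forall k, k%:R * 3 ^+ k <= q k (phi k)) ->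
  exists f, forall k, k%:R / 3 <= q k f.
Proof.
move=> qD qZ qC phiC phimax phibig.
have qN k f : q k (- f) = q k f.
  by have := qZ k (-1) f; rewrite rmorphN1 scaleN1r normrN1 mul1r.
have qB k f g : q k (f - g) <= q k f + q k g by rewrite (le_trans (qD _ _ _))// qN.
have q_ge0 k f : 0 <= q k f.
  have := qB k f f; rewrite subrr; have := qZ k 0 f; rewrite rmorph0 scale0r normr0 mul0r => ->.
  by rewrite -mulr2n pmulrn_lge0.
pose d k : S := (3 ^- k)%:C *: phi k.
pose T := fix T k : S := if k is k.+1 then
  (if q k (d k) <= q k (T k + d k) then T k + d k else T k - d k) else 0.
have TS k : T k.+1 = T k + d k \/ T k.+1 = T k - d k.
  by rewrite /=; case: ifP => _; [left|right].
(* The two candidates T + d and T - d differ by 2d, so at least one of them has a seminorm not below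
   that of d. *)
have Tq k : q k (d k) <= q k (T k.+1).
  rewrite /=; case: ifPn => //; rewrite -ltNge => h.
  have := qB k (T k + d k) (T k - d k).
  have -> : T k + d k - (T k - d k) = 2%:C *: d k.
    by rewrite opprB [LHS]addrC addrA subrK -mulr2n -scaler_nat rmorph_nat.
  by rewrite qZ ger0_norm//; move: h; set a := q _ _; set b := q _ _; lra.
have i3 k : 0 <= 3 ^- k :> R by rewrite invr_ge0 exprn_ge0.
have qd k i : q k (d i) = 3 ^- i * q k (phi i) by rewrite qZ ger0_norm.
have Tstep k i : q k (T i.+1 - T i) = q k (d i).
  by case: (TS i) => ->; rewrite [T i + _]addrC addrK ?qN.
have [f Hf] : exists f : S, forall N, exists C : R, forall m, cwsup N (f - T m : S) (C / 2 ^+ m).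
  apply: schwartz_complete => N.
  have [C HC] := phiC N.
  have [c Hc] := choice (fun k => schwartz_cwsup N (phi k)).
  pose D := `|C| + \sum_(i < N) `|c i|.
  have D0 : 0 <= D by rewrite addr_ge0// sumr_ge0.
  have HD k : cwsup N (phi k) D.
    have [kN|kN] := leqP N k.
      by apply: cwsup_le (HC k kN); rewrite (le_trans (ler_norm _))// lerDl sumr_ge0.
    apply: cwsup_le (Hc k); rewrite (le_trans (ler_norm _))//.
    rewrite /D (bigD1 (Ordinal kN))//= addrCA lerDl addr_ge0// sumr_ge0//.
  exists D => m.
  have le32 : 3 ^- m * D <= D / 2 ^+ m.
    rewrite mulrC ler_wpM2l// lef_pV2 ?posrE ?exprn_gt0//.
    by rewrite lerXn2r ?nnegrE// ler_nat.
  have E c' : `|c'| = 1 -> cwsup N (c'%:C *: d m : S) (D / 2 ^+ m).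
    move=> c1; apply: (cwsup_le le32).
    have := cwsupZ c' (cwsupZ (3 ^- m) (HD m)).
    by rewrite c1 mul1r ger0_norm.
  have [->|->] := TS m.
    by have := E 1 (normr1 _); rewrite rmorph1 scale1r addrC addKr.
  by have := E (-1) (normrN1 _); rewrite rmorphN1 scaleN1r addrC addKr.
exists f => k.
(* The terms after k sum to at most 4/3 times 3^-k / 2, that is 2/3 of 3^-k q_k(phi_k). The k-th
   partial sum retains all of 3^-k q_k(phi_k), so a third survives, whence the bound k / 3. *)
have tail j : q k (T (k.+1 + j)%N - T k.+1) <=
    2 / 3 * q k (phi k) * 3 ^- k * (1 - 3 ^- j).
  elim: j => [|j IH].
    have := qZ k 0 0; rewrite rmorph0 scale0r normr0 mul0r addn0 subrr => ->.
    by rewrite expr0 invr1 subrr mulr0.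
  have -> : T (k.+1 + j.+1)%N - T k.+1 =
      (T (k.+1 + j).+1 - T (k.+1 + j)%N) + (T (k.+1 + j)%N - T k.+1).
    by rewrite addnS addrA subrK.
  apply: (le_trans (qD _ _ _)); rewrite Tstep qd.
  have h := phimax k (k.+1 + j)%N (leq_trans (leqnSn k) (leq_addr j k.+1)).
  apply: (le_trans (lerD (ler_wpM2l (i3 _) h) IH)).
  apply: eq_lerW.
  by rewrite addSn !exprS exprD; field; rewrite !expf_neq0// pnatr_eq0.
have [N [C [C0 HC]]] := qC k; have [D HD] := Hf N.
have D0 : 0 <= D by have [/wsup_ge0 + _] := HD 0%N; rewrite expr0 divr1.
suff S1 : 3 ^- k * q k (phi k) - 2 / 3 * q k (phi k) * 3 ^- k <= q k f.
  apply: le_trans S1; have := phibig k.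
  rewrite -(@ler_pM2r _ (3 ^- k)) ?invr_gt0 ?exprn_gt0// mulfK ?expf_neq0 ?pnatr_eq0//.
  move: (3 ^- k) => p; nra.
apply/ler_addgt0Pr => e e0.
have CD0 : 0 <= C * D by rewrite mulr_ge0.
have [j Hj] := exists_pow2_le CD0 e0.
have h1 := Tq k; rewrite qd in h1.
pose m := (k.+1 + j)%N.
have h2 : q k (T k.+1) <= q k f + q k (f - T m) + q k (T m - T k.+1).
  have E : T k.+1 = f - (f - T m) - (T m - T k.+1) by rewrite !subKr.
  by rewrite {1}E (le_trans (qB _ _ _))// lerD2r qB.
have h3 : q k (f - T m) <= e.
  apply: (le_trans (HC _ _ (HD m))); rewrite mulrA; apply: le_trans Hj.
  rewrite ler_wpM2l// lef_pV2 ?posrE ?exprn_gt0//.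
  by rewrite ler_weXn2l// ?ler1n// leq_addl.
have h4 := tail j; rewrite -/m in h4.
have h5 : 2 / 3 * q k (phi k) * 3 ^- k * (1 - 3 ^- j) <= 2 / 3 * q k (phi k) * 3 ^- k.
  rewrite ler_piMr ?mulr_ge0// ?divr_ge0//.
by have := i3 j; move: (3 ^- j) => z; lra.
Qed.

End UniformBoundedness.

(** * Necessity *)

Section Necessity.
Context (R : realType) (n : nat) (E : completeNormedModType R[i]).
Variables (h : {linear schwartz R n -> E}) (Gamma : set 'rV[R]_n).
Hypothesis h_continuous : continuous h.
Hypothesis h_supported : supported_by Gamma h.
Hypothesis Gamma_cone : is_cone Gamma.
Variables (omega : 'rV[R]_n) (delta : R).
Hypothesis delta_gt0 : 0 < delta.
Local Notation e_ j := (delta_mx 0 j : 'rV[R]_n).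
Hypothesis delta_conj : forall j, conj_cone Gamma (omega + delta *: e_ j) /\
  conj_cone Gamma (omega - delta *: e_ j).
Local Notation S := (schwartz R n).
Local Notation F x t := (laplace Gamma h (ztube omega x t)).

Lemma dilateD (mu : R) (f g : S) : mu != 0 -> dilate mu (f + g) = dilate mu f + dilate mu g.
Proof.
move=> mu0; apply/val_inj => /=.
by rewrite (dilateE (f + g)%R mu0) (dilateE f mu0) (dilateE g mu0); apply/funext => u.
Qed.

Lemma dilateZ (mu : R) (c : R[i]) (f : S) : mu != 0 ->
  dilate mu (c *: f) = c *: dilate mu f.
Proof.
move=> mu0; apply/val_inj => /=.
by rewrite (dilateE (c *: f)%R mu0) (dilateE f mu0); apply/funext => u.
Qed.

Lemma h_dilate (lam : R) (phi : S) : 0 < lam -> h (dilate lam^-1 phi) =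
  hr h (fun u => complex.Re (phi (lam *: u))) +
  'i%C *: hr h (fun u => complex.Im (phi (lam *: u))).
Proof.
move=> l0; have l1 : lam^-1 != 0 by rewrite gt_eqF// invr_gt0.
rewrite h_split; congr (hr h _ + _ *: hr h _); apply/funext => u.
  by rewrite /comp (dilateE phi l1) invrK.
by rewrite /comp (dilateE phi l1) invrK.
Qed.

(** The rescaled exponentials coincide and only the cutoffs differ; both are 1 near Gamma because
    Gamma is invariant under dilations. *)
Lemma hr_dil_cone_ecos x t c (lam : R) : 0 < lam <= 1 -> 0 < t <= 1 ->
  hr h (fun u => cone_ecos omega delta x t c (lam *: u)) =
  hr h (cone_ecos omega delta (lam *: x) (lam * t) c).
Proof.
move=> l01 t01; have /andP[l0 l1] := l01; have /andP[t0 t1] := t01.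
have lt01 : 0 < lam * t <= 1 by rewrite mulr_gt0//= mulr_ile1// ltW.
have s1 := rschw_dil l01 (rschw_cone_ecos omega delta_gt0 x c t01).
have s2 := rschw_cone_ecos omega delta_gt0 (lam *: x) c lt01.
apply/eqP; rewrite -subr_eq0 -hrB//; apply/eqP.
pose U := cone_nbhd omega delta `&` [set u | cone_nbhd omega delta (lam *: u)].
apply: (hr_local0 h_continuous h_supported (U := U)).
- have -> : (fun u => cone_ecos omega delta x t c (lam *: u) -
      cone_ecos omega delta (lam *: x) (lam * t) c u) =
      (fun u => cone_ecos omega delta x t c (lam *: u) +
      (-1) * cone_ecos omega delta (lam *: x) (lam * t) c u).
    by apply/funext => u; rewrite mulN1r.
  by apply: rschwD => //; exact: rschwZ.
- apply: openI; first exact: open_cone_nbhd.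
  apply: (@open_comp _ _ (fun u : 'rV[R]_n => lam *: u)); last exact: open_cone_nbhd.
  by move=> u _; exact: scaler_continuous.
- move=> u Gu; split; first exact: (cone_nbhd_sub delta_conj).
  by apply: (cone_nbhd_sub delta_conj); apply: Gamma_cone.2.
move=> u [Uu1 Uu2]; rewrite /cone_ecos !cone_cut1//.
by rewrite !mul1r /ecos !dotrNl !dotrZl !dotrZr mulrCA mulrA subrr.
Qed.

Definition etest x t : S := insubd 0 (cexp_test omega delta x t).

Lemma etestE x t : 0 < t <= 1 -> etest x t = cexp_test omega delta x t :> (_ -> _).
Proof.
move=> t01; rewrite /etest insubdK// inE.
by apply: is_schwartz_pair; exact: rschw_cone_ecos.
Qed.

Lemma h_dilate_etest x t (lam : R) : 0 < lam <= 1 -> 0 < t <= 1 ->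
  h (dilate lam^-1 (etest x t)) = F (lam *: x) (lam * t).
Proof.
move=> l01 t01; have /andP[l0 l1] := l01; have /andP[t0 t1] := t01.
have lt01 : 0 < lam * t <= 1 by rewrite mulr_gt0//= mulr_ile1// ltW.
rewrite h_dilate// (laplaceE h_continuous h_supported delta_gt0)//.
by rewrite -!hr_dil_cone_ecos// etestE.
Qed.

Lemma ztubeZ x t (lam : R) :
  lam%:C *: (cvec x + ('i%C * t%:C) *: cvec omega) = ztube omega (lam *: x) (lam * t).
Proof.
rewrite /ztube scalerDr scalerA; congr (_ + _ *: _).
  by apply/rowP => j; rewrite !mxE rmorphM.
by rewrite rmorphM /= mulrCA.
Qed.

Lemma powRV (x a : R) : 0 < x -> (x^-1) `^ a = (x `^ a)^-1.
Proof. by move=> x0; rewrite -powR_inv1 ?ltW// -powRrM mulN1r powRN. Qed.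

Lemma quasi_factor (alpha l : R) (lam : R) (v : E) : 0 < lam ->
  (lam^-1 `^ alpha * l)^-1 * rnorm ((lam^-1 ^- n)%:C *: v) =
  lam `^ (n%:R + alpha) / l * rnorm v.
Proof.
move=> l0; rewrite rnormZr powRV// exprVn invrK ger0_norm ?exprn_ge0 ?(ltW l0)//.
rewrite powRD; last by apply/implyP => _; rewrite gt_eqF.
by rewrite powR_mulrn ?(ltW l0)// invfM invrK; ring.
Qed.

Variables (alpha : R) (L : R -> R).
Hypothesis L_gt0 : exists d : R, 0 < d /\ forall t, 0 < t < d -> 0 < L t^-1.

Local Notation wt t := (t `^ (n%:R + alpha) / L t^-1).

Lemma quasi_to_laplace :
  (forall phi : S, exists d B : R, 0 < d /\ forall t, 0 < t < d ->
     wt t * rnorm (h (dilate t^-1 phi)) <= B) ->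
  exists (k : nat) (d B : R), 0 < d /\ forall t x s, 0 < t < d -> inbox 1 x ->
    0 < s <= 1 -> s ^+ k * wt t * rnorm (F (t *: x) (t * s)) <= B.
Proof.
move=> HQ; apply: contrapT => nH.
have {}nH k d B : 0 < d -> exists t x s, [/\ 0 < t < d, inbox 1 x, 0 < s <= 1 &
    B < s ^+ k * wt t * rnorm (F (t *: x) (t * s))].
  move=> d0; apply: contrapT => H; apply: nH; exists k, d, B; split=> // t x s td xb s01.
  by rewrite leNgt; apply/negP => Hlt; apply: H; exists t, x, s.
have [d1 [d10 Ld1]] := L_gt0.
have [N [C [C0 HC]]] := laplace_bound h_continuous h_supported delta_gt0 delta_conj.
(* Forces the scales lam k to tend to 0, inside the range where L is positive and dilations are
   contractions. *)
pose dk (k : nat) : R := Num.min d1 (Num.min 1 k.+1%:R^-1).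
have dk0 k : 0 < dk k by rewrite /dk !lt_min d10 ltr01 invr_gt0 ltr0Sn.
(* Of the exponent k + N, the part N compensates the s^-N of [laplace_bound] and makes the supremum
   over (x, s) finite at fixed t; the part k grows, so that any fixed norm of the test functions is
   eventually bounded. *)
pose val k t x s : R := s ^+ (k + N) * wt t * rnorm (F (t *: x) (t * s)).
have Hex k : exists t : R, 0 < t < dk k /\
    exists (x : 'rV[R]_n) (s : R), [/\ inbox 1 x, 0 < s <= 1 & 4 / 3 * (k%:R * 3 ^+ k) < val k t x s].
  have [t [x [s [h1 h2 h3 h4]]]] := nH (k + N)%N (dk k) (4 / 3 * (k%:R * 3 ^+ k)) (dk0 k).
  by exists t; split=> //; exists x, s.
have [lam Hlam] := choice Hex.
have l0 k : 0 < lam k by have [/andP[]] := Hlam k.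
have ld k : lam k < d1.
  by have [/andP[_ H] _] := Hlam k; apply: (lt_le_trans H); rewrite ge_min lexx.
have l1 k : lam k <= 1.
  have [/andP[_ H] _] := Hlam k; apply: (le_trans (ltW H)).
  by rewrite !ge_min lexx !orbT.
have lk k : lam k < k.+1%:R^-1.
  have [/andP[_ H] _] := Hlam k; apply: (lt_le_trans H).
  by rewrite !ge_min lexx !orbT.
have l01 k : 0 < lam k <= 1 by rewrite l0 l1.
have wt0 k : 0 < wt (lam k).
  by rewrite divr_gt0 ?powR_gt0// Ld1// l0 ld.
pose A k : set R := [set a | exists x s, [/\ inbox 1 x, 0 < s <= 1 & a = val k (lam k) x s]].
have Asup k : has_sup (A k).
  split; first by have [_ [x [s [h1 h2 _]]]] := Hlam k; exists (val k (lam k) x s), x, s.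
  exists (wt (lam k) * (C * ((1 + n%:R) / lam k) ^+ N)) => _ [x [s [xb /andP[s0 s1] ->]]].
  have ls : 0 < lam k * s <= 1 by rewrite mulr_gt0//= mulr_ile1// ltW.
  rewrite /val -mulrA mulrCA ler_wpM2l ?(ltW (wt0 k))//.
  apply: (le_trans (ler_wpM2l (exprn_ge0 _ (ltW s0)) (HC _ _ ls))).
  set e := 1 + enorm _.
  have e0 : 0 <= e := ltW (gt0_enorm _).
  have en : e <= 1 + n%:R.
    rewrite /e lerD2l enormZ (@le_trans _ _ (enorm x))//.
      by rewrite ler_piMl ?enorm_ge0// gtr0_norm.
    by rewrite (le_trans (enorm_le_box xb))// mulr1.
  have -> : s ^+ (k + N) * (C * (e / (lam k * s)) ^+ N) = s ^+ k * (C * (e / lam k) ^+ N).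
    have -> : e / (lam k * s) = e / lam k * s^-1 by rewrite invfM mulrA.
    rewrite exprD exprMn exprVn; set X := _ ^+ N; rewrite -!mulrA.
    congr (_ * _); rewrite mulrCA; congr (_ * _).
    by rewrite mulrCA mulfV ?mulr1// expf_neq0// gt_eqF.
  have el : 0 <= e / lam k by rewrite divr_ge0// ltW.
  apply: (@le_trans _ _ (C * (e / lam k) ^+ N)).
    by rewrite ler_piMl ?mulr_ge0 ?exprn_ge0// exprn_ile1// ltW.
  have eln : e / lam k <= (1 + n%:R) / lam k by rewrite ler_wpM2r// invr_ge0 ltW.
  by rewrite ler_wpM2l// lerXn2r// nnegrE// (le_trans el).
(* Missing the supremum by at most a quarter yields the factor 4/3, also present in the threshold so
   that k 3^k remains. *)
have arith (z T y : R) : 0 <= z -> 4 / 3 * z < T -> T - T / 4 < y ->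
    z <= y /\ T <= 4 / 3 * y by split; lra.
have Hex2 k : exists y : 'rV[R]_n * R, [/\ inbox 1 y.1,
    0 < y.2 <= 1, k%:R * 3 ^+ k <= val k (lam k) y.1 y.2 &
    sup (A k) <= 4 / 3 * val k (lam k) y.1 y.2].
  have [_ [x0 [s0 [h1 h2 h3]]]] := Hlam k.
  have k3 : 0 <= k%:R * 3 ^+ k :> R by rewrite mulr_ge0.
  have supk : 4 / 3 * (k%:R * 3 ^+ k) < sup (A k).
    apply: (lt_le_trans h3); apply: ub_le_sup; first by have [] := Asup k.
    by exists x0, s0.
  have e0 : 0 < sup (A k) / 4.
    by rewrite divr_gt0// (le_lt_trans _ supk)// mulr_ge0// divr_ge0.
  have [_ [x [s [xb s01 ->]]] Hs] := sup_adherent e0 (Asup k).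
  have [a1 a2] := arith _ _ _ k3 supk Hs.
  by exists (x, s).
have [xs Hxs] := choice Hex2.
pose q k (f : S) := wt (lam k) * rnorm (h (dilate (lam k)^-1 f)).
pose phi k : S := (((xs k).2 ^+ (k + N))%:C *: etest (xs k).1 (xs k).2).
have ln0 k : (lam k)^-1 != 0 by rewrite invr_eq0 gt_eqF.
have qphi k i : q k (phi i) = (xs i).2 ^+ (i + N) * wt (lam k) *
    rnorm (F (lam k *: (xs i).1) (lam k * (xs i).2)).
  have [_ s01 _ _] := Hxs i; have /andP[s0 s1] := s01.
  rewrite /q /phi dilateZ// linearZ rnormZr h_dilate_etest//.
  by rewrite ger0_norm ?exprn_ge0 ?(ltW s0)// mulrCA mulrA.
have [f Hf] : exists f, forall k, k%:R / 3 <= q k f.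
  apply: (unbounded_seminorms (phi := phi)).
  - move=> k f g; rewrite /q dilateD// linearD -mulrDr.
    by rewrite ler_wpM2l ?ler_rnormD// ltW.
  - by move=> k c f; rewrite /q dilateZ// linearZ rnormZr mulrCA.
  - move=> k; have [M [D [D0 HD]]] := hr_dil_bound h_continuous.
    exists M, (wt (lam k) * (D * (lam k ^- M)) * 2); split.
      have p1 : 0 <= lam k ^- M by rewrite invr_ge0 exprn_ge0// ltW.
      exact: (mulr_ge0 (mulr_ge0 (ltW (wt0 k)) (mulr_ge0 D0 p1)) (ler0n R 2)).
    move=> f B [H1 H2]; rewrite /q; have w0 := wt0 k; move: (wt (lam k)) w0 => w w0.
    rewrite -!mulrA ler_wpM2l ?(ltW w0)//.
    rewrite h_dilate// (le_trans (ler_rnormD _ _))// rnorm_i.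
    have h1 := HD _ _ _ (l01 k) (rschw_Re f) H1.
    have h2 := HD _ _ _ (l01 k) (rschw_Im f) H2.
    apply: (le_trans (lerD h1 h2)); apply: eq_lerW.
    ring.
  - move=> M; have [D [D0 HD]] := wsup_cone_ecos omega delta_gt0 M.
    exists (D * (1 + n%:R) ^+ M) => k Mk.
    have [xb s01 _ _] := Hxs k; have /andP[s0 s1] := s01.
    have W c : wsup M (fun u => (xs k).2 ^+ (k + N) *
        cone_ecos omega delta (xs k).1 (xs k).2 c u) (D * (1 + n%:R) ^+ M).
      have := wsupZ ((xs k).2 ^+ (k + N)) (smooth_cone_ecos omega delta (xs k).1 (xs k).2 c)
        (HD (xs k).1 (xs k).2 c s01).
      apply: wsup_le; rewrite ger0_norm ?exprn_ge0 ?(ltW s0)//.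
      rewrite mulrCA ler_wpM2l// expr_div_n mulrA ler_pdivrMr ?exprn_gt0// mulrC.
      apply: ler_pM; rewrite ?exprn_ge0 ?(ltW (gt0_enorm _)) ?(ltW s0)//.
        rewrite lerXn2r ?nnegrE ?(ltW (gt0_enorm _))// lerD2l.
        by rewrite (le_trans (enorm_le_box xb))// mulr1.
      by rewrite ler_wiXn2l// ?(ltW s0)// (leq_trans Mk)// leq_addr.
    split.
      have := W 0; congr wsup; apply/funext => u.
      have Ephi : phi k u = ((xs k).2 ^+ (k + N))%:C * etest (xs k).1 (xs k).2 u by [].
      by rewrite /comp Ephi etestE// /cexp_test /= mul0r subr0.
    have := W (- (pi / 2)); congr wsup; apply/funext => u.
    have Ephi : phi k u = ((xs k).2 ^+ (k + N))%:C * etest (xs k).1 (xs k).2 u by [].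
    by rewrite /comp Ephi etestE// /cexp_test /= mul0r addr0.
  (* Since s <= 1 and i >= k, lowering the exponent from i + N to k + N only increases the value,
     which is then a competitor in the supremum at stage k. *)
  - move=> k i ki; have [xb s01 _ _] := Hxs i; have /andP[s0 s1] := s01.
    rewrite !qphi; have [_ _ _ Hsup] := Hxs k; apply: le_trans Hsup.
    apply: (@le_trans _ _ (val k (lam k) (xs i).1 (xs i).2)).
      rewrite /val; have w0 := wt0 k; move: (wt (lam k)) w0 => w w0.
      rewrite -!mulrA ler_wpM2r ?mulr_ge0 ?rnorm_ge0 ?(ltW w0)//.
      by rewrite ler_wiXn2l// ?(ltW s0)// leq_add2r.
    apply: ub_le_sup; first by have [] := Asup k.
    by exists (xs i).1, (xs i).2.
  - by move=> k; rewrite qphi; have [] := Hxs k.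
have [d [B [d0 HB]]] := HQ f.
(* Larger than 1/d, so that lam k < d and the assumed bound B applies, and larger than 3 |B|, which
   contradicts k / 3 <= B. *)
pose k := Num.bound (d^-1 + 3 * `|B| + 1).
have kb : d^-1 + 3 * `|B| + 1 < k%:R.
  by apply: archi_boundP; rewrite !addr_ge0 ?mulr_ge0// invr_ge0 ltW.
have di : 0 < d^-1 by rewrite invr_gt0.
have B3 : 0 <= 3 * `|B| by rewrite mulr_ge0.
have lkd : lam k < d.
  apply: (lt_le_trans (lk k)); rewrite -[leRHS]invrK lef_pV2 ?posrE//.
  rewrite -[k.+1]addn1 natrD; lra.
have lkB := HB (lam k); rewrite l0 lkd in lkB; have {}lkB := lkB isT.
have := Hf k; rewrite /q => /le_trans/(_ lkB).
have := ler_norm B; rewrite ler_pdivrMr//; lra.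
Qed.

End Necessity.

(** * A Potter bound for slowly varying functions *)

Section SlowVariation.
Context (R : realType).
Local Notation mu := (@lebesgue_measure R).
Local Notation RB := (measurableTypeR R).

Lemma measurable_mulr (c : R) : measurable_fun [set: RB] (fun v : RB => (v * c : RB)).
Proof. by apply: measurable_funM => //; exact: measurable_id. Qed.

Lemma measurable_preimage_mulr (c : R) (A : set RB) : measurable A ->
  measurable [set v : RB | A (v * c)].
Proof. by move=> mA; have := measurable_mulr c measurableT mA; rewrite setTI. Qed.

(** Uniqueness of Lebesgue measure: c times the image measure agrees with it on half-open
    intervals. *)
Lemma lebesgue_measure_mulr (c : R) (A : set RB) : 0 < c -> measurable A ->
  mu [set v : RB | A (v * c)] = ((c^-1)%:E * mu A)%E.
Proof.
move=> c0 mA.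
pose f : {mfun RB >-> RB} := mfun_Sub (mem_set (measurable_mulr c)).
have H : pushforward (mscale (NngNum (ltW c0)) mu) f A = mu A.
  apply/esym/lebesgue_measure_unique => //= _ [[a b]] _ <-.
  rewrite /pushforward /mscale /=.
  have -> : (fun v : RB => v * c) @^-1` `]a, b]%classic = `]a / c, b / c]%classic.
    apply/seteqP; split=> v /=; rewrite !in_itv/= => /andP[h1 h2]; apply/andP;
      move: h1 h2; by rewrite ltr_pdivrMr// ler_pdivlMr.
  rewrite !lebesgue_measure_itv/= !lte_fin ltr_pM2r ?invr_gt0//.
  case: ifP => _; last by rewrite mule0.
  by rewrite -!EFinD -EFinM -mulrBl mulrC divfK// gt_eqF.
by rewrite -H /pushforward /mscale /= muleA -EFinM mulVf ?gt_eqF// mul1e.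
Qed.

(** Egorov's argument: pointwise convergence of the ratios makes the sets where they stay in (1/2,
    2) from k on increase to the whole interval. As L is measurable for the completed sigma-algebra
    only, each preimage is replaced by a Borel subset, and the null sets so lost are collected over
    all m in [Z]. *)
Lemma uniform_ratio_set (L : R -> R) (A lo hi : R) (y : nat -> R) (eta : R) :
  (forall x, A < x -> 0 < L x) ->
  @measurable_fun _ _ (g_sigma_algebraType
    (measurable_realfun.completed_algebra_gen (@lebesgue_measure R)))
    (measurableTypeR R) `]A, +oo[ L ->
  lo < hi -> (forall m, A < y m /\ 0 < y m) ->
  (forall m v, lo <= v <= hi -> A < v * y m) ->
  (forall v, lo <= v <= hi -> exists k : nat, forall m, (k <= m)%N ->
     1 / 2 < L (v * y m) / L (y m) < 2) ->
  0 < eta ->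
  exists k (V : set RB), [/\ measurable V, V `<=` `[lo, hi],
    ((hi - lo - eta)%:E < mu V)%E &
    forall m v, (k <= m)%N -> V v -> 1 / 2 < L (v * y m) / L (y m) < 2].
Proof.
move=> Lpos mL lohi yA vA conv eta0.
(* The ratio condition on v reads v y_m in [S m], which is a preimage under L of an interval. *)
pose S m : set R := `]A, +oo[ `&` L @^-1` `]L (y m) / 2, L (y m) * 2[%classic.
have SE m v : A < v -> S m v <-> 1 / 2 < L v / L (y m) < 2.
  have Ly0 : 0 < L (y m) by apply: Lpos; have [] := yA m.
  move=> Av; rewrite /S /= !in_itv/= Av/= ltr_pdivlMr// !ltr_pdivrMr//.
  split=> [[_ /andP[h1 h2]]|/andP[h1 h2]]; last split=> //.
    by apply/andP; split; lra.
  by apply/andP; split; lra.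
have dec m : exists BN : set RB * set RB, [/\ measurable BN.1, measurable BN.2,
    mu BN.2 = 0%E, BN.1 `<=` S m & S m `<=` BN.1 `|` BN.2].
  have : (measurable_realfun.completed_algebra_gen (@lebesgue_measure R)).-sigma.-measurable (S m).
    apply: mL; last exact: measurable_itv.
    apply: sub_sigma_algebra; exists (`]A, +oo[%classic : set RB); first exact: measurable_itv.
    by exists set0; [exact: negligible_set0|rewrite setU0].
  rewrite g_sigma_completed_algebra_genE => -[B mB [N [N' [mN' N'0 NN']] BN]].
  exists (B, N'); split=> //=; rewrite -BN; first by move=> v; left.
  by apply: setUS.
have [BN HBN] := choice dec.
pose Z : set RB := \bigcup_m [set v : RB | (BN m).2 (v * y m)].
have y0 m : 0 < y m by have [] := yA m.
have mZ : measurable Z.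
  apply: bigcupT_measurable => m; apply: measurable_preimage_mulr.
  by have [] := HBN m.
have Z0 : mu Z = 0%E.
  apply/negligibleP => //; apply: negligible_bigcup => m.
  have [_ m2 m20 _ _] := HBN m.
  apply/negligibleP; first exact: measurable_preimage_mulr.
  by apply: (etrans (lebesgue_measure_mulr (y0 m) m2)); rewrite m20 mule0.
pose G : set RB := `[lo, hi]%classic `\` Z.
have mI : measurable (`[lo, hi]%classic : set RB) by exact: measurable_itv.
have mG : measurable G by exact: measurableD.
have muI : mu `[lo, hi]%classic = (hi - lo)%:E.
  by rewrite lebesgue_measure_itv/= lte_fin lohi -EFinD.
have muG : mu G = (hi - lo)%:E.
  have IZ : mu (`[lo, hi]%classic `&` Z) = 0%E.
    apply: (@subset_measure0 _ _ _ mu _ Z) => //; exact: measurableI.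
  have fI : (mu `[lo, hi]%classic < +oo)%E.
    exact: (eq_ind_r (fun z => (z < +oo)%E) (ltry _) muI).
  have E := measureD mI mZ fI.
  by apply: (etrans E); apply: (etrans (congr2 (fun a b => (a - b)%E) muI IZ)); rewrite sube0.
pose V k : set RB := G `&` \bigcap_(m in [set m | (k <= m)%N]) [set v : RB | (BN m).1 (v * y m)].
have mV k : measurable (V k).
  apply: measurableI => //; apply: bigcap_measurable; first by exists k => /=.
  by move=> m _; apply: measurable_preimage_mulr; have [] := HBN m.
have VG : \bigcup_k V k = G.
  apply/seteqP; split=> [v [k _ []]//|v Gv].
  have [vI nZ] := Gv; move: vI; rewrite /= in_itv/= => vI.
  have [k Hk] := conv v vI; exists k => //; split=> // m /= km.
  have [_ _ _ _ H] := HBN m.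
  have : S m (v * y m) by apply/SE; [exact: vA|exact: Hk].
  by move=> /H[//|bad]; exfalso; apply: nZ; exists m.
have cV : mu (V k) @[k --> \oo] --> (hi - lo)%:E.
  rewrite -muG -VG; apply: nondecreasing_cvg_mu => //.
    by rewrite VG.
  move=> i j ij; apply/subsetPset => v [Gv H]; split=> // m /= jm.
  by apply: H; rewrite /= (leq_trans ij).
have [k Hk] : exists k, ((hi - lo - eta)%:E < mu (V k))%E.
  apply: contrapT => nH.
  have H k : (mu (V k) <= (hi - lo - eta)%:E)%E.
    by rewrite leNgt; apply/negP => h; apply: nH; exists k.
  have : ((hi - lo)%:E <= (hi - lo - eta)%:E)%E.
    rewrite -(cvg_lim _ cV)//; apply: lime_le; first by apply/cvg_ex; eexists; exact: cV.
    exact: nearW.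
  by rewrite lee_fin; lra.
exists k, (V k); split=> //; first by move=> v [[]].
move=> m v km [[vI _] H]; have [_ _ _ BS _] := HBN m.
move: vI; rewrite /= in_itv/= => vI.
by apply/SE; [exact: vA|apply/BS/H].
Qed.

(** Suppose x_k tends to infinity with bad a_k in [1, 2], and put y_k = a_k x_k. For some k, most v
    in [1, 4] have L(v x_k) within a factor 2 of L(x_k), and over half of the w in [1, 2] have L(w
    y_k) within a factor 2 of L(y_k). A common point v = a_k w gives v x_k = w y_k, so L(x_k) and
    L(y_k) differ by a factor at most 4. *)
Lemma slowly_varying_doubling (L : R -> R) : slowly_varying L ->
  exists X : R, [/\ 0 < X, forall x, X <= x -> 0 < L x &
   forall x a, X <= x -> 1 <= a <= 2 -> 1 / 4 <= L (a * x) / L x <= 4].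
Proof.
move=> [A [Lpos mL Lsv]]; apply: contrapT => nH.
have bad (k : nat) : exists xa : R * R, [/\ k%:R + 1 + `|A| <= xa.1, 1 <= xa.2 <= 2 &
    ~ (1 / 4 <= L (xa.2 * xa.1) / L xa.1 <= 4)].
  apply: contrapT => H; apply: nH; exists (k%:R + 1 + `|A|); split.
  - by rewrite ltr_wpDr// ltr_wpDl.
  - move=> x Hx; apply: Lpos; apply: lt_le_trans Hx.
    by rewrite (le_lt_trans (ler_norm A))// ltrDr ltr_wpDl.
  move=> x a Hx Ha; apply: contrapT => Hn; apply: H; by exists (x, a).
have [xa Hxa] := choice bad.
pose x k := (xa k).1; pose a k := (xa k).2.
have xk k : k%:R + 1 + `|A| <= x k by have [] := Hxa k.
have a12 k : 1 <= a k <= 2 by have [] := Hxa k.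
have nb k : ~ (1 / 4 <= L (a k * x k) / L (x k) <= 4) by have [] := Hxa k.
have x0 k : 0 < x k.
  by apply: lt_le_trans (xk k); rewrite ltr_wpDr// ltr_wpDl.
have xA k : A < x k.
  apply: lt_le_trans (xk k); rewrite (le_lt_trans (ler_norm A))// ltrDr ltr_wpDl//.
have vx (z v : R) : A < z -> 0 < z -> 1 <= v -> A < v * z.
  by move=> Az z0 v1; rewrite (lt_le_trans Az)// ler_peMl// ltW.
have conv (y : nat -> R) : (forall m, m%:R <= y m) -> forall v, 0 < v ->
    exists k : nat, forall m, (k <= m)%N -> 1 / 2 < L (v * y m) / L (y m) < 2.
  move=> Hy v v0; have := Lsv v v0 => /cvgrPdist_lt/(_ (1 / 2)).
  move=> /(_ _)[|M [Mr HM]]; first by rewrite divr_gt0.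
  exists (Num.bound `|M|).+1 => m km.
  have : M < y m.
    rewrite (le_lt_trans (ler_norm M))// (lt_le_trans _ (Hy m))//.
    by rewrite (lt_trans (archi_boundP (normr_ge0 M)))// ltr_nat.
  by move=> /HM; rewrite /= ltr_distl => /andP[]; lra.
have h2 : 0 < 1 / 2 :> R by lra.
have l14 : 1 < 4 :> R by lra.
have l12 : 1 < 2 :> R by lra.
have xn m : m%:R <= x m.
  by apply: le_trans (xk m); rewrite -addrA lerDl addr_ge0.
have [k1 [V [mV V14 muV HV]]] := @uniform_ratio_set L A 1 4 x (1 / 2) Lpos mL
  l14 (fun m => conj (xA m) (x0 m))
  (fun m v h => vx _ _ (xA m) (x0 m) (proj1 (andP h)))
  (fun v h => conv x xn v (lt_le_trans ltr01 (proj1 (andP h)))) h2.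
pose y k := a k * x k.
have yx k : x k <= y k by rewrite ler_peMl ?(ltW (x0 k))//; have /andP[] := a12 k.
have y0 k : 0 < y k := lt_le_trans (x0 k) (yx k).
have yA k : A < y k := lt_le_trans (xA k) (yx k).
have yn m : m%:R <= y m.
  by apply: le_trans (yx m); apply: le_trans (xk m); rewrite -addrA lerDl addr_ge0.
have [k2 [W [mW W12 muW HW]]] := @uniform_ratio_set L A 1 2 y (1 / 2) Lpos mL
  l12 (fun m => conj (yA m) (y0 m))
  (fun m v h => vx _ _ (yA m) (y0 m) (proj1 (andP h)))
  (fun v h => conv y yn v (lt_le_trans ltr01 (proj1 (andP h)))) h2.
pose k := maxn k1 k2.
have /andP[a1 a2] := a12 k; have a0 : 0 < a k := lt_le_trans ltr01 a1.
pose aW : set RB := [set v : RB | W (v * (a k)^-1)].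
have maW : measurable aW by exact: measurable_preimage_mulr.
have muaW : ((1 / 2)%:E < mu aW)%E.
  rewrite lebesgue_measure_mulr ?invr_gt0// invrK.
  apply: (lt_le_trans (_ : _ < mu W)%E).
    by apply: le_lt_trans muW; rewrite lee_fin; lra.
  by rewrite -[leLHS]mul1e lee_wpmul2r// lee_fin.
have aW14 : aW `<=` `[1, 4]%classic.
  move=> v /W12; rewrite /= !in_itv/= ler_pdivlMr// ler_pdivrMr// mul1r.
  by move=> /andP[h3 h4]; rewrite (le_trans a1 h3)/= (le_trans h4)//; lra.
clear h2.
(* The two measures exceed 5/2 and 1/2, while both sets lie in [1, 4], of length 3. *)
have [v [Vv aWv]] : exists v, V v /\ aW v.
  apply: contrapT => nv.
  have VaW : V `&` aW = set0 by apply/seteqP; split=> // v Hv; exfalso; apply: nv; exists v.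
  have := measureU mu mV maW VaW.
  have : (mu (V `|` aW) <= 3%:E)%E.
    have -> : 3%:E = mu `[1, 4]%classic.
      rewrite lebesgue_measure_itv/= lte_fin ifT; last by lra.
      by rewrite -EFinD; congr (_%:E); lra.
    apply: le_measure; rewrite ?inE//; first exact: measurableU.
    by move=> v [/V14|/aW14].
  move=> h1 h2; move: h1; rewrite h2 leNgt => /negP; apply.
  apply: le_lt_trans (lteD muV muaW); rewrite -EFinD lee_fin; lra.
apply: (nb k).
have h1 := HV k v (leq_maxl _ _) Vv.
have h2 := HW k (v * (a k)^-1) (leq_maxr _ _) aWv.
have E : v * (a k)^-1 * y k = v * x k by rewrite /y mulrA divfK// gt_eqF.
rewrite E in h2; rewrite -/(y k).
have Lx : 0 < L (x k) by exact: Lpos.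
have Ly : 0 < L (y k) by exact: Lpos.
move: h1 h2; rewrite !ltr_pdivlMr// !ltr_pdivrMr// !ler_pdivlMr// !ler_pdivrMr//.
move: (L (v * x k)) => z /andP[h1 h2] /andP[h3 h4]; apply/andP; split; lra.
Qed.

(** If 2^m <= y / x < 2^(m+1), then m doublings cost 4^m <= (y / x)^2 and the remaining ratio one
    more factor 4. The symmetric expression spares a distinction between x <= y and y <= x. *)
Lemma slowly_varying_potter (L : R -> R) : slowly_varying L ->
  exists X : R, [/\ 0 < X, forall x, X <= x -> 0 < L x &
   forall x y, X <= x -> X <= y -> L y <= 4 * L x * (x / y + y / x) ^+ 2].
Proof.
move=> /slowly_varying_doubling[X [X0 Lpos H]]; exists X; split=> //.
have step (m : nat) x a : X <= x -> 1 <= a <= 2 -> L (2 ^+ m * (a * x)) <= 4 * 4 ^+ m * L x /\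
    L x <= 4 * 4 ^+ m * L (2 ^+ m * (a * x)).
  move=> Xx a12; have x0 := lt_le_trans X0 Xx; have Lx := Lpos x Xx.
  have /andP[a1 a2] := a12.
  have Xax : X <= a * x by rewrite (le_trans Xx)// ler_peMl// ltW.
  elim: m => [|m [IH1 IH2]].
    rewrite expr0 !mul1r mulr1; have := H x a Xx a12.
    by rewrite ler_pdivlMr// ler_pdivrMr// => /andP[]; split; lra.
  have Xm : X <= 2 ^+ m * (a * x).
    by rewrite (le_trans Xax)// ler_peMl ?exprn_ege1 ?ler1n// (le_trans (ltW X0)).
  have Lm := Lpos _ Xm.
  have := H _ 2 Xm (_ : 1 <= 2 <= 2); rewrite ler1n lexx => /(_ isT).
  rewrite mulrA -exprS ler_pdivlMr// ler_pdivrMr// exprS => /andP[h1 h2].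
  rewrite exprS in h1 h2 *.
  have p0 : 0 <= 4 ^+ m :> R by rewrite exprn_ge0.
  move: p0 h1 h2 IH1 IH2; move: (4 ^+ m) (L (2 * _ * _)) (L (2 ^+ m * (a * x))) (L x).
  move=> p z r t p0 h1 h2 IH1 IH2.
  have : 0 <= p * (4 * z - r) by rewrite mulr_ge0//; lra.
  by rewrite mulrBr; split; lra.
have key x y : X <= x -> x <= y -> L y <= 4 * L x * (y / x) ^+ 2 /\
    L x <= 4 * L y * (y / x) ^+ 2.
  move=> Xx xy; have x0 := lt_le_trans X0 Xx.
  have [m /andP[m1 m2]] : exists m, (2 ^+ m : R) <= y / x < 2 ^+ m.+1.
    have ex : exists m, y / x < 2 ^+ m.
      exists (Num.bound (y / x)); have yx0 : 0 <= y / x.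
        by rewrite divr_ge0 ?(ltW x0)// (le_trans (ltW x0)).
      by rewrite (lt_le_trans (archi_boundP yx0))// -natrX ler_nat ltnW// ltn_expl.
    have [[|m] Hm mmin] := ex_minnP ex.
      by move: Hm; rewrite expr0 ltNge ler_pdivlMr// mul1r xy.
    exists m; rewrite Hm andbT leNgt; apply/negP => /mmin.
    by rewrite ltnn.
  have p0 : 0 < 2 ^+ m :> R by rewrite exprn_gt0.
  pose a := y / x / 2 ^+ m.
  have a12 : 1 <= a <= 2.
    by rewrite ler_pdivlMr// mul1r m1/= ler_pdivrMr// -exprS ltW.
  have E : 2 ^+ m * (a * x) = y.
    by rewrite /a; field; rewrite !gt_eqF.
  have [h1 h2] := step m x a Xx a12; rewrite E in h1 h2.
  have q : 4 ^+ m <= (y / x) ^+ 2.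
    rewrite (_ : 4 ^+ m = (2 ^+ m) ^+ 2 :> R); last by rewrite -exprM mulnC exprM; congr (_ ^+ _); ring.
    by rewrite lerXn2r ?nnegrE ?(ltW p0)// (le_trans (ltW p0)).
  have Lx := Lpos x Xx; have Ly := Lpos y (le_trans Xx xy).
  split.
    apply: (le_trans h1); rewrite mulrAC ler_wpM2l//.
    by rewrite mulr_ge0// ltW.
  apply: (le_trans h2); rewrite mulrAC ler_wpM2l//.
  by rewrite mulr_ge0// ltW.
move=> x y Xx Xy; have x0 := lt_le_trans X0 Xx; have y0 := lt_le_trans X0 Xy.
have Lx := Lpos x Xx; have Ly := Lpos y Xy.
have p1 : 0 < x / y by rewrite divr_gt0.
have p2 : 0 < y / x by rewrite divr_gt0.
have L4 : 0 <= 4 * L x by rewrite mulr_ge0// ltW.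
have [xy|yx] := leP x y.
  have [h _] := key x y Xx xy; apply: (le_trans h).
  by rewrite ler_wpM2l// lerXn2r ?nnegrE ?addr_ge0 ?(ltW p1) ?(ltW p2)// lerDr ltW.
have [_ h] := key y x Xy (ltW yx); apply: (le_trans h).
by rewrite ler_wpM2l// lerXn2r ?nnegrE ?addr_ge0 ?(ltW p1) ?(ltW p2)// lerDl ltW.
Qed.

End SlowVariation.

(** * Discrete Fourier interpolation *)

Section Differences.
Context (R : realType) (n : nat).
Implicit Types (f : 'rV[R]_n -> R) (x u v a : 'rV[R]_n) (s : seq 'I_n) (q : R).

Local Notation e_ j := (delta_mx 0 j : 'rV[R]_n).

Lemma derive_translate f a x v :
  'D_v (fun u => f (a + u)) x = 'D_v f (a + x).
Proof.
have E : (fun h : R => h^-1 *: (((fun u => f (a + u)) \o shift x) (h *: v) - f (a + x))) =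
    (fun h => h^-1 *: ((f \o shift (a + x)) (h *: v) - f (a + x))).
  by apply/funext => h /=; rewrite addrCA.
by rewrite /derive E.
Qed.

Lemma derivable_translate f a x v :
  derivable f (a + x) v -> derivable (fun u => f (a + u)) x v.
Proof.
rewrite /derivable; set g := (X in cvg (X @ _)) => cg.
set k := (X in cvg (X @ _)); have -> // : k = g.
by apply/funext => h; rewrite /k /g /= addrCA.
Qed.

Lemma partials_translate s f a :
  partials s (fun u => f (a + u)) = fun x => partials s f (a + x).
Proof.
elim: s => [//|j s IH] /=; rewrite IH; apply/funext => x.
exact: derive_translate.
Qed.

Lemma smooth_translate f a : smooth f -> smooth (fun u => f (a + u)).
Proof.
move=> sf s; rewrite partials_translate; have [cf df] := sf s; split=> [x|j x].
  apply: (@continuous_comp _ _ _ (fun u => a + u) (partials s f)) => //.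
    have H : {for x, continuous (fun u : 'rV[R]_n => a + u)}.
      have c1 : {for x, continuous (fun _ : 'rV[R]_n => a)} by exact: cst_continuous.
      have c2 : {for x, continuous (fun u : 'rV[R]_n => u)} by exact: cvg_id.
      exact: (continuousD c1 c2).
    exact: H.
  exact: cf.
exact: derivable_translate.
Qed.

(* In Fourier space, [theta q j] is multiplication by [1 - q (e^{i x_j / q} - 1)],
   whose modulus is at least [(1 + |x_j|) / 4] at all the frequencies used. *)
Definition theta q j f u := f u - q * (f (q^-1 *: e_ j + u) - f u).

Definition thetas q s f := foldr (theta q) f s.

Lemma smooth_theta q j f : smooth f -> smooth (theta q j f).
Proof.
move=> sf.
have -> : theta q j f = fun u => (1 + q) * f u + - q * f (q^-1 *: e_ j + u).
  by apply/funext => u; rewrite /theta; ring.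
by apply: smoothD; apply: smoothZ => //; exact: smooth_translate.
Qed.

Lemma partials_theta q j f s : smooth f ->
  partials s (theta q j f) = theta q j (partials s f).
Proof.
move=> sf.
have -> : theta q j f = fun u => (1 + q) * f u + - q * f (q^-1 *: e_ j + u).
  by apply/funext => u; rewrite /theta; ring.
have sg := smooth_translate (q^-1 *: e_ j) sf.
rewrite partialsD; try exact: smoothZ.
rewrite !partialsZ// partials_translate.
by apply/funext => u; rewrite /theta; ring.
Qed.

Lemma enorm_delta_le (r : R) j x : `|r| <= 1 ->
  1 + enorm x <= n.+2%:R * (1 + enorm (r *: e_ j + x)).
Proof.
move=> r1; set y := r *: e_ j + x.
have H i : `|x 0 i| <= enorm y + (i == j)%:R.
  have -> : x 0 i = y 0 i - r * (i == j)%:R by rewrite !mxE eqxx/= [r * _ + _]addrC addrK.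
  rewrite (le_trans (ler_normB _ _))// lerD ?abs_le_enorm// normrM (ger0_norm (ler0n _ _)).
  by rewrite ler_piMl.
have : enorm x <= n%:R * enorm y + 1.
  rewrite (le_trans (enorm_le_sum x))// (le_trans (ler_sum _ (fun i _ => H i)))//.
  rewrite big_split/= sumr_const card_ord -[_ *+ n]mulr_natl.
  by rewrite (bigD1 j)//= eqxx big1 ?addr0// => i /negbTE ->.
rewrite -addn2 natrD; have := ler0n R n; have := enorm_ge0 y.
move: (enorm x) (enorm y) (n%:R : R) => X Y m; nra.
Qed.

(** The mean value theorem bounds the difference quotient by one derivative, uniformly in q >= 1; a
    shift of length at most 1 changes the weight by a factor at most n + 2. *)
Lemma wsup_theta q j N f (B : R) : 1 <= q -> smooth f -> wsup N.+1 f B ->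
  wsup N (theta q j f) ((1 + n.+2%:R ^+ N) * B).
Proof.
move=> q1 sf H s x sN; rewrite partials_theta//.
have q0 : 0 < q := lt_le_trans ltr01 q1.
have sps := smooth_partials s sf.
have w0 := gt0_enorm x; have wN : 0 < (1 + enorm x) ^+ N by rewrite exprn_gt0.
have B0 := wsup_ge0 H.
have D0 : 0 <= n.+2%:R ^+ N * B / (1 + enorm x) ^+ N.
  by rewrite !mulr_ge0// ?exprn_ge0 ?invr_ge0 ?(ltW wN).
have M := line_MVT (x := x) (t := q^-1) (fun y => smooth_derivable sps) D0.
have {}M : `|partials s f (q^-1 *: e_ j + x) - partials s f x| <=
    n.+2%:R ^+ N * B / (1 + enorm x) ^+ N * q^-1.
  rewrite -[in leRHS](@ger0_norm _ q^-1) ?invr_ge0 ?(ltW q0)//; apply: (M j) => r.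
  rewrite [X in _ <= X -> _]ger0_norm ?invr_ge0 ?(ltW q0)// => rq.
  have r1 : `|r| <= 1 by rewrite (le_trans rq)// invf_le1.
  have := H (j :: s) (r *: e_ j + x) sN; rewrite /=.
  move: ('D_(e_ j) _ _) => d Hd; rewrite ler_pdivlMr//.
  have y0 := gt0_enorm (r *: e_ j + x).
  apply: (@le_trans _ _ (`|d| * (n.+2%:R * (1 + enorm (r *: e_ j + x))) ^+ N)).
    rewrite ler_wpM2l// lerXn2r ?nnegrE ?(ltW w0)//; last exact: enorm_delta_le.
    by rewrite mulr_ge0// ltW.
  rewrite exprMn mulrCA ler_wpM2l ?exprn_ge0// mulrC.
  apply: le_trans Hd; rewrite ler_wpM2r//.
  by rewrite ler_weXn2l// ge1_enorm.
rewrite /theta mulrDl mul1r.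
apply: (@le_trans _ _ ((1 + enorm x) ^+ N * (`|partials s f x| +
    `|q * (partials s f (q^-1 *: e_ j + x) - partials s f x)|))).
  by rewrite ler_wpM2l ?ler_normB ?(ltW wN).
rewrite mulrDr lerD//; first exact: (wsupW (leqnSn N) H).
rewrite normrM (ger0_norm (ltW q0)).
have := ler_wpM2l (ltW q0) M => /(ler_wpM2l (ltW wN)) /le_trans; apply.
by apply: eq_lerW; field; rewrite !gt_eqF.
Qed.

Lemma smooth_thetas q s f : smooth f -> smooth (thetas q s f).
Proof. by move=> sf; elim: s => [|j s IH]; [exact: sf|exact: (smooth_theta q j IH)]. Qed.

Lemma wsup_thetas q s N K f (B : R) : 1 <= q -> smooth f -> (N + size s <= K)%N ->
  wsup (N + size s) f B -> wsup N (thetas q s f) ((1 + n.+2%:R ^+ K) ^+ size s * B).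
Proof.
move=> q1 sf; elim: s N => [|j s IH] N /= NK H; first by rewrite mul1r -[N]addn0.
have H' : wsup N.+1 (thetas q s f) ((1 + n.+2%:R ^+ K) ^+ size s * B).
  by apply: IH; rewrite addSnnS.
rewrite exprS -mulrA; apply: wsup_le (wsup_theta j q1 (smooth_thetas q s sf) H').
rewrite ler_wpM2r ?(wsup_ge0 H')// lerD2l ler_weXn2l ?ler1n//.
exact: leq_trans (leq_addr _ _) NK.
Qed.

(** Vanishing is required on the faces |x_j| = r too: [dsum_translate] needs it at the edge of the
    grid. *)
Definition boxsupp (r : R) f := forall x j, r <= `|x 0 j| -> f x = 0.

Lemma boxsuppW (r r' : R) f : r <= r' -> boxsupp r f -> boxsupp r' f.
Proof. by move=> rr' H x j h; apply: (H x j); exact: le_trans h. Qed.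

Lemma boxsupp_thetas q s r f : 1 <= q -> boxsupp r f ->
  boxsupp (r + (size s)%:R) (thetas q s f).
Proof.
move=> q1 H; elim: s => [|j s IH] /=; first by rewrite addr0.
move=> x i hx; have h1 : r + (size s)%:R <= `|x 0 i|.
  by rewrite (le_trans _ hx)// lerD2l ler_nat.
rewrite /theta (IH _ i h1) (IH _ i) ?subrr ?mulr0 ?subrr//.
rewrite !mxE eqxx/= -lerBDr in hx *.
have q0 : 0 < q := lt_le_trans ltr01 q1.
have : `|x 0 i| <= `|q^-1 * (i == j)%:R + x 0 i| + q^-1 * (i == j)%:R.
  rewrite -{1}[x 0 i](addKr (q^-1 * (i == j)%:R)) addrC.
  rewrite (le_trans (ler_normD _ _))// normrN lerD2l ger0_norm//.
  by rewrite mulr_ge0// invr_ge0 ltW.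
have : q^-1 * (i == j)%:R <= 1.
  by rewrite mulr_ile1// ?invr_ge0 ?(ltW q0) ?invf_le1// lern1 leq_b1.
by move: hx; rewrite -natr1; lra.
Qed.

End Differences.

(** * Characters of the one-dimensional grid *)

Section Dft.
Context (R : realType).
Local Notation nrm z := (rnorm (z : R[i]^o)).

Lemma nrmM (x y : R[i]) : nrm (x * y) = nrm x * nrm y.
Proof. exact: rnormZ. Qed.

Lemma nrm1 : nrm (1 : R[i]) = 1. Proof. by rewrite /rnorm normr1. Qed.

Lemma nrm_sum (I : Type) (r : seq I) (F : I -> R[i]) :
  nrm (\sum_(i <- r) F i) <= \sum_(i <- r) nrm (F i).
Proof.
elim: r => [|i r IH]; first by rewrite !big_nil rnorm0.
by rewrite !big_cons (le_trans (ler_rnormD _ _))// lerD2l.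
Qed.

Lemma nrm_prod (I : Type) (r : seq I) (F : I -> R[i]) :
  nrm (\prod_(i <- r) F i) = \prod_(i <- r) nrm (F i).
Proof. exact: (big_morph (fun z : R[i] => nrm z) nrmM nrm1). Qed.

Definition cis (t : R) : R[i] := cos t +i* sin t.

Lemma cisD (a b : R) : cis (a + b) = cis a * cis b.
Proof.
by rewrite /cis cosD sinD; apply/eqP; rewrite eq_complex/= eqxx addrC eqxx.
Qed.

Lemma cis0 : cis 0 = 1. Proof. by rewrite /cis cos0 sin0. Qed.

Lemma cis_sum (I : Type) (r : seq I) (F : I -> R) :
  cis (\sum_(i <- r) F i) = \prod_(i <- r) cis (F i).
Proof. exact: (big_morph cis cisD cis0). Qed.

Lemma cisX (k : nat) (t : R) : cis (k%:R * t) = cis t ^+ k.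
Proof.
elim: k => [|k IH]; first by rewrite mul0r cis0.
by rewrite exprS -IH -cisD -natr1 mulrDl mul1r addrC.
Qed.

Lemma nrm_cis (t : R) : nrm (cis t) = 1.
Proof. by rewrite /cis rnorm_complex cos2Dsin2 sqrtr1. Qed.

Lemma cos_half (t : R) : cos t = 1 - 2 * sin (t / 2) ^+ 2.
Proof.
have -> : cos t = cos (t / 2 + t / 2) by rewrite -splitr.
have := cos2Dsin2 (t / 2); rewrite cosD -!expr2.
by move: (cos _ ^+ 2) (sin _ ^+ 2) => c s; lra.
Qed.

Lemma cis_neq1 (t : R) : t != 0 -> `|t| < 2 * pi -> cis t != 1.
Proof.
move=> t0 tpi; rewrite /cis eq_complex/= negb_and; apply/orP; left.
rewrite cos_half; apply/eqP => H.
have : sin (t / 2) = 0.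
  by apply/eqP; rewrite -sqrf_eq0; apply/eqP; lra.
move: tpi; have [tp|tn] := ltP 0 t.
  rewrite gtr0_norm// => tpi.
  have : 0 < sin (t / 2) by apply: sin_gt0_pi; apply/andP; split; lra.
  by move=> /lt_eqF/[swap] ->; rewrite eqxx.
rewrite ler0_norm// => tpi.
have tn' : t < 0 by rewrite lt_neqAle t0.
have : 0 < sin (- (t / 2)) by apply: sin_gt0_pi; apply/andP; split; lra.
by rewrite sinN => /lt_eqF/[swap] ->; rewrite oppr0 eqxx.
Qed.

Lemma cis_2pi (k : nat) : cis (2 * pi * k%:R) = 1.
Proof.
rewrite mulrC cisX (_ : cis (2 * pi) = 1) ?expr1n//.
by rewrite /cis mulr_natl cos2pi sin2pi.
Qed.

Lemma cisN_eq1 (t : R) : cis t = 1 -> cis (- t) = 1.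
Proof. by move=> H; have := cisD t (- t); rewrite subrr cis0 H mul1r. Qed.

Lemma geometric_cis (Q : nat) (t : R) : t != 0 -> `|t| < 2 * pi ->
  cis (Q%:R * t) = 1 -> \sum_(k < Q) cis (k%:R * t) = 0.
Proof.
move=> t0 tpi HQ; have := subrX1 (cis t) Q.
rewrite -cisX HQ subrr => /esym/eqP; rewrite mulf_eq0 subr_eq0 (negbTE (cis_neq1 t0 tpi))/=.
by move=> /eqP H; rewrite -[RHS]H; apply: eq_bigr => k _; rewrite cisX.
Qed.

Lemma sin_ge_half (y : R) : 0 <= y <= pi / 2 -> y / 2 <= sin y.
Proof.
move=> /andP[y0 ypi]; have p0 := pi_gt0 R.
have ms (z : R) : 0 <= z <= pi -> z * cos z <= sin z.
  move=> /andP[z0 zpi].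
  have cs (a b : R) : {within `[a, b], continuous (@sin R)}.
    exact/continuous_subspaceT/continuous_sin.
  have [c cin] := MVT_segment z0 (fun r _ => is_derive_sin r) (cs _ _).
  rewrite sin0 !subr0 => ->; rewrite mulrC ler_wpM2r//.
  move: cin; rewrite in_itv/= => /andP[c0 cz].
  by rewrite leNgt ltr_cos ?in_itv/= -?leNgt ?c0 ?z0//= (le_trans cz).
have h : y / 2 * cos (y / 2) <= sin (y / 2) by apply: ms; apply/andP; split; lra.
have c0 : 0 <= cos (y / 2) by apply: cos_ge0_pihalf; apply/andP; split; lra.
have c1 : 1 / 2 <= cos (y / 2) ^+ 2.
  have : 0 <= cos y by apply: cos_ge0_pihalf; apply/andP; split; lra.
  by rewrite cos_half; have := cos2Dsin2 (y / 2); lra.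
rewrite {2}(splitr y) sinD.
have := ler_wpM2r c0 h; move: (sin (y / 2)) (cos (y / 2)) c0 c1 => s c c0 c1 h'.
have : 0 <= y / 2 * (c ^+ 2 - 1 / 2) by rewrite mulr_ge0//; lra.
by move: h'; rewrite mulrBr expr2; lra.
Qed.

(** As Re (e^{it} - 1) <= 0 with t = x / q, the terms do not cancel: the squared modulus is 1 + 4 (q
    + q^2) sin^2(t/2), and |sin(t/2)| >= |t| / 4 for |t| <= pi. *)
Lemma symbol_ge (q x : R) : 0 < q -> `|x| <= pi * q ->
  (1 + `|x|) / 4 <= nrm (1 - q%:C * (cis (x / q) - 1)).
Proof.
move=> q0 xq; have p0 := pi_gt0 R; pose t := x / q.
have th : `|t| / 4 <= `|sin (t / 2)|.
  have tp : `|t| <= pi by rewrite normrM normfV (gtr0_norm q0) ler_pdivrMr.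
  have [t0|t0] := leP 0 t.
    rewrite ger0_norm// in tp *.
    apply: le_trans (ler_norm _); apply: le_trans (sin_ge_half _); first by lra.
    by apply/andP; split; lra.
  rewrite ltr0_norm// in tp *.
  rewrite -normrN -sinN; apply: le_trans (ler_norm _).
  apply: le_trans (sin_ge_half _); first by lra.
  by apply/andP; split; lra.
have xt : `|x| = q * `|t|.
  by rewrite normrM normfV (gtr0_norm q0) mulrCA divff ?mulr1// gt_eqF.
rewrite -/t (_ : 1 - q%:C * (cis t - 1) = (1 - q * (cos t - 1)) +i* (- (q * sin t))); last first.
  by apply/eqP; rewrite eq_complex/= !mul0r subr0 addr0 oppr0 addr0 add0r !eqxx.
rewrite rnorm_complex -[leLHS]ger0_norm; last by rewrite divr_ge0// addr_ge0.
rewrite -sqrtr_sqr ler_wsqrtr//.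
have E : (1 - q * (cos t - 1)) ^+ 2 + (- (q * sin t)) ^+ 2 =
    1 + 4 * q * sin (t / 2) ^+ 2 + 4 * (q * sin (t / 2)) ^+ 2.
  have -> : (- (q * sin t)) ^+ 2 = q ^+ 2 * (1 - cos t ^+ 2).
    by rewrite -(cos2Dsin2 t); ring.
  by rewrite cos_half; ring.
rewrite E xt; have := ler_wpM2l (ltW q0) th.
have -> : (q * sin (t / 2)) ^+ 2 = (q * `|sin (t / 2)|) ^+ 2.
  by rewrite !exprMn real_normK// num_real.
have : 0 <= 4 * q * sin (t / 2) ^+ 2 by rewrite mulr_ge0 ?sqr_ge0// mulr_ge0// ltW.
have : 0 <= q * `|t| by rewrite mulr_ge0// ltW.
rewrite [q * (`|t| / 4)]mulrA.
move: (4 * q * _) (q * `|t|) (q * `|sin _|) => A B C A0 B0 BC.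
have : 0 <= (C - B / 4) * (C + B / 4) by rewrite mulr_ge0//; lra.
by have := sqr_ge0 (1 - B); nra.
Qed.

Variables (q : nat).
Hypothesis q_gt0 : (0 < q)%N.
Local Notation Q := (2 * q ^ 2)%N.

Let qR : 0 < q%:R :> R. Proof. by rewrite ltr0n. Qed.

(** The 2q^2 nodes of mesh 1/q in [-q, q): as q grows the grid becomes both finer and wider. Since
    the period is 2q, the dual frequencies are pi times the same nodes. *)
Definition rep (k : 'I_Q) : R := (k%:R - (q ^ 2)%:R) / q%:R.

Lemma abs_rep_le k : `|rep k| <= q%:R.
Proof.
rewrite normrM normfV (gtr0_norm qR) ler_pdivrMr// -natrM mulnn.
rewrite ler_distl subrr ler0n -natrD addnn -mul2n ler_nat.
exact/ltnW/ltn_ord.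
Qed.

(** Comparison with the integral of 1/(1 + y^2), written as a telescoping sum of arctangents. The
    factor 3 absorbs the variation of 1 + y^2 over a cell of length at most 1. *)
Lemma lattice_sum : \sum_(k < Q) (1 + rep k ^+ 2)^-1 <= 3 * pi * q%:R.
Proof.
pose F (k : nat) : R := atan ((k%:R - (q ^ 2)%:R) / q%:R).
have H (k : 'I_Q) : (1 + rep k ^+ 2)^-1 <= 3 * q%:R * (F k.+1 - F k).
  pose b := rep k + q%:R^-1; have -> : F k.+1 = atan b.
    by rewrite /F -(natr1 k) /b /rep; congr atan; ring.
  have qi : 0 < q%:R^-1 :> R by rewrite invr_gt0.
  have qi1 : q%:R^-1 <= 1 :> R by rewrite invf_le1// ler1n.
  have kb : rep k <= b by rewrite lerDl ltW.
  have ca (x y : R) : {within `[x, y], continuous (@atan R)}.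
    by apply: continuous_subspaceT => z; exact: continuous_atan.
  have [c cin] := MVT_segment kb (fun r _ => is_derive1_atan r) (ca _ _).
  rewrite -/(rep k) => ->; move: cin; rewrite in_itv/= => /andP[c0 c1].
  have -> : 3 * q%:R * ((1 + c ^+ 2)^-1 * (b - rep k)) = 3 * (1 + c ^+ 2)^-1.
    have p2 : 0 < 1 + c ^+ 2 by rewrite ltr_pwDl// sqr_ge0.
    by rewrite /b; field; rewrite !gt_eqF.
  rewrite /b in c1.
  have p1 : 0 < 1 + rep k ^+ 2 by rewrite ltr_pwDl// sqr_ge0.
  have p2 : 0 < 1 + c ^+ 2 by rewrite ltr_pwDl// sqr_ge0.
  rewrite -[leLHS]mul1r ler_pdivrMr// mulrAC ler_pdivlMr// mul1r.
  move: c0 c1 qi qi1; move: (rep k) (q%:R^-1) => r i c0 c1 i0 i1.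
  have : 0 <= (1 - (c - r)) * (1 + (c - r)) by rewrite mulr_ge0//; lra.
  by have := sqr_ge0 (r - (c - r)); nra.
apply: (le_trans (ler_sum _ (fun k _ => H k))).
rewrite -mulr_sumr -(big_mkord xpredT (fun k => F k.+1 - F k)) telescope_sumr//.
rewrite mulrAC ler_wpM2r// ler_wpM2l//.
have := atan_ltpi2 ((Q%:R - (q ^ 2)%:R) / q%:R : R).
have := atan_gtNpi2 ((0%:R - (q ^ 2)%:R) / q%:R : R).
by rewrite /F; lra.
Qed.

(** Up to a phase this is a geometric sum of powers of e^{it}, t = pi (k - l) / q^2, with Qt a
    multiple of 2 pi; for k and l distinct 0 < |t| < 2 pi, because |k - l| < 2q^2. *)
Lemma cis_orthogonal (k l : 'I_Q) :
  \sum_(m < Q) cis (pi * rep m * (rep k - rep l)) = if k == l then Q%:R else 0.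
Proof.
have [->|kl] := eqVneq.
  under eq_bigr do rewrite subrr mulr0 cis0.
  by rewrite sumr_const card_ord.
pose d : R := k%:R - l%:R; pose t := pi * d / (q ^ 2)%:R.
have q2 : 0 < (q ^ 2)%:R :> R by rewrite ltr0n expn_gt0 q_gt0.
have E (m : 'I_Q) : cis (pi * rep m * (rep k - rep l)) = cis (m%:R * t) * cis (- (pi * d)).
  rewrite -cisD; congr cis; rewrite /rep /t /d natrX; field.
  by rewrite gt_eqF.
under eq_bigr do rewrite E.
have d0 : d != 0 by rewrite subr_eq0 eqr_nat.
have p0 := pi_gt0 R.
rewrite -mulr_suml geometric_cis ?mul0r//.
- by rewrite /t !mulf_neq0// ?invr_eq0 gt_eqF.
- rewrite /t !normrM normfV (gtr0_norm p0) (gtr0_norm q2) -mulrA mulrC ltr_pM2r//.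
  rewrite ltr_pdivrMr// -natrM ltr_distl.
  have kQ : (k%:R : R) < Q%:R by rewrite ltr_nat.
  have lQ : (l%:R : R) < Q%:R by rewrite ltr_nat.
  by have := ler0n R k; have := ler0n R l; lra.
have -> : Q%:R * t = 2 * pi * k%:R + - (2 * pi * l%:R).
  by rewrite /t /d natrM; field; rewrite gt_eqF.
by rewrite cisD cis_2pi (cisN_eq1 (cis_2pi l)) mul1r.
Qed.

End Dft.

(** * Discrete Fourier transform on an n-dimensional grid *)

Section DftVector.
Context (R : realType) (n : nat).
Implicit Types (f : 'rV[R]_n -> R) (u v x : 'rV[R]_n).
Local Notation e_ j := (delta_mx 0 j : 'rV[R]_n).
Local Notation nrm z := (rnorm (z : R[i]^o)).

Lemma partials_ecosine_le x (c : R) s u :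
  `|partials s (fun u => cos (dotr x u + c)) u| <= (1 + enorm x) ^+ size s.
Proof.
rewrite cos_shiftE -[leRHS]mulr1; exact: (partials_dotr_le (tower_cos c) (cos_max _)).
Qed.

Lemma ge1_prod (I : Type) (r : seq I) (F : I -> R) : (forall i, 0 <= F i) ->
  1 + \sum_(i <- r) F i <= \prod_(i <- r) (1 + F i).
Proof.
move=> F0; elim: r => [|i r IH]; first by rewrite !big_nil addr0.
rewrite !big_cons; have := ler_wpM2l (addr_ge0 ler01 (F0 i)) IH.
have : 0 <= F i * \sum_(j <- r) F j by rewrite mulr_ge0// sumr_ge0.
move: (\sum_(j <- r) _) (\prod_(j <- r) _) (F i) => a b c; nra.
Qed.

Section Grid.
Variables (q : nat).
Hypothesis q_gt0 : (0 < q)%N.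
Local Notation Q := (2 * q ^ 2)%N.
Local Notation index := {ffun 'I_n -> 'I_Q}.
Implicit Types (g m : index).

Let qR : 0 < q%:R :> R. Proof. by rewrite ltr0n. Qed.
Let QR : 0 < Q%:R :> R. Proof. by rewrite ltr0n muln_gt0/= expn_gt0 q_gt0. Qed.

Definition grid g : 'rV[R]_n := \row_j rep R (g j).
Definition freq m : 'rV[R]_n := pi *: grid m.

Lemma grid_orthogonal g g0 :
  \sum_(m : index) cis (dotr (freq m) (grid g0 - grid g)) = if g == g0 then (Q ^ n)%:R else 0.
Proof.
have -> : \sum_(m : index) cis (dotr (freq m) (grid g0 - grid g)) =
    \prod_j \sum_(k < Q) cis (pi * rep R k * (rep R (g0 j) - rep R (g j))).
  rewrite bigA_distr_bigA; apply: eq_bigr => m _.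
  by rewrite /dotr cis_sum; apply: eq_bigr => j _; rewrite !mxE.
have [->|/eqP gg] := eqVneq g g0.
  under eq_bigr do rewrite cis_orthogonal// eqxx.
  by rewrite prodr_const card_ord -natrX.
have [j /eqP gj] : exists j, g j <> g0 j.
  by apply/existsNP => H; apply: gg; apply/ffunP.
by rewrite (bigD1 j)//= cis_orthogonal// eq_sym (negbTE gj) mul0r.
Qed.

Definition dsum f m : R[i] := \sum_(g : index) (f (grid g))%:C * cis (- dotr (freq m) (grid g)).
Definition dcoef f m : R[i] := ((Q ^ n)%:R^-1)%:C * dsum f m.
(** Real part of the interpolating trigonometric sum, expanded in cosines with phases 0 and -pi/2,
    the form to which [cone_ecos] applies term by term. *)
Definition dft f u : R := \sum_(m : index) (complex.Re (dcoef f m) * cos (dotr (freq m) u + 0) +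
  - complex.Im (dcoef f m) * cos (dotr (freq m) u + - (pi / 2))).

Lemma dft_Re f u : dft f u = complex.Re (\sum_(m : index) dcoef f m * cis (dotr (freq m) u)).
Proof.
rewrite raddf_sum/=; apply: eq_bigr => m _.
by rewrite addr0 cosBpihalf /cis; case: (dcoef f m) => a b /=; rewrite mulNr.
Qed.

Lemma dft_grid f g : dft f (grid g) = f (grid g).
Proof.
rewrite dft_Re /dcoef /dsum.
have -> : \sum_(m : index) ((Q ^ n)%:R^-1)%:C * (\sum_(g1 : index) (f (grid g1))%:C *
    cis (- dotr (freq m) (grid g1))) * cis (dotr (freq m) (grid g)) =
    \sum_(g1 : index) ((Q ^ n)%:R^-1 * f (grid g1))%:C *
      \sum_(m : index) cis (dotr (freq m) (grid g - grid g1)).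
  under eq_bigr do rewrite mulr_sumr mulr_suml.
  rewrite exchange_big; apply: eq_bigr => g1 _; rewrite mulr_sumr; apply: eq_bigr => m _.
  rewrite dotrDr -[- grid g1]scaleN1r dotrZr mulN1r addrC cisD rmorphM/=; ring.
rewrite (bigD1 g)//= grid_orthogonal eqxx big1 ?addr0; last first.
  by move=> g1 /negbTE g1g; rewrite grid_orthogonal g1g mulr0.
rewrite -(rmorph_nat (real_complex R)) -rmorphM/= mulrAC mulVf ?mul1r//.
by rewrite natrX expf_neq0// gt_eqF.
Qed.

(** Reindexing by a cyclic shift of the j-th index. At the wrap-around the two nodes involved have
    j-th coordinate q and -q, where f vanishes. *)
Lemma dsum_translate f j m : boxsupp q%:R f ->
  dsum (fun u => f (q%:R^-1 *: e_ j + u)) m = cis (freq m 0 j / q%:R) * dsum f m.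
Proof.
move=> sf; pose next g : index := [ffun l => if l == j then ordS (g l) else g l].
have next_inj : injective next.
  move=> g g' /ffunP H; apply/ffunP => l; have := H l; rewrite !ffunE.
  by case: (l == j) => // /ordS_inj.
rewrite /dsum mulr_sumr [RHS](reindex_inj next_inj)/=; apply: eq_bigr => g _.
have [gQ|gQ] := ltnP (g j).+1 Q.
  have E : grid (next g) = q%:R^-1 *: e_ j + grid g.
    apply/rowP => l; rewrite !mxE ffunE eqxx/=.
    have [->|_] := eqVneq l j; last by rewrite mulr0 add0r.
    by rewrite /rep /= modn_small// -natr1; ring.
  rewrite E mulrCA; congr (_ * _); rewrite -cisD dotrDr dotrZr dotr_delta.
  by congr cis; ring.
have gE : (g j).+1 = Q by apply/eqP; rewrite eqn_leq gQ ltn_ord.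
have Q2 : Q%:R = 2 * q%:R ^+ 2 :> R by rewrite natrM natrX.
rewrite (sf _ j); last first.
  rewrite !mxE !eqxx/= /rep mulr1.
  have gR : (g j : nat)%:R = Q%:R - 1 :> R by apply/eqP; rewrite eq_sym subr_eq natr1 gE.
  rewrite gR (_ : q%:R^-1 + _ = q%:R) ?ger0_norm//.
  by rewrite Q2 natrX; field; rewrite gt_eqF.
rewrite (sf _ j) ?mul0r ?mulr0//.
rewrite !mxE ffunE eqxx /rep /= gE modnn sub0r natrX mulNr expr2 mulfK ?gt_eqF//.
by rewrite normrN ger0_norm.
Qed.

Definition symbol j m : R[i] := 1 - q%:R%:C * (cis (freq m 0 j / q%:R) - 1).

Lemma dsum_theta f j m : boxsupp q%:R f ->
  dsum (theta q%:R j f) m = symbol j m * dsum f m.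
Proof.
move=> sf; have := dsum_translate j m sf; rewrite /dsum /theta /symbol => E.
have -> : \sum_(g : index) (f (grid g) - q%:R * (f (q%:R^-1 *: e_ j + grid g) - f (grid g)))%:C *
      cis (- dotr (freq m) (grid g)) =
    (1 + q%:R%:C) * (\sum_(g : index) (f (grid g))%:C * cis (- dotr (freq m) (grid g))) -
    q%:R%:C * (\sum_(g : index) (f (q%:R^-1 *: e_ j + grid g))%:C * cis (- dotr (freq m) (grid g))).
  rewrite !mulr_sumr -sumrB; apply: eq_bigr => g _.
  by rewrite !(rmorphB, rmorphM)/=; ring.
by rewrite E; ring.
Qed.

Lemma dsum_thetas f s m (r : R) : boxsupp r f -> r + (size s)%:R <= q%:R ->
  dsum (thetas q%:R s f) m = (\prod_(j <- s) symbol j m) * dsum f m.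
Proof.
move=> sf; elim: s => [|j s IH] /= rq; first by rewrite big_nil mul1r.
have rq' : r + (size s)%:R <= q%:R by rewrite (le_trans _ rq)// lerD2l ler_nat.
rewrite dsum_theta; first by rewrite IH// big_cons mulrA.
by apply: boxsuppW rq' _; apply: boxsupp_thetas sf; rewrite ler1n.
Qed.

Lemma symbol_lower j m : (1 + `|freq m 0 j|) / 4 <= nrm (symbol j m).
Proof.
apply: symbol_ge => //; rewrite !mxE normrM (ger0_norm (pi_ge0 R)).
by rewrite ler_wpM2l ?pi_ge0// abs_rep_le.
Qed.

Lemma lattice_sum_prod :
  \sum_(g : index) \prod_j (1 + rep R (g j) ^+ 2)^-1 <= (3 * pi * q%:R) ^+ n.
Proof.
rewrite -(bigA_distr_bigA (fun (j : 'I_n) (k : 'I_Q) => (1 + rep R k ^+ 2)^-1)).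
rewrite prodr_const card_ord lerXn2r ?nnegrE//; last exact: lattice_sum.
  by apply: sumr_ge0 => k _; rewrite invr_ge0 addr_ge0// sqr_ge0.
by rewrite !mulr_ge0// pi_ge0.
Qed.

Lemma prod_sqr_le_enorm u : \prod_j (1 + u 0 j ^+ 2) <= (1 + enorm u) ^+ (2 * n).
Proof.
rewrite exprM -[X in _ ^+ X]card_ord -prodr_const; apply: ler_prod => j _.
rewrite addr_ge0 ?sqr_ge0//=.
have := abs_le_enorm u j; have := normr_ge0 (u 0 j).
rewrite -[u 0 j ^+ 2]real_normK ?num_real//; move: `|_| (enorm u) => a b; nra.
Qed.

(** M + 2 differences in each coordinate divide the coefficient by the product of ((1 +
    |x_j|)/4)^(M+2): M powers pay for the weight, the other two make the frequency sum converge.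
    That sum and the sum over nodes each cost 3 pi q per coordinate, and the normalisation 1/(2q^2)
    turns their product into 9 pi^2 / 2, free of q. *)
Lemma dcoef_sum_le f (M N : nat) (A r : R) (s : seq 'I_n) :
  s = flatten (nseq M.+2 (enum 'I_n)) -> N = (2 * n + size s)%N ->
  smooth f -> boxsupp r f -> r + (size s)%:R <= q%:R ->
  wsup N f A ->
  \sum_(m : index) nrm (dcoef f m) * (1 + enorm (freq m)) ^+ M <=
  (1 + n.+2%:R ^+ N) ^+ size s * (9 / 2 * pi ^+ 2 * 4 ^+ M.+2) ^+ n * A.
Proof.
move=> sE NE sf bf rq HA.
have q1 : 1 <= q%:R :> R by rewrite ler1n.
have W : wsup (2 * n) (thetas q%:R s f) ((1 + n.+2%:R ^+ N) ^+ size s * A).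
  by apply: wsup_thetas => //; rewrite -NE.
have [B BE] : exists B : R, B = (1 + n.+2%:R ^+ N) ^+ size s * A by eexists.
rewrite -BE in W; have B0 := wsup_ge0 W.
have p0 (u : 'rV[R]_n) : 0 < \prod_j (1 + u 0 j ^+ 2).
  by apply: prodr_gt0 => j _; rewrite ltr_pwDl// sqr_ge0.
have S m : nrm (dsum (thetas q%:R s f) m) <= B * (3 * pi * q%:R) ^+ n.
  apply: (le_trans (nrm_sum _ _)).
  apply: (@le_trans _ _ (\sum_(g : index) B * \prod_j (1 + rep R (g j) ^+ 2)^-1)); last first.
    by rewrite -mulr_sumr ler_wpM2l// lattice_sum_prod.
  apply: ler_sum => g _; rewrite nrmM nrm_cis mulr1 rnorm_real.
  have := wsup_pt (s := [::]) (grid g) W (leq0n _) => /= /le_trans; apply.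
  rewrite ler_wpM2l// prodfV lef_pV2 ?posrE ?exprn_gt0 ?gt0_enorm//.
    apply: le_trans (prod_sqr_le_enorm (grid g)).
    by apply: eq_lerW; apply: eq_bigr => j _; rewrite mxE.
  by have := p0 (grid g); under eq_bigr do rewrite mxE.
have prodE m : \prod_(j <- s) symbol j m = \prod_j symbol j m ^+ M.+2.
  rewrite sE prodrXl; elim: (M.+2) => [|k IH]; first by rewrite big_nil.
  by rewrite /= big_cat/= IH exprS big_enum.
have K m : nrm (dcoef f m) * (1 + enorm (freq m)) ^+ M <=
    (Q ^ n)%:R^-1 * (B * (3 * pi * q%:R) ^+ n) *
      \prod_j (4 ^+ M.+2 * (1 + rep R (m j) ^+ 2)^-1).
  have y0 j : 0 < 1 + `|freq m 0 j| by rewrite ltr_pwDl.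
  have nu : \prod_j ((1 + `|freq m 0 j|) / 4) ^+ M.+2 <= nrm (\prod_(j <- s) symbol j m).
    rewrite prodE nrm_prod; apply: ler_prod => j _.
    rewrite exprn_ge0 ?divr_ge0 ?(ltW (y0 j))//=.
    have -> : nrm (symbol j m ^+ M.+2) = nrm (symbol j m) ^+ M.+2.
      by elim: (M.+2) => [|k IH]; [exact: nrm1|rewrite !exprS nrmM IH].
    by rewrite lerXn2r ?nnegrE ?rnorm_ge0 ?divr_ge0 ?(ltW (y0 j))// symbol_lower.
  have eM : (1 + enorm (freq m)) ^+ M <= \prod_j (1 + `|freq m 0 j|) ^+ M.
    rewrite prodrXl lerXn2r ?nnegrE ?(ltW (gt0_enorm _))//.
      by apply: prodr_ge0 => j _; exact: ltW.
    apply: le_trans (ge1_prod _ (fun j => normr_ge0 (freq m 0 j))).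
    by rewrite lerD2l enorm_le_sum.
  have D : nrm (dsum f m) * \prod_j ((1 + `|freq m 0 j|) / 4) ^+ M.+2 <= B * (3 * pi * q%:R) ^+ n.
    apply: le_trans (S m); rewrite (dsum_thetas _ bf rq) nrmM mulrC.
    by rewrite ler_wpM2r// rnorm_ge0.
  have P0 : 0 < \prod_j ((1 + `|freq m 0 j|) / 4) ^+ M.+2.
    by apply: prodr_gt0 => j _; rewrite exprn_gt0// divr_gt0.
  rewrite -ler_pdivlMr// in D.
  have Q0 : 0 <= (Q ^ n)%:R^-1 :> R by rewrite invr_ge0.
  rewrite /dcoef nrmM rnorm_real (ger0_norm Q0) -!mulrA ler_wpM2l//.
  apply: (@le_trans _ _ (B * (3 * pi * q%:R) ^+ n /
     \prod_j ((1 + `|freq m 0 j|) / 4) ^+ M.+2 * \prod_j (1 + `|freq m 0 j|) ^+ M)).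
    by apply: ler_pM => //; rewrite ?rnorm_ge0// exprn_ge0// ltW// gt0_enorm.
  rewrite -!mulrA ler_wpM2l// ler_wpM2l ?exprn_ge0 ?mulr_ge0 ?pi_ge0//.
  rewrite -prodfV -big_split/=; apply: ler_prod => j _; apply/andP; split.
    by rewrite mulr_ge0 ?invr_ge0 ?exprn_ge0 ?divr_ge0 ?(ltW (y0 j)).
  have -> : (((1 + `|freq m 0 j|) / 4) ^+ M.+2)^-1 * (1 + `|freq m 0 j|) ^+ M =
      4 ^+ M.+2 * ((1 + `|freq m 0 j|) ^+ 2)^-1.
    by rewrite expr_div_n -addn2 !exprD; field; rewrite !gt_eqF.
  rewrite ler_wpM2l ?exprn_ge0// lef_pV2 ?posrE ?exprn_gt0//; last first.
    by rewrite ltr_pwDl// sqr_ge0.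
  rewrite !mxE normrM (ger0_norm (pi_ge0 R)) -[rep R (m j) ^+ 2]real_normK ?num_real//.
  have := pi_ge2 R; have := normr_ge0 (rep R (m j)); move: `|_| (pi : R) => a p a0 p2.
  have : a <= p * a by rewrite ler_peMl//; lra.
  by move: (p * a) => X aX; nra.
apply: (le_trans (ler_sum _ (fun m _ => K m))).
rewrite -mulr_sumr.
under eq_bigr do rewrite big_split/= prodr_const card_ord.
rewrite -mulr_sumr.
set Z := \sum_(i : index) _; have Z1 : Z <= (3 * pi * q%:R) ^+ n := lattice_sum_prod.
apply: (@le_trans _ _ ((Q ^ n)%:R^-1 * (B * (3 * pi * q%:R) ^+ n) *
   ((4 ^+ M.+2) ^+ n * (3 * pi * q%:R) ^+ n))).
  rewrite ler_wpM2l// ?ler_wpM2l ?exprn_ge0//.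
  by rewrite mulr_ge0 ?invr_ge0// mulr_ge0// exprn_ge0// !mulr_ge0// pi_ge0.
rewrite BE; apply: eq_lerW.
move: ((1 + n.+2%:R ^+ N) ^+ size s) => c.
have -> : (9 / 2 * pi ^+ 2 * 4 ^+ M.+2) =
    (Q%:R)^-1 * (3 * pi * q%:R) * (3 * pi * q%:R) * 4 ^+ M.+2 :> R.
  by rewrite natrM natrX; field; rewrite gt_eqF.
rewrite natrX; move: (3 * pi * q%:R) (4 ^+ M.+2) (Q%:R) => a b e.
by rewrite !exprMn exprVn; ring.
Qed.

End Grid.
End DftVector.

(** * Approximation by interpolants on refined grids *)

Section TrigApprox.
Context (R : realType) (n : nat).
Implicit Types (f psi : 'rV[R]_n -> R) (u v x : 'rV[R]_n) (q : nat).
Local Notation e_ j := (delta_mx 0 j : 'rV[R]_n).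
Local Notation nrm z := (rnorm (z : R[i]^o)).
Local Notation index q := {ffun 'I_n -> 'I_(2 * q ^ 2)}.

Definition dcoef_norm q f (M : nat) : R :=
  \sum_(m : index q) nrm (dcoef f m) * (1 + enorm (freq R m)) ^+ M.

Lemma dcoef_norm_ge0 q f M : 0 <= dcoef_norm q f M.
Proof.
apply: sumr_ge0 => m _; rewrite mulr_ge0 ?rnorm_ge0//.
exact: exprn_ge0 (ltW (gt0_enorm _)).
Qed.

Lemma smooth_dft q f : smooth (dft q f).
Proof.
apply: smooth_sum => m; apply: smoothD; apply: smoothZ; exact: smooth_cos_dotr.
Qed.

Lemma partials_dft_le q f (M : nat) s u : (size s <= M)%N ->
  `|partials s (dft q f) u| <= 2 * dcoef_norm q f M.
Proof.
move=> sM; rewrite /dft partials_sum; last first.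
  by move=> m; apply: smoothD; apply: smoothZ; exact: smooth_cos_dotr.
rewrite (le_trans (ler_norm_sum _ _ _))// mulr_sumr; apply: ler_sum => m _.
have sc c : smooth (fun u => cos (dotr (freq R m) u + c)) := smooth_cos_dotr _ _.
rewrite (partialsD s (smoothZ _ (sc _)) (smoothZ _ (sc _))) !(partialsZ s _ (sc _)).
have E : (1 + enorm (freq R m)) ^+ size s <= (1 + enorm (freq R m)) ^+ M.
  by rewrite ler_weXn2l// ge1_enorm.
have H c := le_trans (partials_ecosine_le (freq R m) c s u) E.
rewrite (le_trans (ler_normD _ _))// !normrM normrN mulr_natl mulr2n.
have p0 := rnorm_ge0 (dcoef f m : R[i]^o).
by rewrite lerD// ler_pM// ?abs_Re_le ?abs_Im_le.
Qed.

Lemma exists_near_grid q (r : R) u : (0 < q)%N -> r + 1 <= q%:R -> inbox r u ->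
  exists g : index q, inbox q%:R^-1 (u - grid R g).
Proof.
move=> q0 rq ur; have qR : 0 < q%:R :> R by rewrite ltr0n.
have H j : 0 <= q%:R * u 0 j + (q ^ 2)%:R < (2 * q ^ 2)%:R.
  have := ur j; rewrite ler_norml => /andP[h1 h2].
  rewrite natrM natrX; move: (q%:R : R) (u 0 j) qR rq h1 h2 => a b a0 ra h1 h2.
  have : 0 <= a * (a - 1 - b) by rewrite mulr_ge0 ?(ltW a0)//; lra.
  have : 0 <= a * (b + a - 1) by rewrite mulr_ge0 ?(ltW a0)//; lra.
  by move=> k1 k2; apply/andP; split; nra.
pose k j := Num.truncn (q%:R * u 0 j + (q ^ 2)%:R).
have kP j : (k j)%:R <= q%:R * u 0 j + (q ^ 2)%:R < (k j).+1%:R.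
  by apply: truncn_itv; have /andP[] := H j.
have kQ j : (k j < 2 * q ^ 2)%N.
  rewrite -(ltr_nat R); have /andP[h1 _] := kP j; have /andP[_ h2] := H j.
  exact: le_lt_trans h1 h2.
exists [ffun j => Ordinal (kQ j)] => j; rewrite !mxE ffunE /rep /=.
have -> : u 0 j - ((k j)%:R - (q ^ 2)%:R) / q%:R =
    (q%:R * u 0 j + (q ^ 2)%:R - (k j)%:R) / q%:R by field; rewrite gt_eqF.
rewrite normrM normfV (gtr0_norm qR) ler_piMl ?invr_ge0 ?(ltW qR)//.
have := kP j; rewrite -(natr1 (k j)) => /andP[h1 h2].
by rewrite ger0_norm; lra.
Qed.

(** The coefficient bound at order M is the one retained; at every other order it shows that the
    derivatives of the interpolants are uniformly bounded. The error then vanishes at the nodes, has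
    bounded gradient, and tends to 0 locally with the mesh. Only [q0] depends on psi and its
    support, not N and C. *)
Lemma trig_approx (M : nat) : exists N (C : R), 0 <= C /\
  forall (r : R) psi (B : R), rschw psi -> boxsupp r psi -> wsup N psi B ->
  exists q0 : nat,
   [/\ (0 < q0)%N, ubsm (fun i u => dft (i + q0) psi u - psi u),
       loc0 (fun i u => dft (i + q0) psi u - psi u) &
       forall i, dcoef_norm (i + q0) psi M <= C * B].
Proof.
pose s (M : nat) := flatten (nseq M.+2 (enum 'I_n)).
pose N M := (2 * n + size (s M))%N.
pose C M : R := (1 + n.+2%:R ^+ N M) ^+ size (s M) * (9 / 2 * pi ^+ 2 * 4 ^+ M.+2) ^+ n.
exists (N M), (C M); split.
  rewrite /C mulr_ge0 ?exprn_ge0 ?addr_ge0 ?exprn_ge0//.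
  by rewrite mulr_ge0 ?exprn_ge0// mulr_ge0 ?divr_ge0 ?exprn_ge0 ?pi_ge0.
move=> r psi B spsi bpsi WB; have [sm _] := spsi.
(* From this q on, the support enlarged by all the differences still fits in the grid. *)
pose t (M : nat) := (Num.bound `|r| + size (s M)).+1.
have tP M' q : (t M' <= q)%N -> r + (size (s M'))%:R <= q%:R.
  move=> tq; apply: (@le_trans _ _ (t M')%:R); last by rewrite ler_nat.
  rewrite /t -addSn natrD lerD2r (le_trans (ler_norm r))// (le_trans (ltW (archi_boundP _)))//.
  by rewrite ler_nat.
have K M' q B' : (t M' <= q)%N -> wsup (N M') psi B' -> dcoef_norm q psi M' <= C M' * B'.
  move=> tq W; have q0 : (0 < q)%N by rewrite (leq_trans _ tq).
  exact: (dcoef_sum_le q0 erefl erefl sm bpsi (tP _ _ tq) W).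
pose g i u := dft (i + t M) psi u - psi u.
have gE i : g i = fun u => dft (i + t M) psi u + (-1) * psi u.
  by apply/funext => u; rewrite mulN1r.
have ug : ubsm g.
  split=> [i|N'].
    by rewrite gE; apply: smoothD; [exact: smooth_dft|exact: smoothZ].
  have [_ /(_ (N N'))[B' W']] := spsi; have [_ /(_ N')[A WA]] := spsi.
  (* The finitely many grids too coarse for the bound at order N' are added by hand. *)
  pose Z := C N' * B' + \sum_(i < t N') dcoef_norm (i + t M) psi N'.
  have CB0 : 0 <= C N' * B'.
    exact: le_trans (dcoef_norm_ge0 _ _ _) (K N' (t N') B' (leqnn _) W').
  have HZ i : dcoef_norm (i + t M) psi N' <= Z.
    have [ti|it] := leqP (t N') i.
      rewrite (le_trans (K N' _ B' (leq_trans ti (leq_addr _ _)) W'))//.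
      by rewrite lerDl sumr_ge0// => k _; exact: dcoef_norm_ge0.
    rewrite /Z (bigD1 (Ordinal it))//= addrCA lerDl addr_ge0// sumr_ge0// => k _.
    exact: dcoef_norm_ge0.
  exists (2 * Z + A) => i s' x sN'; rewrite gE partialsD//; last 2 first.
  - exact: smooth_dft.
  - exact: smoothZ.
  rewrite (le_trans (ler_normD _ _))// lerD//.
    by rewrite (le_trans (partials_dft_le _ _ _ sN'))// ler_wpM2l.
  rewrite partialsZ// normrM normrN1 mul1r (le_trans (wsup_pt x WA sN'))//.
  by rewrite ler_pdivrMr ?exprn_gt0 ?gt0_enorm// ler_peMr ?(wsup_ge0 WA)// exprn_ege1// ge1_enorm.
exists (t M); split=> //; last by move=> i; apply: K => //; exact: leq_addl.
move=> r' e e0; have [sg /(_ 1%N)[D HD]] := ug.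
have D0 : 0 <= D by exact: le_trans (HD 0%N [::] 0 isT).
(* Makes n D / q <= e and lets the grid cover the box with a margin of one unit. *)
pose I := Num.bound (`|r'| + 1 + n%:R * D / e).
have Z0 : 0 <= n%:R * D / e by rewrite divr_ge0 ?mulr_ge0// ltW.
exists I => i iI x xr.
have q0 : (0 < i + t M)%N by rewrite addnS.
have qR : 0 < (i + t M)%:R :> R by rewrite ltr0n.
have qI : `|r'| + 1 + n%:R * D / e <= (i + t M)%:R.
  rewrite (le_trans (ltW (archi_boundP _)))//; first by rewrite !addr_ge0.
  by rewrite ler_nat (leq_trans iI)// leq_addr.
have rq : r' + 1 <= (i + t M)%:R.
  by rewrite (le_trans _ qI)// -addrA [leRHS]addrA ler_wpDr// lerD2r ler_norm.
have [gg Hg] := exists_near_grid q0 rq xr.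
have -> : dft (i + t M) psi x - psi x = g i x - g i (grid R gg).
  by rewrite /g dft_grid// subrr subr0.
rewrite (le_trans (inbox_lipschitz (sg i) D0 (fun j x => HD i [:: j] x isT) Hg))//.
have : n%:R * D / e <= (i + t M)%:R by rewrite (le_trans _ qI)// lerDr addr_ge0.
by rewrite ler_pdivrMr// mulrA ler_pdivrMr// [_ * e]mulrC.
Qed.

End TrigApprox.

(** * From the tube bound to quasiasymptotic boundedness *)

Section CompactSupport.
Context (R : realType) (n : nat).
Implicit Types (f : 'rV[R]_n -> R) (u x : 'rV[R]_n).

Lemma smooth_boxsupp_rschw f (r : R) : smooth f -> boxsupp r f -> rschw f.
Proof.
move=> sf bf; split=> // N.
have B s : exists B : R, forall x, inbox r x -> `|partials s f x| <= B.
  have cf := (sf s).1.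
  have := continuous_compact (continuous_subspaceT cf) (@compact_inbox R n r).
  move=> /compact_bounded [M [Mr HM]].
  exists (M + 1) => x xr; apply: (HM (M + 1)); first by rewrite ltrDl.
  by exists x.
have out s x : ~ inbox r x -> partials s f x = 0.
  apply: (partials_local0 (U := ~` inbox r)).
    apply: closed_openC; apply: compact_closed; [exact: norm_hausdorff|exact: compact_inbox].
  by move=> y /existsNP[j /negP]; rewrite -ltNge => /ltW; exact: bf.
have {B}[B HB] := choice B.
exists (\sum_(m < N.+1) \sum_(t : m.-tuple 'I_n) (1 + n%:R * `|r|) ^+ N * `|B t|) => s x sN.
have S0 (m : 'I_N.+1) : 0 <= \sum_(t : m.-tuple 'I_n) (1 + n%:R * `|r|) ^+ N * `|B t|.
  by apply: sumr_ge0 => t _; rewrite mulr_ge0// exprn_ge0// addr_ge0// mulr_ge0.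
have [xr|xr] := pselect (inbox r x); last first.
  by rewrite out// normr0 mulr0 sumr_ge0.
apply: (@le_trans _ _ ((1 + n%:R * `|r|) ^+ N * `|B s|)).
  apply: ler_pM => //; first exact: exprn_ge0 (ltW (gt0_enorm x)).
    rewrite lerXn2r ?nnegrE ?(ltW (gt0_enorm x)) ?addr_ge0 ?mulr_ge0// lerD2l.
    by rewrite (le_trans (enorm_le_box xr))// ler_wpM2l// ler_norm.
  by rewrite (le_trans (HB s x xr))// ler_norm.
rewrite (bigD1 (Ordinal (sN : (size s < N.+1)%N)))//= -[leLHS]addr0 lerD//.
  by rewrite (bigD1 (in_tuple s))//= lerDl sumr_ge0.
by apply: sumr_ge0 => m _; exact: S0.
Qed.

Lemma open_box (r : R) : open [set u : 'rV[R]_n | forall j, `|u 0 j| < r].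
Proof.
have H (l : seq 'I_n) : open [set u : 'rV[R]_n | forall j, j \in l -> `|u 0 j| < r].
  elim: l => [|i l IH].
    rewrite [X in open X](_ : _ = setT); first exact: openT.
    by apply/seteqP; split=> // u _ j; rewrite in_nil.
  rewrite [X in open X](_ : _ = ([set u | dotr (delta_mx 0 i) u < r] `&`
     [set u | - r < dotr (delta_mx 0 i) u]) `&`
     [set u : 'rV[R]_n | forall j, j \in l -> `|u 0 j| < r]).
    by apply: openI => //; apply: openI; [exact: open_dotr_lt|exact: open_dotr_gt].
  apply/seteqP; split=> u /=.
    move=> H; have := H i; rewrite mem_head ltr_norml dotrC dotr_delta => /(_ isT)/andP[h1 h2].
    by split=> // j jl; apply: H; rewrite in_cons jl orbT.
  rewrite dotrC dotr_delta => -[[h1 h2] H] j; rewrite in_cons => /orP[/eqP ->|]; last exact: H.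
  by rewrite ltr_norml h1 h2.
rewrite (_ : mkset _ = [set u : 'rV[R]_n | forall j, j \in enum 'I_n -> `|u 0 j| < r]) //.
by apply/seteqP; split=> u /= K j; [move=> _; exact: K|apply: K; rewrite mem_enum].
Qed.

Lemma cutoff_scale (r c : R) u : cutoff r (c *: u) = cutoff (r / c) u.
Proof.
apply: eq_bigr => j _; rewrite !dotr_scaled mxE invf_div; congr bump.
by rewrite mulrA [c / r]mulrC.
Qed.

End CompactSupport.

Section Sufficiency.
Context (R : realType) (n : nat) (E : completeNormedModType R[i]).
Variables (h : {linear schwartz R n -> E}) (Gamma : set 'rV[R]_n).
Hypothesis h_continuous : continuous h.
Hypothesis h_supported : supported_by Gamma h.
Hypothesis Gamma_cone : is_cone Gamma.
Variables (omega : 'rV[R]_n) (delta : R).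
Hypothesis delta_gt0 : 0 < delta.
Local Notation e_ j := (delta_mx 0 j : 'rV[R]_n).
Hypothesis delta_conj : forall j, conj_cone Gamma (omega + delta *: e_ j) /\
  conj_cone Gamma (omega - delta *: e_ j).
Local Notation F x t := (laplace Gamma h (ztube omega x t)).

Variables (ell : R -> R) (C0 e0 : R) (M : nat).
Hypothesis e0_le1 : e0 <= 1.
Hypothesis C0_ge0 : 0 <= C0.
Hypothesis ell_ge0 : forall e, 0 < e < e0 -> 0 <= ell e.
Hypothesis tube_bound : forall e s x, 0 < e < e0 -> 0 < s <= 1 ->
  rnorm (F (e *: x) (e * s)) <= C0 * ((1 + enorm x) / s) ^+ M * ell e.

Local Notation w s := (cone_ecos omega delta 0 s 0).

Lemma cone_expE s u : w s u = cone_cut omega delta u * expR (dotr (- (s *: omega)) u).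
Proof.
rewrite /cone_ecos /ecos addr0 [dotr 0 u](_ : _ = 0) ?cos0 ?mulr1//.
by rewrite /dotr big1// => j _; rewrite mxE mul0r.
Qed.

Lemma cone_exp_cos s x c u : w s u * cos (dotr x u + c) = cone_ecos omega delta x s c u.
Proof. by rewrite cone_expE /cone_ecos /ecos mulrA. Qed.

Lemma hr_cone_ecos_tube e s x c : 0 < e < e0 -> 0 < s <= 1 -> c = 0 \/ c = - (pi / 2) ->
  rnorm (hr h (fun u => cone_ecos omega delta x s c (e *: u))) <=
  2 * (C0 * ((1 + enorm x) / s) ^+ M * ell e).
Proof.
move=> ee s01 Hc; have /andP[ep e1] := ee; have /andP[s0 s1] := s01.
have e01 : 0 < e <= 1 by rewrite ep (le_trans (ltW e1)).
rewrite (hr_dil_cone_ecos h_continuous h_supported Gamma_cone delta_gt0 delta_conj)//.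
have es01 : 0 < e * s <= 1.
  by rewrite mulr_gt0//= mulr_ile1 ?(ltW ep) ?(ltW s0)//; case/andP: e01.
apply: (le_trans (hr_cone_ecos_le h_continuous h_supported delta_gt0 delta_conj _ es01 Hc)).
rewrite mulr_natl mulr2n lerD//; first exact: tube_bound.
rewrite -scalerN (le_trans (tube_bound (- x) ee s01))//.
by rewrite -[- x]scaleN1r enormZ normrN1 mul1r.
Qed.

(** The damping times each exponential of the interpolant is a cut-off exponential, controlled by
    the tube bound, and the weighted coefficient sum absorbs its growth in x. The constants do not
    depend on the support radius r, as summation over dyadic pieces requires. *)
Lemma hr_cone_exp_bound : exists N (C : R), 0 <= C /\
  forall e s r psi (B : R), 0 < e < e0 -> 0 < s <= 1 -> rschw psi -> boxsupp r psi ->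
    wsup N psi B ->
    rnorm (hr h (fun u => w s (e *: u) * psi (e *: u))) <= C * s ^- M * B * ell e.
Proof.
have [N [C1 [C10 HC1]]] := @trig_approx R n M.
exists N, (4 * (C0 * C1)); split; first by rewrite !mulr_ge0.
move=> e s r psi B ee s01 spsi bpsi W; have /andP[ep e1] := ee; have /andP[s0 s1] := s01.
have e01 : 0 < e <= 1 by rewrite ep (le_trans (ltW e1)).
have [q0 [q00 ug lg Hc]] := HC1 r psi B spsi bpsi W.
have sw := rschw_cone_ecos omega delta_gt0 0 0 s01.
have [K [D [D0 HD]]] := hr_dil_bound h_continuous.
have tw x c : rschw (fun u => cone_ecos omega delta x s c (e *: u)).
  exact: (rschw_dil e01 (rschw_cone_ecos omega delta_gt0 x c s01)).
have bdft q : rnorm (hr h (fun u => w s (e *: u) * dft q psi (e *: u))) <=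
    4 * (C0 * ell e) * s ^- M * dcoef_norm q psi M.
  have -> : (fun u => w s (e *: u) * dft q psi (e *: u)) = fun u =>
      \sum_(m : {ffun 'I_n -> 'I_(2 * q ^ 2)})
      (complex.Re (dcoef psi m) * cone_ecos omega delta (freq R m) s 0 (e *: u) +
      - complex.Im (dcoef psi m) * cone_ecos omega delta (freq R m) s (- (pi / 2)) (e *: u)).
    apply/funext => u; rewrite /dft mulr_sumr; apply: eq_bigr => m _.
    by rewrite mulrDr !(mulrCA (w s _)) !cone_exp_cos.
  rewrite hr_sum; last by move=> m; apply: rschwD; apply: rschwZ.
  rewrite (le_trans (rnorm_sum _ _))// /dcoef_norm mulr_sumr; apply: ler_sum => m _.
  rewrite hrD; try exact: rschwZ.
  rewrite !hrZ// (le_trans (ler_rnormD _ _))// !rnormZr normrN.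
  have h1 := hr_cone_ecos_tube (freq R m) ee s01 (or_introl erefl).
  have h2 := hr_cone_ecos_tube (freq R m) ee s01 (or_intror erefl).
  have a1 := abs_Re_le (dcoef psi m); have a2 := abs_Im_le (dcoef psi m).
  have k1 := ler_pM (normr_ge0 _) (rnorm_ge0 _) a1 h1.
  have k2 := ler_pM (normr_ge0 _) (rnorm_ge0 _) a2 h2.
  apply: (le_trans (lerD k1 k2)); apply: eq_lerW.
  by rewrite expr_div_n; ring.
(* The interpolation error loses e^-K, unrelated to [ell]; since e is fixed while the grid is
   refined, this loss disappears in the limit. *)
apply/ler_addgt0Pr => eps eps0.
have eta0 : 0 < eps / (D * e ^- K + 1).
  by rewrite divr_gt0// ltr_wpDl// mulr_ge0// invr_ge0 exprn_ge0// ltW.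
have [I /(_ I (leqnn _)) HI] := convergence sw ug lg K eta0.
pose dd u := dft (I + q0) psi u - psi u.
have swd : rschw (fun u => w s u * dd u) := rschwM sw (ubsm_bsm I ug).
have HDI := HD e _ _ e01 swd HI.
have -> : hr h (fun u => w s (e *: u) * psi (e *: u)) =
    hr h (fun u => w s (e *: u) * dft (I + q0) psi (e *: u)) -
    hr h (fun u => w s (e *: u) * dd (e *: u)).
  have sp : rschw (fun u => w s (e *: u) * psi (e *: u)).
    apply: (rschw_dil e01 (f := fun u => w s u * psi u)); apply: rschwM => //.
    exact: rschw_bsm.
  have sdd : rschw (fun u => w s (e *: u) * dd (e *: u)).
    exact: (rschw_dil e01 swd).
  have -> : (fun u => w s (e *: u) * dft (I + q0) psi (e *: u)) =
      fun u => w s (e *: u) * psi (e *: u) + w s (e *: u) * dd (e *: u).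
    by apply/funext => u; rewrite /dd; ring.
  by rewrite hrD// addrK.
rewrite (le_trans (ler_rnormB _ _))// lerD//.
  rewrite (le_trans (bdft _))//.
  apply: (@le_trans _ _ (4 * (C0 * ell e) * s ^- M * (C1 * B))).
    rewrite ler_wpM2l ?Hc// mulr_ge0 ?invr_ge0 ?exprn_ge0 ?(ltW s0)//.
    by rewrite mulr_ge0// mulr_ge0// ell_ge0.
  by apply: eq_lerW; ring.
apply: (le_trans HDI); rewrite mulrA.
have z0 : 0 <= D * e ^- K by rewrite mulr_ge0// invr_ge0 exprn_ge0// ltW.
move: (D * e ^- K) z0 => z z0.
by rewrite mulrA ler_pdivrMr ?ltr_wpDl// mulrC ler_wpM2l ?(ltW eps0)// lerDl.
Qed.

Lemma hr_cone_cut f e : 0 < e <= 1 -> rschw f ->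
  hr h (fun u => f (e *: u)) = hr h (fun u => cone_cut omega delta (e *: u) * f (e *: u)).
Proof.
move=> e01 sf; have /andP[ep e1] := e01.
have s1 := rschw_dil e01 sf.
have sc : rschw (fun u => f u * cone_cut omega delta u) := rschwM sf (bsm_cone_cut omega delta).
have s2 := rschw_dil e01 sc.
have -> : (fun u => cone_cut omega delta (e *: u) * f (e *: u)) =
    fun u => f (e *: u) * cone_cut omega delta (e *: u).
  by apply/funext => u; rewrite mulrC.
apply/eqP; rewrite -subr_eq0 -hrB//; apply/eqP.
apply: (hr_local0 h_continuous h_supported (U := [set u | cone_nbhd omega delta (e *: u)])).
- have -> : (fun u => f (e *: u) - f (e *: u) * cone_cut omega delta (e *: u)) =
      fun u => f (e *: u) + (-1) * (f (e *: u) * cone_cut omega delta (e *: u)).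
    by apply/funext => u; rewrite mulN1r.
  by apply: rschwD => //; exact: rschwZ.
- apply: (@open_comp _ _ (fun u : 'rV[R]_n => e *: u)); last exact: open_cone_nbhd.
  by move=> u _; exact: scaler_continuous.
- by move=> u Gu; apply: (cone_nbhd_sub delta_conj); apply: Gamma_cone.2.
by move=> u Uu; rewrite cone_cut1// mulr1 subrr.
Qed.

(* [shell] is the profile of the dyadic pieces, divided by the exponential that
   [hr_cone_exp_bound] requires; the pieces are dilations of it. *)
Definition shell u : R := expR (dotr omega u) * (cutoff 2 u - cutoff 1 u).

Lemma rschw_exp_cutoff (a b c : R) :
  rschw (fun u => expR (dotr omega u) * (a * cutoff 2 u + b * cutoff 1 u)).
Proof.
apply: (@smooth_boxsupp_rschw _ _ _ 4).
  apply: smoothM; first exact: smooth_expR_dotr.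
  by apply: smoothD; apply: smoothZ; exact: smooth_cutoff.
by move=> x j xj; rewrite !(@cutoff0 _ _ _ x) ?mulr0 ?addr0 ?mulr0//; exists j => //; lra.
Qed.

Lemma shell_dil (i : nat) u : shell (2 ^- i *: u) =
  expR (dotr (2 ^- i *: omega) u) * (cutoff (2 ^+ i.+1) u - cutoff (2 ^+ i) u).
Proof. by rewrite /shell !cutoff_scale dotrZr -dotrZl !invrK exprS mul1r. Qed.

(** The dilated shell vanishes where all |u_j| < 2^i, so K spare powers of the weight of f are worth
    2^(-iK); its derivatives are bounded uniformly in i, the dilation factor being at most 1. *)
Lemma wsup_shell N K f : rschw f -> exists B : R, 0 <= B /\ forall i : nat,
  wsup N (fun u => f u * shell (2 ^- i *: u)) (B * 2 ^- (i * K)).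
Proof.
move=> sf; have [sm /(_ (N + K)%N)[A W]] := sf; have A0 := wsup_ge0 W.
have ssh : rschw shell.
  have := rschw_exp_cutoff 1 (-1) 0; congr rschw; apply/funext => u.
  by rewrite /shell mul1r mulN1r.
have [B [B0 HB]] := rschw_bound N ssh.
exists (2 ^+ N * (A * B)); split; first by rewrite !mulr_ge0 ?exprn_ge0.
move=> i s x sN.
have p0 : 0 < 2 ^- i :> R by rewrite invr_gt0 exprn_gt0.
have p1 : 2 ^- i <= 1 :> R by rewrite invf_le1 ?exprn_gt0// exprn_ege1// ler1n.
have sg : smooth (fun u => shell (2 ^- i *: u)).
  by apply: smooth_scale; [rewrite gt_eqF|case: ssh].
have [xi|xi] := pselect (forall j, `|x 0 j| < 2 ^+ i).
  rewrite (partials_local0 (U := [set u | forall j, `|u 0 j| < 2 ^+ i])) ?normr0 ?mulr0//.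
  - by rewrite !mulr_ge0 ?exprn_ge0// invr_ge0 exprn_ge0.
  - exact: open_box.
  move=> y yi; rewrite shell_dil !(@cutoff1 _ _ _ y) ?exprn_gt0 ?subrr ?mulr0// => j.
    exact: ltW (yi j).
  by rewrite (le_trans (ltW (yi j)))// exprS ler_peMl ?exprn_ge0// ler1n.
have ex : 2 ^+ i <= 1 + enorm x.
  move: xi => /existsNP[j /negP]; rewrite -leNgt => xj.
  by rewrite (le_trans xj)// (le_trans (abs_le_enorm x j))// lerDr.
have := partialsM_le sm sg (N := N) (A := A / (1 + enorm x) ^+ (N + K)) (B := B) (x := x).
move=> /(_ _ _ s sN) H.
have {}H : `|partials s (fun u => f u * shell (2 ^- i *: u)) x| <=
    2 ^+ N * (A / (1 + enorm x) ^+ (N + K) * B).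
  apply: H => t tN.
    by apply: (wsup_pt x W); rewrite (leq_trans tN)// leq_addr.
  rewrite (partials_scale t (lt0r_neq0 p0) ssh.1).
  rewrite normrM -[leRHS]mul1r ler_pM// ?HB// normrX (gtr0_norm p0).
  by rewrite exprn_ile1// ltW.
apply: (le_trans (ler_wpM2l (exprn_ge0 _ (ltW (gt0_enorm x))) H)).
have e0' := gt0_enorm x.
rewrite exprD invfM.
have -> : (1 + enorm x) ^+ N * (2 ^+ N * (A * ((1 + enorm x) ^- N / (1 + enorm x) ^+ K) * B)) =
   2 ^+ N * (A * B) * (1 + enorm x) ^- K.
  by field; rewrite ?expf_neq0// gt_eqF.
rewrite ler_wpM2l ?mulr_ge0 ?exprn_ge0// lef_pV2 ?posrE ?exprn_gt0//.
by rewrite exprM lerXn2r ?nnegrE ?exprn_ge0 ?(ltW e0').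
Qed.

Lemma hr_dil_ell f : rschw f -> exists B : R, forall e, 0 < e < e0 ->
  rnorm (hr h (fun u => f (e *: u))) <= B * ell e.
Proof.
move=> sf; have [N [C [C0' HC]]] := hr_cone_exp_bound.
(* One power more than the cost 2^(iM) of the damping s = 2^-i, so that a summable 2^-i is left. *)
have [A [A0 HA]] := wsup_shell N M.+1 sf.
have sb : rschw (fun u => expR (dotr omega u) * (0 * cutoff 2 u + 1 * cutoff 1 u)).
  exact: (rschw_exp_cutoff 0 1 0).
(* The innermost piece, with e^{omega.u} to cancel the damping at s = 1. *)
pose psi0 u := f u * (expR (dotr omega u) * (0 * cutoff 2 u + 1 * cutoff 1 u)).
have sp0 : rschw psi0 := rschwM sf (rschw_bsm sb).
have [_ /(_ N)[A' HA']] := sp0.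
exists (C * A' + C * A * 2) => e ee; have /andP[ep e1] := ee.
have e01 : 0 < e <= 1 by rewrite ep (le_trans (ltW e1)).
have l0 := ell_ge0 ee.
rewrite (hr_cone_cut e01 sf).
pose chi := cone_cut omega delta.
have sc : rschw (fun u => f u * chi u) := rschwM sf (bsm_cone_cut omega delta).
have p1 i : 1 <= 2 ^+ i :> R by rewrite exprn_ege1// ler1n.
have p0 i : 0 < 2 ^+ i :> R by rewrite exprn_gt0.
pose P i u := f u * chi u * cutoff (2 ^+ i) u.
have sP i : rschw (P i) := rschwM sc (bsm_cutoff n (p1 i)).
have sPe i : rschw (fun u => P i (e *: u)) by exact: (rschw_dil e01 (sP i)).
(* 2 - 2 2^-i is the sum of 2^-j over j < i. *)
have HP i : rnorm (hr h (fun u => P i (e *: u))) <=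
    (C * A' + C * A * (2 - 2 * 2 ^- i)) * ell e.
  elim: i => [|i IH].
    rewrite expr0 invr1 mulr1 subrr mulr0 addr0.
    have -> : (fun u => P 0%N (e *: u)) = fun u => w 1 (e *: u) * psi0 (e *: u).
      apply/funext => u; rewrite cone_expE /psi0 /P expr0 scale1r dotrNl expRN -/chi.
      by have := expR_gt0 (dotr omega (e *: u)); move: (expR _) => z z0; field; rewrite gt_eqF.
    have bp0 : boxsupp 2 psi0.
      move=> x j xj; rewrite /psi0 mul0r add0r (@cutoff0 _ _ 1 x) ?mulr0//.
      by exists j; rewrite mulr1.
    have := HC e 1 2 psi0 A' ee _ sp0 bp0 HA'; rewrite ltr01 lexx expr1n invr1 mulr1.
    exact.
  pose psi u := f u * shell (2 ^- i *: u).
  have -> : (fun u => P i.+1 (e *: u)) = fun u => P i (e *: u) + w (2 ^- i) (e *: u) * psi (e *: u).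
    apply/funext => u; rewrite cone_expE /psi shell_dil /P dotrNl expRN -/chi.
    have := expR_gt0 (dotr (2 ^- i *: omega) (e *: u)); move: (expR _) => z z0.
    by field; rewrite gt_eqF.
  have s01 : 0 < (2 : R) ^- i <= 1.
    by apply/andP; split; [rewrite invr_gt0 p0|rewrite invf_le1 ?p1 ?p0].
  have spsi : rschw psi.
    apply: rschwM => //.
    have -> : (fun u => shell (2 ^- i *: u)) = fun u => (expR (dotr omega (2 ^- i *: u)) *
      (1 * cutoff 2 (2 ^- i *: u) + (-1) * cutoff 1 (2 ^- i *: u))).
      by apply/funext => u; rewrite /shell mul1r mulN1r.
    exact: (rschw_bsm (rschw_dil s01 (rschw_exp_cutoff 1 (-1) 0))).
  have bpsi : boxsupp (2 * 2 ^+ i.+1) psi.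
    move=> x j xj; rewrite /psi shell_dil !(@cutoff0 _ _ _ x) ?subrr ?mulr0//; exists j => //.
    by apply: le_trans xj; rewrite ler_pM2l// exprS ler_peMl ?ler1n// ltW.
  have H := HC e (2 ^- i) _ psi _ ee s01 spsi bpsi (HA i).
  have sw : rschw (fun u => w (2 ^- i) (e *: u) * psi (e *: u)).
    apply: (rschw_dil e01 (f := fun u => w (2 ^- i) u * psi u)); apply: rschwM.
      exact: rschw_cone_ecos.
    exact: rschw_bsm.
  rewrite hrD// (le_trans (ler_rnormD _ _))//.
  apply: (le_trans (lerD IH H)).
  have powE : C * (2 ^- i) ^- M * (A * 2 ^- (i * M.+1)) = C * A * 2 ^- i.
    by rewrite exprVn invrK -exprM mulnS exprD; field; rewrite !expf_neq0.
  rewrite powE -mulrDl ler_wpM2r//; apply: eq_lerW.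
  by rewrite exprS; field; rewrite expf_neq0.
have fin i : rnorm (hr h (fun u => P i (e *: u))) <= (C * A' + C * A * 2) * ell e.
  rewrite (le_trans (HP i))// ler_wpM2r// lerD2l ler_wpM2l ?mulr_ge0//.
  by rewrite gerBl mulr_ge0// invr_ge0 ltW.
apply/ler_addgt0Pr => eps eps0.
have [K [D [D0 HD]]] := hr_dil_bound h_continuous.
have z0 : 0 <= D * e ^- K by rewrite mulr_ge0// invr_ge0 exprn_ge0// ltW.
have eta0 : 0 < eps / (D * e ^- K + 1) by rewrite divr_gt0// ltr_wpDl.
have p2 i : i%:R < 2 ^+ i :> R by rewrite -natrX ltr_nat ltn_expl.
have ug := @ubsm_cutoff R n _ p1.
have [I /(_ I (leqnn _)) HI] := convergence sc ug (@loc0_cutoff R n _ p2) K eta0.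
have sd := rschwM sc (ubsm_bsm I ug).
have HDI := HD e _ _ e01 sd HI.
have -> : (fun u => cone_cut omega delta (e *: u) * f (e *: u)) =
    fun u => P I (e *: u) + f (e *: u) * chi (e *: u) * (1 + (-1) * cutoff (2 ^+ I) (e *: u)).
  by apply/funext => u; rewrite /P -/chi; ring.
rewrite hrD//; last exact: (rschw_dil e01 sd).
rewrite (le_trans (ler_rnormD _ _))// lerD// (le_trans HDI)// mulrA.
move: (D * e ^- K) z0 => z z0.
by rewrite mulrA ler_pdivrMr ?ltr_wpDl// mulrC ler_wpM2l ?(ltW eps0)// lerDl.
Qed.

End Sufficiency.

(** * From the boundary to the tube *)

Section Boundary.
Context (R : realType) (n : nat).
Implicit Types (x : 'rV[R]_n) (sigma kappa : R).

(** Members of Omega are shown to lie on its boundary by a path that leaves Omega at once: upwards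
    from sigma = 1, radially from |x| = sigma^kappa. *)
Lemma boundary_of_path (kappa : R) (p : 'rV[R]_n * R) (c : R -> 'rV[R]_n * R) :
  Omega n kappa p -> c 0 = p -> {for 0, continuous c} ->
  (forall t, 0 < t -> ~ Omega n kappa (c t)) -> boundary (Omega n kappa) p.
Proof.
move=> Op c0 cc nO; split; first exact: subset_closure.
rewrite /interior => H; have := cc (Omega n kappa); rewrite c0 => /(_ H).
move=> /nbhs_ballP[e /= e0 He]; apply: (nO (e / 2)); first by rewrite divr_gt0.
apply: He; rewrite /ball /= sub0r normrN gtr0_norm ?divr_gt0//.
by rewrite ltr_pdivrMr// ltr_pMr// ltr1n.
Qed.

Lemma boundary_Omega_top kappa x : enorm x <= 1 -> boundary (Omega n kappa) (x, 1).
Proof.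
move=> x1; apply: (@boundary_of_path _ _ (fun t => (x, 1 + t))).
- by split=> //=; rewrite powR1.
- by rewrite addr0.
- have c1 : (fun _ : R => x) t @[t --> (0 : R)] --> x by exact: cvg_cst.
  have c2 : (1 + t) @[t --> (0 : R)] --> (1 + 0 : R).
    by apply: cvgD; [exact: cvg_cst|exact: cvg_id].
  exact: (cvg_pair c1 c2).
by move=> t t0 [_ _ /=]; lra.
Qed.

Lemma boundary_Omega_side kappa x sigma : 0 < sigma <= 1 -> enorm x = sigma `^ kappa ->
  boundary (Omega n kappa) (x, sigma).
Proof.
move=> /andP[s0 s1] xs; apply: (@boundary_of_path _ _ (fun t => ((1 + t) *: x, sigma))).
- by split=> //=; rewrite xs.
- by rewrite addr0 scale1r.
- have c1 : (fun _ : R => sigma) t @[t --> (0 : R)] --> sigma by exact: cvg_cst.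
  have c2 : (1 + t) @[t --> (0 : R)] --> (1 + 0 : R).
    by apply: cvgD; [exact: cvg_cst|exact: cvg_id].
  exact: (cvg_pair (cvgZr_tmp (a := x) c2) c1).
move=> t t0 [/= h _ _]; move: h; rewrite enormZ xs gtr0_norm; last by lra.
by rewrite mulrDl mul1r gerDl leNgt mulr_gt0// powR_gt0.
Qed.

Lemma boundary_Omega_zero (p : 'rV[R]_n * R) : boundary (Omega n 0) p -> p.2 != 0 ->
  inbox 1 p.1 /\ 0 < p.2 <= 1.
Proof.
move=> [cl _] p0.
have sub : Omega n 0 `<=` [set p : 'rV[R]_n * R | (inbox 1 p.1) /\ 0 <= p.2 <= 1].
  move=> q [h1 h2 h3]; split; last by rewrite h3 ltW.
  by move=> j; rewrite (le_trans (abs_le_enorm _ j))// (le_trans h1)// powRr0.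
have cs : closed [set p : 'rV[R]_n * R | (inbox 1 p.1) /\ 0 <= p.2 <= 1].
  have -> : [set p : 'rV[R]_n * R | (inbox 1 p.1) /\ 0 <= p.2 <= 1] =
      fst @^-1` (inbox 1 : set 'rV[R]_n) `&` snd @^-1` `[0, 1]%classic.
    by apply/seteqP; split=> q /=; rewrite in_itv.
  apply: closedI; apply: closed_comp => [q _|]; try exact: cvg_fst; try exact: cvg_snd.
    by apply: compact_closed; [exact: norm_hausdorff|exact: compact_inbox].
  exact: itv_closed.
have cl2 : closure (Omega n 0) `<=` [set p : 'rV[R]_n * R | (inbox 1 p.1) /\ 0 <= p.2 <= 1].
  by rewrite [X in _ `<=` X]((closure_id _).1 cs); exact: closureS.
have [h1 /andP[h2 h3]] := cl2 p cl.
by split=> //; rewrite h3 andbT lt_neqAle eq_sym p0 h2.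
Qed.

End Boundary.

(** * From points of the boundary to the whole tube *)

Section TubeBound.
Context (R : realType) (n : nat) (E : completeNormedModType R[i]).
Variables (h : {linear schwartz R n -> E}) (Gamma : set 'rV[R]_n).
Variables (omega : 'rV[R]_n).
Local Notation F x t := (laplace Gamma h (ztube omega x t)).

Lemma powR_le_expr (rho T y : R) (m : nat) : 0 < rho -> rho <= T -> rho^-1 <= T ->
  `|y| <= m%:R -> rho `^ y <= T ^+ m.
Proof.
move=> r0 rT riT ym.
have H (z v : R) : 1 <= z -> z <= T -> v <= m%:R -> z `^ v <= T ^+ m.
  move=> z1 zT vm; have z0 := lt_le_trans ltr01 z1.
  rewrite (le_trans (ler_powR z1 vm))// powR_mulrn ?(ltW z0)//.
  by rewrite lerXn2r// nnegrE (ltW z0, le_trans (ltW z0)).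
have [r1|r1] := leP 1 rho; first by apply: H => //; exact: le_trans (ler_norm y) ym.
have -> : rho `^ y = rho^-1 `^ (- y) by rewrite powRV// powRN invrK.
apply: H => //; first by rewrite invf_ge1// ltW.
by rewrite (le_trans (ler_norm _))// normrN.
Qed.

Variables (alpha : R) (L : R -> R) (X : R).
Hypothesis X_gt0 : 0 < X.
Hypothesis L_gt0 : forall x, X <= x -> 0 < L x.
Hypothesis potter : forall x y, X <= x -> X <= y ->
  L y <= 4 * L x * (x / y + y / x) ^+ 2.

Definition ell (t : R) : R := L t^-1 / t `^ (n%:R + alpha).

Lemma ell_gt0 t : 0 < t <= X^-1 -> 0 < ell t.
Proof.
move=> /andP[t0 tX]; rewrite divr_gt0 ?powR_gt0// L_gt0//.
by rewrite -[X]invrK lef_pV2 ?posrE ?invr_gt0.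
Qed.

(** Since rho + 1/rho <= 2T, the Potter bound contributes 4 (2T)^2 = 16 T^2; the other m powers of T
    bound rho^-(n+alpha). *)
Lemma ell_potter (e rho T : R) (m : nat) : `|n%:R + alpha| <= m%:R ->
  0 < e <= X^-1 -> 0 < rho -> e * rho <= X^-1 -> rho <= T -> rho^-1 <= T ->
  ell (e * rho) <= 16 * T ^+ m.+2 * ell e.
Proof.
move=> am /andP[e0 eX] r0 erX rT riT; have T0 := lt_le_trans r0 rT.
have er0 : 0 < e * rho by rewrite mulr_gt0.
have X1 : X <= e^-1 by rewrite -[X]invrK lef_pV2 ?posrE ?invr_gt0.
have X2 : X <= (e * rho)^-1 by rewrite -[X]invrK lef_pV2 ?posrE ?invr_gt0.
have Le := L_gt0 X1.
have p1 : rho `^ (- (n%:R + alpha)) <= T ^+ m by apply: powR_le_expr => //; rewrite normrN.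
have p2 : L (e * rho)^-1 <= 16 * T ^+ 2 * L e^-1.
  apply: (le_trans (potter X1 X2)).
  have -> : e^-1 / (e * rho)^-1 + (e * rho)^-1 / e^-1 = rho + rho^-1.
    by field; rewrite !gt_eqF.
  have : (rho + rho^-1) ^+ 2 <= (2 * T) ^+ 2.
    have ri0 : 0 < rho^-1 by rewrite invr_gt0.
    by rewrite lerXn2r ?nnegrE ?mulr_ge0 ?addr_ge0 ?(ltW T0) ?(ltW r0) ?(ltW ri0)//; lra.
  move=> H; have L4 : 0 <= 4 * L e^-1 by rewrite mulr_ge0// ltW.
  apply: (le_trans (ler_wpM2l L4 H)); apply: eq_lerW; ring.
have q0 : 0 < e `^ (n%:R + alpha) by rewrite powR_gt0.
have -> : ell (e * rho) = L (e * rho)^-1 * rho `^ (- (n%:R + alpha)) / e `^ (n%:R + alpha).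
  rewrite /ell powRM ?(ltW e0) ?(ltW r0)// powRN [(_ `^ _ * _)^-1]invfM.
  by move: (L _) => z; ring.
have -> : 16 * T ^+ m.+2 * ell e = 16 * T ^+ 2 * L e^-1 * T ^+ m / e `^ (n%:R + alpha).
  by rewrite /ell !exprS; move: (L _) => z; ring.
rewrite ler_wpM2r ?invr_ge0 ?(ltW q0)//.
exact: (ler_pM (ltW (L_gt0 X2)) (powR_ge0 _ _) p2 p1).
Qed.

Hypothesis laplace_global : exists N (C : R), 0 <= C /\ forall x t, 0 < t <= 1 ->
  rnorm (F x t) <= C * ((1 + enorm x) / t) ^+ N.
Variables (k : nat) (kappa d B : R).
Hypothesis kappa01 : 0 <= kappa < 1.
Hypothesis d_gt0 : 0 < d.
Hypothesis boundary_bound : forall lam (p : 'rV[R]_n * R), 0 < lam < d ->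
  boundary (Omega n kappa) p -> p.2 != 0 ->
  p.2 ^+ k * rnorm (F (lam *: p.1) (lam * p.2)) <= B * ell lam.

(* [(x, s) = rho (x', sigma)] with [|x'| = sigma^kappa] forces
   [rho = s (|x| / s)^b], which uses [kappa < 1]; when [|x| <= s], [sigma = 1] will do. *)
Lemma exists_boundary_point (b s : R) x : b = (1 - kappa)^-1 -> 0 < s <= 1 ->
  exists rho sigma : R, [/\ 0 < rho, 0 < sigma, rho <= ((1 + enorm x) / s) `^ b,
    rho^-1 <= (1 + enorm x) / s & [/\ sigma^-1 <= ((1 + enorm x) / s) `^ b,
    rho * sigma = s & boundary (Omega n kappa) (rho^-1 *: x, sigma)]].
Proof.
move=> bE /andP[s0 s1]; have /andP[k0 k1] := kappa01.
have b0 : 0 < b by rewrite bE invr_gt0 subr_gt0.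
(* With r = |x| / s, rho = s r^b and sigma = r^-b, one has |x| / rho = r^(1-b), and this identity
   makes it sigma^kappa. *)
have bk : b * kappa = b - 1.
  by rewrite bE; field; rewrite subr_eq0 eq_sym lt_eqF.
have si : 1 <= s^-1 by rewrite invf_ge1.
have x0 := enorm_ge0 x.
have z1 : 1 <= (1 + enorm x) / s by rewrite mulr_ege1// ge1_enorm.
have zb1 : 1 <= ((1 + enorm x) / s) `^ b.
  by have := ler_powR z1 (ltW b0); rewrite powRr0.
have zs : s^-1 <= (1 + enorm x) / s by rewrite ler_peMl ?ge1_enorm// invr_ge0 ltW.
have [xs|xs] := leP (enorm x) s.
  exists s, 1; split=> //; first exact: le_trans zb1.
  split; [by rewrite invr1|by rewrite mulr1|].
  apply: boundary_Omega_top; rewrite enormZ ger0_norm ?invr_ge0 ?(ltW s0)//.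
  by rewrite mulrC ler_pdivrMr// mul1r.
pose r := enorm x / s; have r1 : 1 < r by rewrite ltr_pdivlMr// mul1r.
have r0 := lt_trans ltr01 r1.
have rb1 : 1 <= r `^ b by have := ler_powR (ltW r1) (ltW b0); rewrite powRr0.
have rb0 := lt_le_trans ltr01 rb1.
have rzb : r `^ b <= ((1 + enorm x) / s) `^ b.
  rewrite ge0_ler_powR ?nnegrE ?(ltW b0) ?(ltW r0)//; first exact: le_trans z1.
  by rewrite ler_wpM2r ?invr_ge0 ?(ltW s0)// lerDr.
exists (s * r `^ b), (r `^ b)^-1; split.
- by rewrite mulr_gt0.
- by rewrite invr_gt0.
- by rewrite (le_trans _ rzb)// ler_piMl// ltW.
- rewrite invfM (le_trans _ zs)// ler_piMr ?invr_ge0 ?(ltW s0)//.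
  by rewrite invf_le1.
split; [by rewrite invrK|by rewrite mulfK// gt_eqF|].
apply: boundary_Omega_side; first by rewrite invr_gt0 rb0 invf_le1.
rewrite enormZ ger0_norm ?invr_ge0 ?mulr_ge0 ?(ltW s0) ?(ltW rb0)//.
rewrite powRV// -powRrM bk powRB ?(ltW r0)//; last by apply/implyP => _; rewrite gt_eqF.
rewrite powRr1 ?(ltW r0)// invf_div.
have -> : enorm x = r * s by rewrite divfK// gt_eqF.
by field; rewrite !gt_eqF.
Qed.

(** The boundary hypothesis is applied at lambda = e rho, and [ell_potter] compares [ell (e rho)]
    with [ell e]. If e rho is not small, then 1/e is itself at most a power of (1 + |x|) / s up to a
    constant, and the a priori bound is enough. *)
Lemma tube_bound_of_boundary : exists (e0 C0 : R) (M : nat),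
  [/\ 0 < e0, e0 <= 1, 0 <= C0, forall e, 0 < e < e0 -> 0 < ell e &
   forall e s x, 0 < e < e0 -> 0 < s <= 1 ->
   rnorm (F (e *: x) (e * s)) <= C0 * ((1 + enorm x) / s) ^+ M * ell e].
Proof.
have [N [C1 [C10 HC1]]] := laplace_global.
pose e0 : R := Num.min (d / 2) (Num.min 1 X^-1).
have e00 : 0 < e0 by rewrite !lt_min divr_gt0//= ltr01 invr_gt0.
have e0d : e0 < d by rewrite (@le_lt_trans _ _ (d / 2)) ?ge_min ?lexx// ltr_pdivrMr// ltr_pMr// ltr1n.
have e01 : e0 <= 1 by rewrite !ge_min lexx orbT.
have e0X : e0 <= X^-1 by rewrite !ge_min lexx !orbT.
pose b := (1 - kappa)^-1; pose m' := Num.bound b; pose m := Num.bound `|n%:R + alpha|.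
have am : `|n%:R + alpha| <= m%:R by rewrite ltW// archi_boundP.
have b0 : 0 < b by have /andP[_ k1] := kappa01; rewrite invr_gt0 subr_gt0.
have bm : b <= m'%:R by rewrite ltW// archi_boundP// ltW.
have l0 e : 0 < e <= e0 -> 0 < ell e.
  by move=> /andP[h1 h2]; apply: ell_gt0; rewrite h1 (le_trans h2).
have le0 : 0 < ell e0 by rewrite l0// e00 lexx.
have K0 : 0 <= 16 * (C1 * e0 ^- N / ell e0).
  apply: mulr_ge0 => //; apply: divr_ge0 (ltW le0).
  by rewrite mulr_ge0// invr_ge0 exprn_ge0// ltW.
(* T = z^(m'+1) dominates both z and z^b. Its exponents are k for sigma^-k, m + 2 for [ell_potter]
   and N for the a priori bound, which adds z^N. *)
pose M := (m'.+1 * (k + m.+2 + N) + N)%N.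
exists e0, (16 * `|B| + 16 * (C1 * e0 ^- N / ell e0)), M; split => //.
- by rewrite addr_ge0// mulr_ge0.
- by move=> e /andP[h1 h2]; rewrite l0// h1 ltW.
move=> e s x /andP[ep ee] s01; have /andP[s0 s1] := s01.
have le : 0 < ell e by rewrite l0// ep ltW.
have [rho [sigma [rho0 sig0 rhob rhoi [sigi rs bd]]]] := exists_boundary_point x erefl s01.
move: rhob rhoi sigi; set z := (1 + enorm x) / s => rhob rhoi sigi.
have z1 : 1 <= z.
  by rewrite mulr_ege1 ?ge1_enorm// invf_ge1.
have z0 := lt_le_trans ltr01 z1.
pose T := z ^+ m'.+1.
have zT : z <= T by rewrite /T exprS ler_peMr ?(ltW z0)// exprn_ege1.
have bT : z `^ b <= T.
  rewrite (le_trans (ler_powR z1 bm))// powR_mulrn ?(ltW z0)//.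
  by rewrite ler_weXn2l.
have T1 := le_trans z1 zT; have T0 := lt_le_trans ltr01 T1.
have {}rhob := le_trans rhob bT; have {}rhoi := le_trans rhoi zT.
have {}sigi := le_trans sigi bT.
have zM i j : (i <= k + m.+2 + N)%N -> (j <= N)%N -> T ^+ i * z ^+ j <= z ^+ M.
  move=> iM jN; rewrite /T -exprM -exprD ler_weXn2l// leq_add//.
  by rewrite leq_mul2l iM.
have eX : 0 < e <= X^-1 by rewrite ep (le_trans (ltW ee)).
rewrite mulrDl mulrDl.
have [lame|lame] := ltP (e * rho) e0.
  have lam0 : 0 < e * rho < d by rewrite mulr_gt0//= (lt_trans lame).
  have := boundary_bound lam0 bd (lt0r_neq0 sig0); rewrite /=.
  rewrite scalerA -mulrA divff ?gt_eqF// mulr1 -mulrA rs => H.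
  have lp := ell_potter am eX rho0 (le_trans (ltW lame) e0X) rhob rhoi.
  have ler : 0 < ell (e * rho) by apply: l0; rewrite mulr_gt0//= ltW.
  have sk : 0 < sigma ^+ k by rewrite exprn_gt0.
  rewrite -[leLHS]addr0 lerD//; last first.
    by apply: mulr_ge0 (ltW le); rewrite mulr_ge0// exprn_ge0// ltW.
  have h1 : rnorm (F (e *: x) (e * s)) <= `|B| * ell (e * rho) * sigma ^- k.
    rewrite ler_pdivlMr// mulrC (le_trans H)// ler_wpM2r ?(ltW ler)//; exact: ler_norm.
  apply: (le_trans h1).
  apply: (@le_trans _ _ (`|B| * (16 * T ^+ m.+2 * ell e) * T ^+ k)).
    apply: ler_pM.
    - exact: mulr_ge0 (normr_ge0 _) (ltW ler).
    - by rewrite invr_ge0 ltW.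
    - by rewrite ler_wpM2l.
    by rewrite -exprVn lerXn2r ?nnegrE ?invr_ge0 ?(ltW sig0) ?(ltW T0).
  have -> : `|B| * (16 * T ^+ m.+2 * ell e) * T ^+ k = 16 * `|B| * (T ^+ (m.+2 + k) * z ^+ 0) * ell e.
    by rewrite exprD expr0; ring.
  rewrite ler_wpM2r ?(ltW le)// ler_wpM2l ?mulr_ge0// zM//.
  by rewrite addnC leq_addr.
(* Here e rho >= e0, so 1/e <= T / e0; [ell e] is compared with the constant [ell e0], the ratio e0
   / e being admissible in [ell_potter]. *)
have e0e : 0 < e0 / e by rewrite divr_gt0.
have e0T : e0 / e <= T by rewrite (le_trans _ rhob)// ler_pdivrMr// mulrC.
have ei : (e0 / e)^-1 <= T by rewrite invf_div (le_trans _ T1)// ler_pdivrMr// mul1r ltW.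
have Ee : e * (e0 / e) = e0 by field; rewrite gt_eqF.
have := ell_potter am eX e0e; rewrite Ee => /(_ T e0X e0T ei) lp.
rewrite -[leLHS]add0r lerD//.
  by apply: mulr_ge0 (ltW le); rewrite mulr_ge0 ?mulr_ge0// exprn_ge0// ltW.
have es01 : 0 < e * s <= 1.
  by rewrite mulr_gt0//= mulr_ile1 ?(ltW ep) ?(ltW s0)// (le_trans (ltW ee)).
apply: (le_trans (HC1 _ _ es01)).
have h1 : (1 + enorm (e *: x)) / (e * s) <= z * (T / e0).
  have e1 : 1 + enorm (e *: x) <= 1 + enorm x.
    rewrite lerD2l enormZ gtr0_norm// ler_piMl ?enorm_ge0//.
    by rewrite (le_trans (ltW ee)).
  have e2 : e^-1 <= T / e0 by rewrite ler_pdivlMr// mulrC.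
  have -> : (1 + enorm (e *: x)) / (e * s) = (1 + enorm (e *: x)) / s * e^-1.
    by rewrite invfM [e^-1 * _]mulrC mulrA.
  rewrite ler_pM ?invr_ge0 ?(ltW ep)//.
    by rewrite divr_ge0 ?(ltW s0)// ltW// gt0_enorm.
  by rewrite ler_wpM2r// invr_ge0 ltW.
have h0 : 0 <= (1 + enorm (e *: x)) / (e * s).
  by rewrite divr_ge0 ?(ltW (gt0_enorm _))//; case/andP: es01 => /ltW.
have h2 : ((1 + enorm (e *: x)) / (e * s)) ^+ N <= (z * (T / e0)) ^+ N.
  by rewrite lerXn2r ?nnegrE// (le_trans h0).
apply: (le_trans (ler_wpM2l C10 h2)).
have D0 : 0 <= C1 * (z * (T / e0)) ^+ N.
  by rewrite mulr_ge0// exprn_ge0// (le_trans h0).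
apply: (@le_trans _ _ (C1 * (z * (T / e0)) ^+ N * (16 * T ^+ m.+2 * ell e / ell e0))).
  by rewrite ler_peMr// ler_pdivlMr// mul1r.
have -> : C1 * (z * (T / e0)) ^+ N * (16 * T ^+ m.+2 * ell e / ell e0) =
    16 * (C1 * e0 ^- N / ell e0) * (T ^+ (m.+2 + N) * z ^+ N) * ell e.
  have gen (c v t i l l' : R) : c * (v * (t * i)) ^+ N * (16 * t ^+ m.+2 * l * l') =
      16 * (c * i ^+ N * l') * (t ^+ (m.+2 + N) * v ^+ N) * l.
    by rewrite exprD !exprMn; ring.
  by rewrite gen exprVn.
rewrite ler_wpM2r ?(ltW le)// ler_wpM2l//.
by rewrite zM// -addnA leq_addl.
Qed.

End TubeBound.

(** * Equivalence of quasiasymptotic boundedness and boundary growth *)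

Theorem theorem7p2 (R : realType) (n : nat) (E : completeNormedModType R[i])
    (Gamma : set 'rV[R]_n) (h : {linear schwartz R n -> E})
    (alpha : R) (L : R -> R)
    (Gamma_closed : closed Gamma)
    (Gamma_convex : convex_set (Gamma : set (convex_lmodType 'rV[R]_n)))
    (Gamma_cone : is_cone Gamma)
    (Gamma_acute : acute Gamma)
    (h_continuous : continuous h)
    (h_supported : supported_by Gamma h)
    (L_slowly_varying : slowly_varying L) :
  quasiasymptotically_bounded h alpha L <->
  exists (k : nat) (kappa : R) (omega : 'rV[R]_n),
    [/\ 0 <= kappa, kappa < 1, open_conj_cone Gamma omega &
     (limf_esup (fun lambda : R =>
        ereal_sup [set (p.2 ^+ k * lambda `^ (n%:R + alpha) / L (lambda^-1) *
            rnorm (laplace Gamma h (lambda%:C *: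
              (cvec p.1 + ('i%C * p.2%:C) *: cvec omega))))%R%:E
          | p in [set p | boundary (Omega n kappa) p /\ p.2 != 0%R]])
      0^'+ < +oo)%E].
Proof.
have [X [X0 Lpos potter]] := slowly_varying_potter L_slowly_varying.
have Linv t : 0 < t < X^-1 -> 0 < L t^-1.
  move=> /andP[t0 tX]; apply: Lpos.
  by rewrite -[X]invrK lef_pV2 ?posrE ?invr_gt0// ltW.
have Xi0 : 0 < X^-1 by rewrite invr_gt0.
split=> [qb|[k [kappa [omega [k0 k1 omegaC]]]]].
  have [omega omegaC] := Gamma_acute.
  have [delta [delta0 deltaC]] := open_conj_cone_delta omegaC.
  have [|k [d [B [d0 H]]]] := quasi_to_laplace h_continuous h_supported Gamma_cone
    delta0 deltaC (alpha := alpha) (L := L) (ex_intro _ _ (conj Xi0 Linv)).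
    move=> phi; have /limsup_pinfty_bounded[A [B HB]] := qb phi.
    (* Dilations at infinity become small parameters t = 1 / lambda; below this threshold 1 / t
       exceeds A. *)
    exists (`|A| + 1)^-1, B; split; first by rewrite invr_gt0 ltr_wpDl.
    move=> t /andP[t0 tA].
    have At : A < t^-1.
      rewrite (@lt_trans _ _ (`|A| + 1))//; first by rewrite (le_lt_trans (ler_norm A))// ltrDl.
      by rewrite -[ltLHS]invrK ltf_pV2 ?posrE ?invr_gt0 ?ltr_wpDl.
    by have := HB _ At; rewrite /pairing_dilate quasi_factor.
  (* For kappa = 0 the boundary points with sigma nonzero lie in the cylinder |x_j| <= 1, 0 < sigma
     <= 1 on which the estimate was obtained. *)
  exists k, 0, omega; split=> //.
  apply/limsup_right_bounded; exists (Num.min d 1), B; split.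
    by rewrite lt_min d0 ltr01.
  move=> t [x s] /andP[t0]; rewrite lt_min => /andP[td t1] /= [bxs s0].
  have [/= xb s01] := boundary_Omega_zero bxs s0.
  rewrite ztubeZ -[s ^+ k * _ / _]mulrA; apply: H => //; by rewrite t0 td.
move=> /limsup_right_bounded[d [B [d0 H]]].
have [delta [delta0 deltaC]] := open_conj_cone_delta omegaC.
have k01 : 0 <= kappa < 1 by rewrite k0 k1.
have lg := laplace_bound h_continuous h_supported delta0 deltaC.
have bb lam (p : 'rV[R]_n * R) : 0 < lam < Num.min d X^-1 ->
    boundary (Omega n kappa) p -> p.2 != 0 ->
    p.2 ^+ k * rnorm (laplace Gamma h (ztube omega (lam *: p.1) (lam * p.2))) <=
    B * ell n alpha L lam.
  move=> /andP[l0]; rewrite lt_min => /andP[ld lX] bp p0.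
  have := H lam p _ (conj bp p0); rewrite l0 ld ztubeZ => /(_ isT) h1.
  have Ll : 0 < L lam^-1 by apply: Linv; rewrite l0.
  have pl : 0 < lam `^ (n%:R + alpha) by rewrite powR_gt0.
  rewrite /ell mulrA ler_pdivlMr// -ler_pdivrMr//; apply: le_trans h1.
  by apply: eq_lerW; ring.
have dX : 0 < Num.min d X^-1 by rewrite lt_min d0.
have [e0 [C0 [M [e00 e01 C00 l0 tb]]]] := tube_bound_of_boundary X0 Lpos potter lg k01 dX bb.
move=> phi; apply/limsup_pinfty_bounded.
have sr := rschw_Re phi; have si := rschw_Im phi.
have l0' e : 0 < e < e0 -> 0 <= ell n alpha L e by move=> /l0/ltW.
have key f := hr_dil_ell h_continuous h_supported Gamma_cone delta0 deltaC e01 C00 l0' tb (f := f).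
(* The real and imaginary parts of the test function are estimated separately. *)
have [B1 HB1] := key _ sr; have [B2 HB2] := key _ si.
exists e0^-1, (B1 + B2) => t te.
have t0 : 0 < t by apply: lt_trans te; rewrite invr_gt0.
have ee : 0 < t^-1 < e0.
  by rewrite invr_gt0 t0/= -[ltRHS]invrK ltf_pV2 ?posrE ?invr_gt0.
have t10 : 0 < t^-1 by rewrite invr_gt0.
have := quasi_factor n alpha (L t) (h (dilate t phi)) t10; rewrite !invrK => ->.
have := h_dilate h phi t10; rewrite invrK => ->.
have le := l0 _ ee.
have -> : t^-1 `^ (n%:R + alpha) / L t = (ell n alpha L t^-1)^-1.
  by rewrite /ell invrK invf_div.
rewrite mulrC ler_pdivrMr// (le_trans (ler_rnormD _ _))// rnorm_i mulrDl.
exact: (lerD (HB1 _ ee) (HB2 _ ee)).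
Qed.
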